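(* Suppose $N$ is odd and $m$ is even. For $k\ge1$ let $a_k$ (respectively $b_k$) be the dimension of the Hodge degree $k$ part of the defect $0$ homology $H_0$ (respectively defect $1$ homology $H_1$) of the two-loop hairy graph-complex $0\to\mathcal C_2\to\mathcal C_1\to\mathcal C_0\to 0$ with rational coefficients. Then $$a_k=\begin{cases}0& k\equiv0,1\bmod4,\\ \lfloor\frac{k}{12}\rfloor & k\equiv2\bmod4,\\ \lceil\frac{k+2}{12}\rceil & k\equiv3\bmod4,\end{cases}\qquad b_k=\begin{cases}0& k\equiv2,3\bmod4,\\ \lfloor\frac{k-1}{12}\rfloor & k\equiv0\bmod4,\\ \lceil\frac{k}{12}\rceil & k\equiv1\bmod4.\end{cases}$$
   Context: Let $m,N$ be positive integers; all coefficients are in $\mathbb Q$. Graph-complex $\mathcal E^{m,N}_\pi$. It is spanned by connected graphs (self-loops and multiple edges allowed) with a non-empty finite set of unlabeled external vertices of valence $1$ and a possibly empty finite set of unlabeled internal vertices of valence $\ge3$. The orientation set of a graph is the union of its external vertices (each of degree $-m$), internal vertices (each of degree $-N$) and edges (each of degree $N-1$). An orientation of a graph is a total order of its orientation set together with an orientation of every edge. Isomorphic oriented graphs (isomorphism respecting adjacency, edge orientations and the order) are identified. One takes the quotient of the $\mathbb Q$-vector space spanned by isomorphism classes of oriented graphs by the relations: reversing the orientation of one edge multiplies by $(-1)^N$; permuting the orientation set multiplies by the Koszul sign of the permutation, computed from the degrees of the elements. The differential $\partial\Upsilon$ is the sum, over all internal vertices $v$ and all unordered partitions of the half-edges at $v$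 into two sets of size $\ge2$, of the graph obtained by replacing $v$ by a new edge joining two vertices, the half-edges of one set being attached to one endpoint and those of the other set to the other endpoint; one endpoint is regarded as the old vertex $v$, the other one as the new vertex; the new vertex and the new edge are added as the first and second elements of the ordered orientation set, and the new edge is oriented from the old vertex to the new one (the choice of which endpoint is new does not matter). Hairy graphs. An edge of a connected graph is tree-type if removing it disconnects the graph into two parts, exactly one of which is a tree. The frame is the subgraph generated by the edges that are not tree-type. A hair is a tree-type edge one of whose endpoints is univalent and whose other endpoint lies in the frame and has no other tree-type edges adjacent to it. A vertex is a cut vertex if removing it (as a point of the topological space) disconnects the graph. A two-loop hairy graph is a connected graph (self-loops and multiple edges allowed) with a non-empty finite set of unlabeled external vertices of valence $1$ and a finite set of unlabeled internal vertices of valence $\ge3$, of first Betti number $2$, whose frame has no cut vertices and all of whose tree-type edges are hairs; its frame is a (subdivided) $\Theta$-graph. The Hodge degree is the number of external vertices (i.e. of hairs). The defect is $\sum_v(|v|-3)$ over the internal vertices $v$, where $|v|$ is the valence; for two-loop hairy graphs it is $0$, $1$ or $2$. Let $\mathcal C_i\subset\mathcal E^{m,N}_\pi$ be the span of the two-loop hairy graphs of defect $i$. The differential $\partial$ preserves Hodge degree and lowers the defect by $1$, giving the two-loop hairy graph-complex $0\to\mathcal C_2\xrightarrow{\partial_2}\mathcal C_1\xrightarrow{\partial_1}\mathcal C_0\to0$, with $H_i=\ker\partial_i/\operatorname{im}\partial_{i+1}$. *)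

(* Defs.v *)
From HB Require Import structures.
From mathcomp Require Import all_boot all_order all_algebra perm.
From mathcomp Require Import boolp finmap.
From mathcomp.multinomials Require Import monalg.

Set Implicit Arguments.
Unset Strict Implicit.
Unset Printing Implicit Defensive.

Import GRing.Theory Num.Theory.

Local Open Scope ring_scope.
Local Open Scope quotient_scope.

(** * Linear algebra over the rationals *)

Section Span.
Variables (V : lmodType rat) (G : V -> Prop).

Definition lspan (x : V) : Prop :=
  exists (r : nat) (c : 'I_r -> rat) (g : 'I_r -> V),
    (forall i, G (g i)) /\ x = \sum_i c i *: g i.

Lemma lspan0 : lspan 0.
Proof.
exists 0%N, (fun=> 0), (fun=> 0); split; first by case.
by rewrite big_ord0.
Qed.

Lemma lspan_gen x : G x -> lspan x.
Proof.
by move=> Gx; exists 1%N, (fun=> 1), (fun=> x); rewrite big_ord1 scale1r.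
Qed.

Lemma lspanD x y : lspan x -> lspan y -> lspan (x + y).
Proof.
move=> [r [c [g [Gg ->]]]] [r' [c' [g' [Gg' ->]]]].
exists (r + r')%N.
exists (fun i => match split i with inl j => c j | inr j => c' j end).
exists (fun i => match split i with inl j => g j | inr j => g' j end).
split=> [i|]; first by case: (split i).
rewrite big_split_ord; congr (_ + _); apply: eq_bigr => i _.
  by rewrite (unsplitK (inl i : 'I_r + 'I_r')%type).
by rewrite (unsplitK (inr i : 'I_r + 'I_r')%type).
Qed.

Lemma lspanZ a x : lspan x -> lspan (a *: x).
Proof.
move=> [r [c [g [Gg ->]]]]; exists r, (fun i => a * c i), g; split=> //.
by rewrite scaler_sumr; apply: eq_bigr => i _; rewrite scalerA.
Qed.

Lemma lspanN x : lspan x -> lspan (- x).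
Proof. by rewrite -scaleN1r; apply: lspanZ. Qed.

End Span.

(* [subquotient_dim Z B d]: the quotient [Z / B] has dimension [d]. *)
Definition subquotient_dim (V : lmodType rat) (Z B : V -> Prop) (d : nat) :=
  exists e : 'I_d -> V,
    [/\ forall i, Z (e i),
        forall c : 'I_d -> rat, B (\sum_i c i *: e i) -> forall i, c i = 0
      & forall z, Z z -> exists c : 'I_d -> rat, B (z - \sum_i c i *: e i)].

Section Quotient.
Variables (V : lmodType rat) (G : V -> Prop).

Definition qeq (x y : V) : bool := `[< lspan G (x - y) >].

Lemma qeq_refl : reflexive qeq.
Proof. by move=> x; apply/asboolP; rewrite subrr; apply: lspan0. Qed.

Lemma qeq_sym : symmetric qeq.
Proof.
by move=> x y; apply/asboolP/asboolP => /lspanN; rewrite opprB.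
Qed.

Lemma qeq_trans : transitive qeq.
Proof.
move=> y x z /asboolP xy /asboolP yz; apply/asboolP.
by have := lspanD xy yz; rewrite addrA subrK.
Qed.

Canonical qeq_equiv := EquivRel qeq qeq_refl qeq_sym qeq_trans.

(* The quotient of [V] by the subspace spanned by [G]. *)
Definition quotmod := {eq_quot qeq}.
HB.instance Definition _ := Choice.on quotmod.
HB.instance Definition _ := EqQuotient.on quotmod.

Definition qpi (x : V) : quotmod := \pi x.

Lemma qpiP x y : qpi x = qpi y <-> lspan G (x - y).
Proof.
split=> [/eqP|H]; first by rewrite eqmodE => /asboolP.
by apply/eqP; rewrite eqmodE; apply/asboolP.
Qed.

Lemma qpi_repr (x : quotmod) : qpi (repr x) = x.
Proof. exact: reprK. Qed.

Definition qadd (x y : quotmod) := qpi (repr x + repr y).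
Definition qopp (x : quotmod) := qpi (- repr x).
Definition qscale (a : rat) (x : quotmod) := qpi (a *: repr x).

Lemma qaddE x y : qadd (qpi x) (qpi y) = qpi (x + y).
Proof.
apply/qpiP; rewrite opprD addrACA.
by apply: lspanD; apply/qpiP; apply: qpi_repr.
Qed.

Lemma qoppE x : qopp (qpi x) = qpi (- x).
Proof.
by apply/qpiP; rewrite -opprD; apply/lspanN/qpiP/qpi_repr.
Qed.

Lemma qscaleE a x : qscale a (qpi x) = qpi (a *: x).
Proof.
by apply/qpiP; rewrite -scalerBr; apply/lspanZ/qpiP/qpi_repr.
Qed.

Lemma qind (P : quotmod -> Prop) : (forall x, P (qpi x)) -> forall x, P x.
Proof. by move=> H x; rewrite -(qpi_repr x). Qed.

Lemma qaddA : associative qadd.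
Proof.
by elim/qind=> x; elim/qind=> y; elim/qind=> z; rewrite !qaddE addrA.
Qed.

Lemma qaddC : commutative qadd.
Proof. by elim/qind=> x; elim/qind=> y; rewrite !qaddE addrC. Qed.

Lemma qadd0 : left_id (qpi 0) qadd.
Proof. by elim/qind=> x; rewrite !qaddE add0r. Qed.

Lemma qaddN : left_inverse (qpi 0) qopp qadd.
Proof. by elim/qind=> x; rewrite qoppE !qaddE addNr. Qed.

HB.instance Definition _ := GRing.isZmodule.Build quotmod
  qaddA qaddC qadd0 qaddN.

Lemma qpiD x y : qpi (x + y) = qpi x + qpi y.
Proof. by rewrite -qaddE. Qed.

Lemma qscaleA a b v : qscale a (qscale b v) = qscale (a * b) v.
Proof. by elim/qind: v => x; rewrite !qscaleE scalerA. Qed.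

Lemma qscale1 : left_id 1 qscale.
Proof. by elim/qind=> x; rewrite !qscaleE scale1r. Qed.

Lemma qscaleDr : right_distributive qscale +%R.
Proof.
by move=> a; elim/qind=> x; elim/qind=> y; rewrite -qpiD !qscaleE scalerDr qpiD.
Qed.

Lemma qscaleDl v : {morph qscale^~ v : a b / a + b}.
Proof.
by move=> a b; elim/qind: v => x; rewrite !qscaleE scalerDl qpiD.
Qed.

HB.instance Definition _ := GRing.Zmodule_isLmodule.Build rat quotmod
  qscaleA qscale1 qscaleDr qscaleDl.

Lemma qpi_is_linear : linear qpi.
Proof. by move=> a x y; rewrite qpiD -qscaleE. Qed.
HB.instance Definition _ :=
  GRing.isLinear.Build rat V quotmod _ qpi qpi_is_linear.

Lemma qpi_eq0 x : G x -> qpi x = 0.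
Proof.
by move=> Gx; rewrite -(raddf0 qpi); apply/qpiP; rewrite subr0; apply: lspan_gen.
Qed.

Section Descend.
Variables (W : lmodType rat) (f : {linear V -> W}).

Definition descend (fG : forall x, G x -> f x = 0) (x : quotmod) : W :=
  f (repr x).

Variable fG : forall x, G x -> f x = 0.

Lemma descendE x : descend fG (qpi x) = f x.
Proof.
apply/eqP; rewrite /descend -subr_eq0 -linearB; apply/eqP.
have /qpiP[r [c [g [Gg ->]]]] := qpi_repr (qpi x).
by rewrite linear_sum big1 // => i _; rewrite linearZ /= fG ?scaler0.
Qed.

Lemma descend_is_linear : linear (descend fG).
Proof.
move=> a x y; rewrite -(qpi_repr x) -(qpi_repr y).
by rewrite -(linearP qpi) !descendE linearP.
Qed.
HB.instance Definition _ :=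
  GRing.isLinear.Build rat quotmod W _ (descend fG) descend_is_linear.

End Descend.
End Quotient.

Section FreeModule.
Variables (K : choiceType) (W : lmodType rat) (phi : K -> W).

(* The linear extension of [phi] to the free module on [K]. *)
Definition lin_ext (x : {malg rat[K]}) : W :=
  \sum_(k <- msupp x) x@_k *: phi k.

Lemma lin_extEw (x : {malg rat[K]}) (D : {fset K}) :
  fsubset (msupp x) D -> lin_ext x = \sum_(k <- D) x@_k *: phi k.
Proof.
move=> sD; rewrite /lin_ext; apply: big_fset_incl => // k _.
by move/mcoeff_outdom => ->; rewrite scale0r.
Qed.

Lemma lin_ext_is_linear : linear lin_ext.
Proof.
move=> a x y.
pose D := fsetU (msupp (a *: x + y)) (fsetU (msupp x) (msupp y)).
rewrite !(@lin_extEw _ D) ?fsubsetUl //; last 2 first.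
- by rewrite /D fsetUA fsubsetUr.
- by rewrite /D fsetUCA fsubsetUl.
rewrite scaler_sumr -big_split /=; apply: eq_bigr => k _.
by rewrite mcoeffD mcoeffZ scalerDl scalerA.
Qed.
HB.instance Definition _ :=
  GRing.isLinear.Build rat {malg rat[K]} W _ lin_ext lin_ext_is_linear.

Lemma lin_extU k : lin_ext << k >> = phi k.
Proof.
by rewrite (@lin_extEw _ [fset k]%fset) ?msuppU_le // big_seq_fset1 mcoeffUU scale1r.
Qed.

End FreeModule.

(** * Graphs *)

(* A graph has external vertices ['I_k], internal vertices ['I_n] and directed
   edges ['I_q].  The half-edges of the edge [e] are [(e, false)], at its
   source, and [(e, true)], at its target. *)
Notation vertex k n := ('I_k + 'I_n)%type.
Notation half q := ('I_q * bool)%type.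
Notation graph k n q := {ffun half q -> vertex k n}.

(* The vertices and the edges of a graph; this is also its orientation set.
   As a topological space the graph is the disjoint union of the vertices and
   of the open edges. *)
Notation cell k n q := ('I_k + 'I_n + 'I_q)%type.

Section Graph.
Variables (k n q : nat) (g : graph k n q).

Definition star (v : vertex k n) : {set half q} := [set h | g h == v].

Definition valence (v : vertex k n) : nat := #|star v|.

Definition incident (x y : cell k n q) : bool :=
  match x, y with
  | inl v, inr e | inr e, inl v => (g (e, false) == v) || (g (e, true) == v)
  | _, _ => false
  end.

Definition incident_in (S : {set cell k n q}) : rel (cell k n q) :=
  fun x y => [&& x \in S, y \in S & incident x y].

(* Connectedness of the subspace [S], an arbitrary union of vertices and open
   edges, and the connected component of [x] in it. *)
Definition connected (S : {set cell k n q}) : bool :=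
  [forall x in S, forall y in S, connect (incident_in S) x y].

Definition component (S : {set cell k n q}) (x : cell k n q) :
    {set cell k n q} :=
  [set y in S | connect (incident_in S) x y].

(* The first Betti number of a connected subgraph [S]. *)
Definition betti1 (S : {set cell k n q}) : nat :=
  (#|[set e | inr e \in S]| + 1 - #|[set v | inl v \in S]|)%N.

Definition is_tree (S : {set cell k n q}) : bool :=
  connected S && (betti1 S == 0%N).

(* In a connected graph, removing an edge leaves the component of its source
   and that of its target. *)
Definition tree_type (e : 'I_q) : bool :=
  let S := ~: [set inr e] in
  ~~ connected S &&
  (is_tree (component S (inl (g (e, false))))
     (+) is_tree (component S (inl (g (e, true))))).

Definition frame : {set cell k n q} :=
  [set x | match x with
           | inl v => [exists h in star v, ~~ tree_type h.1]
           | inr e => ~~ tree_type e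
           end].

Definition hair (e : 'I_q) : bool :=
  tree_type e &&
  [exists b, [&& valence (g (e, b)) == 1%N,
                 inl (g (e, ~~ b)) \in frame &
                 [forall h in star (g (e, ~~ b)),
                    tree_type h.1 ==> (h.1 == e)]]].

Definition cut_vertex (S : {set cell k n q}) (v : vertex k n) : bool :=
  (inl v \in S) && ~~ connected (S :\ inl v).

Definition admissible : bool :=
  [&& (0 < k)%N, connected setT,
      [forall i : 'I_k, valence (inl i) == 1%N] &
      [forall j : 'I_n, (3 <= valence (inr j))%N]].

Definition two_loop_hairy : bool :=
  [&& admissible, betti1 setT == 2%N, [forall v, ~~ cut_vertex frame v] &
      [forall e, tree_type e ==> hair e]].

Definition defect : nat := (\sum_(j < n) (valence (inr j) - 3))%N.

Definition flip (e : 'I_q) : graph k n q :=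
  [ffun h => g (h.1, h.2 (+) (h.1 == e))].

End Graph.

(** * Oriented graphs *)

(* A total order on the orientation set, as its increasing enumeration. *)
Definition total_order (T : finType) (s : seq T) : bool :=
  uniq s && [forall x, x \in s].

Notation pregraph k n q := (graph k n q * seq (cell k n q))%type.

Record ograph k n q := OGraph {
  ogval :> pregraph k n q;
  _ : admissible ogval.1 && total_order ogval.2
}.

HB.instance Definition _ k n q := [isSub for @ogval k n q].
HB.instance Definition _ k n q := [Choice of ograph k n q by <:].

(* Oriented graphs with any numbers of vertices and edges. *)
Definition any_ograph := {t : nat * nat * nat & ograph t.1.1 t.1.2 t.2}.

Definition any k n q (G : ograph k n q) : any_ograph :=
  existT (fun t : nat * nat * nat => ograph t.1.1 t.1.2 t.2) (k, n, q) G.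

HB.instance Definition _ := Choice.on any_ograph.

Section Isomorphism.
Variables (k n q : nat).
Variables (fx : {perm 'I_k}) (fi : {perm 'I_n}) (fe : {perm 'I_q}).

Definition vertex_map (v : vertex k n) : vertex k n :=
  match v with inl i => inl (fx i) | inr j => inr (fi j) end.

Definition cell_map (x : cell k n q) : cell k n q :=
  match x with inl v => inl (vertex_map v) | inr e => inr (fe e) end.

Definition is_iso (G G' : pregraph k n q) : Prop :=
  (forall e b, G'.1 (fe e, b) = vertex_map (G.1 (e, b))) /\
  G'.2 = map cell_map G.2.

End Isomorphism.

Definition degree (m N : nat) k n q (x : cell k n q) : int :=
  match x with
  | inl (inl _) => - m%:Z
  | inl (inr _) => - N%:Z
  | inr _ => N%:Z - 1
  end.

(* The Koszul sign of the permutation taking the enumeration [s] to [s']. *)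
Definition koszul (m N : nat) k n q (s s' : seq (cell k n q)) : rat :=
  \prod_x \prod_(y | (index x s < index y s)%N && (index y s' < index x s')%N)
    (-1) ^ (degree m N x * degree m N y).

(** * The graph-complex *)

Inductive relator (m N : nat) : {malg rat[any_ograph]} -> Prop :=
| relator_iso k n q (G G' : ograph k n q) fx fi fe of
    is_iso fx fi fe G G' :
    relator m N (<< any G' >> - << any G >>)
| relator_flip k n q (G G' : ograph k n q) (e : 'I_q) of
    G'.1 = flip G.1 e & G'.2 = G.2 :
    relator m N (<< any G' >> - (-1) ^+ N *: << any G >>)
| relator_order k n q (G G' : ograph k n q) of G'.1 = G.1 :
    relator m N (<< any G' >> - koszul m N G.2 G'.2 *: << any G >>).

Definition E_pi (m N : nat) : lmodType rat := quotmod (@relator m N).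

(* The class in [E_pi] of a graph with an enumeration of its cells; the value
   0 on pregraphs which are not oriented admissible graphs is a dummy. *)
Definition gclass (m N : nat) k n q (G : pregraph k n q) : E_pi m N :=
  if insub G is Some G' then qpi (@relator m N) << any (G' : ograph k n q) >>
  else 0.

Definition old_vertex k n (v : vertex k n) : vertex k n.+1 :=
  match v with inl i => inl i | inr j => inr (lift ord0 j) end.

Definition old_cell k n q (x : cell k n q) : cell k n.+1 q.+1 :=
  match x with inl v => inl (old_vertex v) | inr e => inr (lift ord0 e) end.

(* Splitting the internal vertex [j]: the half-edges in [A] are moved to the
   new vertex [inr ord0]; the new edge [ord0] goes from [j] to it. *)
Definition split_graph k n q (g : graph k n q) (j : 'I_n) (A : {set half q}) :
    graph k n.+1 q.+1 :=
  [ffun h => match unlift ord0 h.1 with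
             | Some e => if (e, h.2) \in A then inr ord0
                         else old_vertex (g (e, h.2))
             | None => if h.2 then inr ord0 else inr (lift ord0 j)
             end].

Definition split_order k n q (s : seq (cell k n q)) :
    seq (cell k n.+1 q.+1) :=
  inl (inr ord0) :: inr ord0 :: map (@old_cell k n q) s.

Definition vertex_split k n q (G : pregraph k n q) (j : 'I_n)
    (A : {set half q}) : pregraph k n.+1 q.+1 :=
  (split_graph G.1 j A, split_order G.2).

(* The unordered partitions of [S] into two sets with at least two elements. *)
Definition splitting (T : finType) (S : {set T}) (P : {set {set T}}) : bool :=
  [&& partition P S, #|P| == 2%N & [forall A in P, (2 <= #|A|)%N]].

(* An arbitrary element of [P]; which one does not matter by
   [vertex_split_setD]. *)
Definition new_side (T : finType) (P : {set {set T}}) : {set T} :=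
  odflt set0 [pick A in P].

Definition ograph_boundary (m N : nat) k n q (G : pregraph k n q) : E_pi m N :=
  \sum_(j < n) \sum_(P | splitting (star G.1 (inr j)) P)
    gclass m N (vertex_split G j (new_side P)).

(** * The differential is well defined *)

Notation good G := (admissible G.1 && total_order G.2).

Section Relations.
Variables (m N k n q : nat).
Implicit Types G H : pregraph k n q.

Lemma gclassE (G : ograph k n q) :
  gclass m N G = qpi (@relator m N) << any G >>.
Proof. by rewrite /gclass valK. Qed.

Lemma gclass_eq G H (c : rat) : good G -> good H ->
    (forall G' H' : ograph k n q, ogval G' = G -> ogval H' = H ->
       relator m N (<< any H' >> - c *: << any G' >>)) ->
  gclass m N H = c *: gclass m N G.
Proof.
move=> gG gH rel; apply/eqP; rewrite -subr_eq0; apply/eqP.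
rewrite -[G]/(ogval (OGraph gG)) -[H]/(ogval (OGraph gH)) !gclassE.
by rewrite -linearZ -linearB; apply/qpi_eq0/rel.
Qed.

Lemma gclass_iso fx fi fe G H : good G -> good H ->
  is_iso fx fi fe G H -> gclass m N H = gclass m N G.
Proof.
move=> gG gH iGH; rewrite -[RHS]scale1r; apply: gclass_eq => // G' H' eG eH.
by rewrite scale1r; apply: (@relator_iso _ _ _ _ _ _ _ fx fi fe); rewrite eG eH.
Qed.

Lemma gclass_flip G H e : good G -> good H ->
  H.1 = flip G.1 e -> H.2 = G.2 ->
  gclass m N H = (-1) ^+ N *: gclass m N G.
Proof.
move=> gG gH e1 e2; apply: gclass_eq => // G' H' eG eH.
by apply: (@relator_flip _ _ _ _ _ _ _ e); rewrite eG eH.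
Qed.

Lemma gclass_order G H : good G -> good H -> H.1 = G.1 ->
  gclass m N H = koszul m N G.2 H.2 *: gclass m N G.
Proof.
move=> gG gH e1; apply: gclass_eq => // G' H' eG eH.
by rewrite -eG -eH; apply: relator_order; rewrite eG eH.
Qed.

End Relations.

Section SplitGood.
Variables (k n q : nat) (g : graph k n q) (j : 'I_n) (A : {set half q}).
Let gs := split_graph g j A.
Let up (h : half q) : half q.+1 := (lift ord0 h.1, h.2).

Lemma up_inj : injective up.
Proof. move=> [e b] [e' b'] E.
have /= /lift_inj -> := congr1 fst E; by have /= -> := congr1 snd E. Qed.

Lemma split_up h :
  gs (up h) = if h \in A then inr ord0 else old_vertex (g h).
Proof. by case: h => e b; rewrite ffunE /= liftK. Qed.

Lemma split_new b : gs (ord0, b) = if b then inr ord0 else inr (lift ord0 j).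
Proof. by rewrite ffunE /= unlift_none. Qed.

Lemma halfP (h : half q.+1) :
  [\/ h = (ord0, false), h = (ord0, true) | exists h', h = up h'].
Proof.
case: h => e b; case: (unliftP ord0 e) => [e' ->|->].
  by constructor 3; exists (e', b).
by case: b; [constructor 2|constructor 1].
Qed.

Lemma old_vertex_inj : injective (@old_vertex k n).
Proof.
move=> [i|i] [i'|i'] //= E; first by case: E => ->.
by congr inr; apply: (@lift_inj _ ord0); apply: inr_inj E.
Qed.

Lemma old_vertex_new v : (inr ord0 == @old_vertex k n v) = false.
Proof. by case: v => [i|i] //; apply/negbTE/eqP; case. Qed.

Lemma old_cell_inj : injective (@old_cell k n q).
Proof.
move=> [v|e] [v'|e'] //= E.
  by congr inl; apply: old_vertex_inj; apply: inl_inj E.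
by congr inr; apply: (@lift_inj _ ord0); apply: inr_inj E.
Qed.

Hypothesis sA : A \subset star g (inr j).

Lemma star_split_old v : v != inr j ->
  star gs (old_vertex v) = up @: star g v.
Proof.
move=> vj; apply/setP=> h; rewrite inE.
case: (halfP h) => [->|->|[h' ->]].
- rewrite split_new; transitivity false.
    by apply/negbTE; rewrite -[inr _]/(old_vertex (inr j)) (inj_eq old_vertex_inj) eq_sym.
  by symmetry; apply/negbTE/imsetP => -[x _ /(congr1 fst)].
- rewrite split_new old_vertex_new.
  by symmetry; apply/negbTE/imsetP => -[x _ /(congr1 fst)].
- rewrite split_up mem_imset; last exact: up_inj.
  rewrite inE; case: ifP => [hA|_]; last by rewrite (inj_eq old_vertex_inj).
  rewrite old_vertex_new; move/subsetP/(_ _ hA): sA; rewrite inE => /eqP->.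
  by rewrite eq_sym (negbTE vj).
Qed.

Lemma star_split_j :
  star gs (inr (lift ord0 j)) =
  (ord0, false) |: (up @: (star g (inr j) :\: A)).
Proof.
apply/setP=> h; rewrite !inE.
case: (halfP h) => [->|->|[h' ->]].
- by rewrite split_new !eqxx.
- rewrite split_new xpair_eqE andbF -[inr (lift _ _)]/(old_vertex (inr j)) old_vertex_new.
  by symmetry; apply/negbTE/imsetP => -[x _ /(congr1 fst)].
- rewrite split_up mem_imset; last exact: up_inj.
  rewrite !inE xpair_eqE [_ == ord0]eq_sym (negbTE (neq_lift _ _)) /=.
  by case: ifP => _ /=; rewrite -[inr (lift _ _)]/(old_vertex (inr j)) ?old_vertex_new ?(inj_eq old_vertex_inj).
Qed.

Lemma star_split_new : star gs (inr ord0) = (ord0, true) |: (up @: A).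
Proof.
apply/setP=> h; rewrite !inE.
case: (halfP h) => [->|->|[h' ->]].
- rewrite split_new xpair_eqE andbF eq_sym -[inr (lift _ _)]/(old_vertex (inr j)) old_vertex_new.
  by symmetry; apply/negbTE/imsetP => -[x _ /(congr1 fst)].
- by rewrite split_new !eqxx.
- rewrite split_up mem_imset; last exact: up_inj.
  rewrite xpair_eqE [_ == ord0]eq_sym (negbTE (neq_lift _ _)) /=.
  by case: ifP => _; rewrite ?eqxx // eq_sym old_vertex_new.
Qed.

Lemma incident_half (x : half q) (g' : graph k n q) :
  incident g' (inr x.1) (inl (g' x)).
Proof. by case: x => e [] /=; rewrite eqxx ?orbT. Qed.

End SplitGood.

Lemma incident_sym k n q (g : graph k n q) : symmetric (incident g).
Proof. by move=> [v|e] [v'|e']. Qed.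

Lemma incident_in_sym k n q (g : graph k n q) S : symmetric (incident_in g S).
Proof. by move=> x y; rewrite /incident_in incident_sym andbCA. Qed.

Lemma admissible_split k n q (g : graph k n q) j
    (A : {set half q}) :
  admissible g -> A \subset star g (inr j) ->
  (2 <= #|A|)%N -> (2 <= #|star g (inr j) :\: A|)%N ->
  admissible (split_graph g j A).
Proof.
move=> /and4P[k0 con ext int] sA A2 B2; apply/and4P; split=> //; last first.
- apply/forallP=> i; rewrite /valence; case: (unliftP ord0 i) => [i' ->|->].
    have [->|ij] := eqVneq i' j.
      rewrite star_split_j cardsU1 card_imset; last exact: up_inj.
      suff -> : (ord0, false) \notin [set (lift ord0 h.1, h.2) | h in star g (inr j) :\: A] by [].
      by apply/imsetP => -[x _ /(congr1 fst)].
    rewrite -[inr _]/(old_vertex (inr i')) star_split_old //.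
      by rewrite card_imset; [exact: (forallP int) | exact: up_inj].
  rewrite star_split_new cardsU1 card_imset; last exact: up_inj.
  suff -> : (ord0, true) \notin [set (lift ord0 h.1, h.2) | h in A] by [].
  by apply/imsetP => -[x _ /(congr1 fst)].
- apply/forallP=> i; rewrite /valence -[inl _]/(old_vertex (inl i)).
  rewrite star_split_old // card_imset; [exact: (forallP ext) | exact: up_inj].
set g' := split_graph g j A.
pose c := connect (incident_in g' setT).
have cs : connect_sym (incident_in g' setT).
  by apply: sym_connect_sym; apply: incident_in_sym.
have one x y : incident g' x y -> c x y.
  by move=> xy; apply: connect1; rewrite /incident_in !inE.
have new_j : c (inl (inr ord0)) (inl (inr (lift ord0 j))).
  apply: (@connect_trans _ _ (inr ord0)); apply: one.
    by rewrite /= !split_new eqxx orbT.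
  by rewrite /= !split_new eqxx.
have he h : c (inr (lift ord0 h.1)) (inl (old_vertex (g h))).
  have := one _ _ (incident_half (lift ord0 h.1, h.2) g').
  rewrite (split_up g j A h); case: ifP => // hA ch.
  move/subsetP/(_ _ hA): sA; rewrite inE => /eqP->.
  exact: connect_trans ch new_j.
have st x y : incident g x y -> c (old_cell x) (old_cell y).
  case: x y => [v|e] [v'|e'] //=; last by case/orP=> /eqP <-; apply: he.
  by rewrite /c cs; case/orP=> /eqP <-; apply: he.
have old x y : c (old_cell x) (old_cell y).
  have /connectP[p] : connect (incident_in g setT) x y.
    by have /forallP/(_ x)/implyP/(_ (in_setT _))/forallP/(_ y)/implyP := con; apply.
  elim: p x => [|z p IH] x /=; first by move=> _ ->; apply: connect0.
  case/andP=> /and3P[_ _ xz] pz ly.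
  by apply: connect_trans (st _ _ xz) (IH _ pz ly).
have tox x : c x (inl (inr (lift ord0 j))).
  case: x => [[i|i]|e].
  - exact: (old (inl (inl i)) (inl (inr j))).
  - case: (unliftP ord0 i) => [i' ->|-> //].
    exact: (old (inl (inr i')) (inl (inr j))).
  - case: (unliftP ord0 e) => [e' ->|->]; first exact: (old (inr e') (inl (inr j))).
    by apply: one; rewrite /= !split_new eqxx.
apply/forallP=> x; apply/implyP=> _; apply/forallP=> y; apply/implyP=> _.
by apply: connect_trans (tox x) _; rewrite cs; apply: tox.
Qed.

Lemma total_order_split k n q (s : seq (cell k n q)) :
  total_order s -> total_order (split_order s).
Proof.
move=> /andP[us /forallP ms]; apply/andP; split; last first.
  apply/forallP=> -[[i|i]|e]; rewrite !inE.
  - by apply/map_f: (ms (inl (inl i))).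
  - case: (unliftP ord0 i) => [i' ->|->]; last by rewrite eqxx.
    by rewrite (map_f (@old_cell k n q) (ms (inl (inr i')))) !orbT.
  - case: (unliftP ord0 e) => [e' ->|->]; last by rewrite eqxx.
    by rewrite (map_f (@old_cell k n q) (ms (inr e'))) !orbT.
rewrite /= !inE /= map_inj_uniq ?us; last exact: old_cell_inj.
rewrite andbT; apply/andP; split; apply/mapP => -[[[i|i]|e] _ //=].
Qed.

Lemma good_split k n q (G : pregraph k n q) j
    (A : {set half q}) :
  good G -> A \subset star G.1 (inr j) ->
  (2 <= #|A|)%N -> (2 <= #|star G.1 (inr j) :\: A|)%N ->
  good (vertex_split G j A).
Proof.
move=> /andP[aG oG] sA A2 B2.
by rewrite admissible_split //= total_order_split.
Qed.

Lemma prod_inj (T U : finType) (f : T -> U) (F : U -> rat) : injective f ->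
  (forall u, u \notin codom f -> F u = 1) -> \prod_u F u = \prod_t F (f t).
Proof.
move=> f_inj F1; rewrite (bigID (mem (codom f))) /=.
rewrite [X in _ * X]big1 // mulr1 -big_uniq /=; last exact/injectiveP.
by rewrite /codom big_image /=; apply: eq_bigl => t; rewrite inE.
Qed.

Section Koszul.
Variables (m N : nat).

Lemma koszul_map k n q k' n' q' (f : cell k n q -> cell k' n' q')
    (s s' : seq (cell k n q)) (S S' : seq (cell k' n' q')) :
  injective f -> (forall x, degree m N (f x) = degree m N x) ->
  (forall x y, (index (f x) S < index (f y) S)%N =
               (index x s < index y s)%N) ->
  (forall x y, (index (f x) S' < index (f y) S')%N =
               (index x s' < index y s')%N) ->
  (forall x y, (x \notin codom f) || (y \notin codom f) ->
     (index x S < index y S)%N && (index y S' < index x S')%N = false) ->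
  koszul m N S S' = koszul m N s s'.
Proof.
move=> f_inj fd fS fS' out; rewrite /koszul (prod_inj f_inj) => [|x xf].
  apply: eq_bigr => x _; rewrite big_mkcond /= (prod_inj f_inj) => [|y yf].
    by rewrite [RHS]big_mkcond /=; apply: eq_bigr => y _; rewrite fS fS' !fd.
  by rewrite out // yf orbT.
by rewrite big1 // => y; rewrite out // xf.
Qed.

Lemma degree_old_cell k n q (x : cell k n q) :
  degree m N (old_cell x) = degree m N x.
Proof. by case: x => [[]|]. Qed.

Lemma index_split_order k n q (s : seq (cell k n q)) x :
  index (old_cell x) (split_order s) = (index x s).+2.
Proof.
rewrite /= index_map; last exact: old_cell_inj.
have -> : (inl (inr ord0) == old_cell x) = false by case: x => [[i|i]|e].
by have -> : (inr ord0 == old_cell x) = false by case: x => [[i|i]|e].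
Qed.

Lemma old_cellP k n q (x : cell k n.+1 q.+1) : x \notin codom (@old_cell k n q) ->
  x = inl (inr ord0) \/ x = inr ord0.
Proof.
move=> xf; case: x xf => [[i|i]|e].
- by rewrite (codom_f (@old_cell k n q) (inl (inl i))).
- case: (unliftP ord0 i) => [i' ->|->]; last by left.
  by rewrite (codom_f (@old_cell k n q) (inl (inr i'))).
- case: (unliftP ord0 e) => [e' ->|->]; last by right.
  by rewrite (codom_f (@old_cell k n q) (inr e')).
Qed.

Lemma koszul_split k n q (s s' : seq (cell k n q)) :
  koszul m N (split_order s) (split_order s') = koszul m N s s'.
Proof.
apply: (@koszul_map _ _ _ _ _ _ (@old_cell k n q)).
- exact: old_cell_inj.
- exact: degree_old_cell.
- by move=> x y; rewrite !index_split_order.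
- by move=> x y; rewrite !index_split_order.
have i0 (t : seq (cell k n q)) : index (inl (inr ord0)) (split_order t) = 0%N.
  by [].
have i1 (t : seq (cell k n q)) : index (inr ord0) (split_order t) = 1%N.
  by [].
have ca (x : cell k n.+1 q.+1) :
    x \in codom (@old_cell k n q) \/ (x = inl (inr ord0) \/ x = inr ord0).
  by have [|/old_cellP] := boolP (x \in codom (@old_cell k n q)); [left|right].
move=> x y /orP[] /old_cellP[] ->; rewrite ?i0 ?i1 ?ltn0 ?andbF //.
- case: (ca y) => [/codomP[z ->]|[]->]; rewrite ?i0 ?i1 //.
  by rewrite !index_split_order.
- case: (ca x) => [/codomP[z ->]|[]->]; rewrite ?i0 ?i1 //.
  by rewrite !index_split_order.
Qed.

Lemma koszul_swap k n q (s : seq (cell k n q)) (f : cell k n q -> cell k n q)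
    (a b : cell k n q) :
  total_order s -> index a s = 0%N -> a != b -> involutive f -> f a = b ->
  (forall x, x != a -> x != b -> f x = x) -> degree m N a = degree m N b ->
  koszul m N s (map f s) = (-1) ^ (degree m N a * degree m N a).
Proof.
move=> /andP[us /forallP ms] a0 ab fK fa fx dab.
have fb : f b = a by rewrite -fa fK.
have ix y : index y (map f s) = index (f y) s.
  by rewrite -{1}(fK y) index_map //; apply: inv_inj.
have pos0 y : (0 < index y s)%N = (y != a).
  rewrite lt0n; apply/idP/idP; apply: contra_neq; first by move=> ->.
  move=> y0;   by rewrite -(nth_index a (ms y)) y0 -a0 nth_index.
pose c (x y : cell k n q) : rat := (-1) ^ (degree m N x * degree m N y).
have rowb : \prod_(y | (index b s < index y s)%N &&
                       (index y (map f s) < index b (map f s))%N) c b y = 1.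
  by rewrite big1 // => y; rewrite !ix fb a0 ltn0 andbF.
have rowx x : x != a -> x != b ->
    \prod_(y | (index x s < index y s)%N &&
               (index y (map f s) < index x (map f s))%N) c x y =
    if (index x s < index b s)%N then c x b else 1.
  move=> xa xb; rewrite big_mkcond (bigD1 b) //= !ix fb a0 (fx x) // pos0 xa andbT.
  rewrite big1 ?mulr1 // => y yb; rewrite ix.
  have [->|ya] := eqVneq y a; first by rewrite a0 ltn0.
  by rewrite fx // ltnNge andbC; case: ltnP => // /ltnW ->.
have rowa : \prod_(y | (index a s < index y s)%N &&
                       (index y (map f s) < index a (map f s))%N) c a y =
    c a b * \prod_(y | (y != a) && (y != b))
              if (index y s < index b s)%N then c a y else 1.
  rewrite big_mkcond (bigD1 a) //= !ix a0 mul1r (bigD1 b) 1?eq_sym //=.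
  rewrite pos0 eq_sym ab ix fb fa a0 pos0 eq_sym ab /=; congr (_ * _).
  apply: eq_bigr => y /andP[ya yb].
  by rewrite pos0 ya /= ix fx.
have -> : koszul m N s (map f s) =
    \prod_x \prod_(y | (index x s < index y s)%N &&
                       (index y (map f s) < index x (map f s))%N) c x y by [].
rewrite (bigD1 a) //= rowa [X in _ * X](bigD1 b) 1?eq_sym //= rowb mul1r.
rewrite [X in _ * X](eq_bigr (fun y =>
    if (index y s < index b s)%N then c y b else 1)); last first.
  by move=> y /andP[ya yb]; apply: rowx.
rewrite -mulrA -big_split /= big1 ?mulr1 => [|y _]; first by rewrite /c -dab.
case: ifP => _; rewrite ?mulr1 // /c -dab [degree m N y * _]mulrC.
by rewrite -expfzMl mulrNN mulr1 exp1rz.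
Qed.

End Koszul.

Lemma exprz_degree m N k n q (j : 'I_n) (x := inl (inr j) : cell k n q) :
  (-1) ^ (degree m N x * degree m N x) = (-1) ^+ N :> rat.
Proof.
rewrite /= mulrNN -PoszM -exprnP.
by rewrite -(signr_odd _ (N * N)) oddM andbb signr_odd.
Qed.

Section Flip.
Variables (k n q : nat) (g : graph k n q) (e : 'I_q).

Definition flip_half (h : half q) : half q := (h.1, h.2 (+) (h.1 == e)).

Lemma flip_halfK : involutive flip_half.
Proof. by case=> e' b; rewrite /flip_half /= addbK. Qed.

Lemma star_flip v : star (flip g e) v = flip_half @: star g v.
Proof.
apply/setP=> h; rewrite -(flip_halfK h) mem_imset; last exact: inv_inj flip_halfK.
by rewrite !inE ffunE -/(flip_half _) flip_halfK.
Qed.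

Lemma incident_flip : incident (flip g e) =2 incident g.
Proof.
move=> [v|e1] [v'|e2] //=; rewrite !ffunE /=; case: (_ == e) => //=; exact: orbC.
Qed.

Lemma admissible_flip : admissible g -> admissible (flip g e).
Proof.
move=> /and4P[k0 con ext int].
have val v : valence (flip g e) v = valence g v.
  by rewrite /valence star_flip card_imset //; apply: inv_inj flip_halfK.
apply/and4P; split=> //.
- congr (is_true _): con; apply: eq_forallb => x; congr (_ ==> _).
  apply: eq_forallb => y; congr (_ ==> _); apply: eq_connect => u v.
  by rewrite /incident_in incident_flip.
- by apply/forallP=> i; rewrite val; apply: (forallP ext).
- by apply/forallP=> i; rewrite val; apply: (forallP int).
Qed.

End Flip.

Lemma total_order_map (T U : finType) (f : T -> U) (s : seq T) :
  bijective f -> total_order s -> total_order (map f s).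
Proof.
move=> [f' fK f'K] /andP[us /forallP ms]; rewrite /total_order.
rewrite map_inj_uniq ?us; last exact: can_inj fK.
by apply/forallP=> x; rewrite -(f'K x) map_f.
Qed.

(* The sets [A] occurring in the unordered partitions {A, S \ A}. *)
Definition side (T : finType) (S A : {set T}) : bool :=
  [&& A \subset S, (2 <= #|A|)%N & (2 <= #|S :\: A|)%N].

(* The choice of the endpoint which is the new vertex does not matter. *)
Lemma vertex_split_setD m N k n q (G : pregraph k n q) (j : 'I_n)
    (A : {set half q}) : good G -> side (star G.1 (inr j)) A ->
  gclass m N (vertex_split G j (star G.1 (inr j) :\: A)) =
  gclass m N (vertex_split G j A).
Proof.
move=> gG /and3P[sA A2 B2]; set B := star _ _ :\: A.
have sB : B \subset star G.1 (inr j) by apply: subsetDl.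
have DB : star G.1 (inr j) :\: B = A by rewrite setDDr setDv set0U (setIidPr sA).
have gA : good (vertex_split G j A) by apply: good_split.
have gB : good (vertex_split G j B) by apply: good_split => //; rewrite DB.
pose t := tperm ord0 (lift ord0 j).
pose f := @cell_map k n.+1 q.+1 1 t 1.
have fK : involutive f.
  by case=> [[i|i]|e] /=; rewrite /f /= ?perm1 // tpermK.
pose H : pregraph k n.+1 q.+1 := (flip (split_graph G.1 j B) ord0, split_order G.2).
pose H' : pregraph k n.+1 q.+1 := (H.1, map f H.2).
have gH : good H.
  by case/andP: gB => aB oB; rewrite /= admissible_flip.
have gH' : good H'.
  case/andP: gH => aB oB; apply/andP; split; first exact: aB.
  by apply: (total_order_map _ oB); exists f.
have iH' : is_iso 1 t 1 (vertex_split G j A) H'; last first.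
  rewrite -(gclass_iso m N gA gH' iH') (@gclass_order m N _ _ _ H H') //.
  rewrite (@gclass_flip m N _ _ _ (vertex_split G j B) H ord0) // scalerA.
  rewrite (@koszul_swap m N _ _ _ _ f (inl (inr ord0)) (inl (inr (lift ord0 j)))) //.
  - by rewrite exprz_degree -exprMn mulrNN mulr1 expr1n scale1r.
  - by case/andP: gH.
  - by rewrite /f /= tpermL.
  - case=> [[i|i]|e] /= xa xb; rewrite /f /= ?perm1 // tpermD // eq_sym.
      by apply: contraNneq xa => ->.
    by apply: contraNneq xb => ->.
split=> // e b; rewrite perm1 /= [LHS]ffunE /=.
case: (halfP (e, b)) => [[-> ->]|[-> ->]|[[e' b'] [-> ->]]].
- by rewrite split_new eqxx /= split_new /= tpermR.
- by rewrite split_new eqxx /= split_new /= tpermL.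
rewrite [_ == ord0]eq_sym (negbTE (neq_lift _ _)) addbF.
rewrite !(split_up _ _ _ (e', b')) inE.
have [hA|hA] /= := boolP ((e', b') \in A).
  by move/subsetP/(_ _ hA): sA; rewrite inE => /eqP-> /=; rewrite tpermL.
rewrite inE; have [->|hj] /= := eqVneq; first by rewrite tpermR.
case: (G.1 (e', b')) hj => [i|i] hj /=; first by rewrite perm1.
rewrite tpermD ?neq_lift // (inj_eq lift_inj).
by apply: contraNneq hj => ->.
Qed.

Lemma splittingP (T : finType) (S : {set T}) P B : splitting S P -> B \in P ->
  [/\ side S B, P = [set B; S :\: B] & B != S :\: B].
Proof.
move=> /and3P[pP /cards2P[X [Y [XY eP]]] /forallP big] BP.
have {big} big C : C \in P -> (2 <= #|C|)%N by move=> CP; apply: (implyP (big C)).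
have key X' Y' : X' != Y' -> P = [set X'; Y'] -> Y' = S :\: X' /\ X' \subset S.
  move=> ne e; case/and3P: pP => /eqP cS tP _.
  have XP : X' \in P by rewrite e !inE eqxx.
  have YP : Y' \in P by rewrite e !inE eqxx orbT.
  have dXY : [disjoint X' & Y'] by apply: (trivIsetP tP).
  have <- : X' :|: Y' = S.
    by rewrite -cS /cover e big_setU1 ?inE //= big_set1.
  rewrite subsetUl setDUl setDv set0U; split=> //.
  by apply/esym/setDidPl; rewrite disjoint_sym.
have [C [BC eC]] : exists C, B != C /\ P = [set B; C].
  move: BP; rewrite eP !inE => /orP[] /eqP ->; first by exists Y.
  by exists X; rewrite eq_sym XY setUC.
have [eC' sB] := key _ _ BC eC; rewrite -eC'; split=> //.
by rewrite /side sB -eC' !big // eC !inE eqxx ?orbT.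
Qed.

Lemma splitting_side (T : finType) (S A : {set T}) : side S A ->
  splitting S [set A; S :\: A].
Proof.
move=> /and3P[sA A2 B2].
have ne : A != S :\: A.
  apply/eqP => e; move: A2; have : A :&: A = set0.
    by rewrite {2}e setIDA setIC -setIDA setDv setI0.
  by rewrite setIid => ->; rewrite cards0.
apply/and3P; split; last first.
- by apply/forallP=> C; apply/implyP; rewrite !inE => /orP[] /eqP ->.
- by rewrite cards2 ne.
apply/and3P; split.
- by rewrite /cover big_setU1 ?inE //= big_set1 -{1}(setIidPr sA) setID.
- apply/trivIsetP => C D; rewrite !inE.
  have dA : [disjoint A & S :\: A] by rewrite -setI_eq0 setIDA setIC -setIDA setDv setI0.
  move=> /orP[] /eqP -> /orP[] /eqP ->; rewrite ?eqxx // => _.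
  by rewrite disjoint_sym.
- by rewrite !inE negb_or ![set0 == _]eq_sym -!card_gt0 (ltnW A2) (ltnW B2).
Qed.

(* Summing over unordered partitions is half of summing over ordered ones. *)
Lemma sum_splitting (T : finType) (W : lmodType rat) (S : {set T})
    (F : {set T} -> W) :
  (forall A, side S A -> F (S :\: A) = F A) ->
  \sum_(P | splitting S P) F (new_side P) = 2^-1 *: \sum_(A | side S A) F A.
Proof.
move=> FD; rewrite (partition_big (fun A => [set A; S :\: A]) (splitting S)) /=; last first.
  exact: splitting_side.
rewrite scaler_sumr; apply: eq_bigr => P sP.
have BP : new_side P \in P.
  rewrite /new_side; case: pickP => //= P0.
  by case/and3P: sP => _ /eqP; rewrite (eq_card0 P0).
have [sB eP ne] := splittingP sP BP.
rewrite (eq_bigl (mem P)) => [|A]; last first.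
  apply/andP/idP => [[_ /eqP <-]|AP]; first by rewrite !inE eqxx.
  by have [sA <- _] := splittingP sP AP.
set B := new_side P in BP sB eP ne *; rewrite (eq_bigl (mem [set B; S :\: B])) => [|A].
  rewrite big_setU1 ?inE //= big_set1 FD // -mulr2n.
  by rewrite -scaler_nat scalerA mulVf ?scale1r.
by rewrite -eP.
Qed.

Lemma ograph_boundaryE m N k n q (G : pregraph k n q) : good G ->
  ograph_boundary m N G = 2^-1 *: \sum_(j < n)
    \sum_(A | side (star G.1 (inr j)) A) gclass m N (vertex_split G j A).
Proof.
move=> gG; rewrite /ograph_boundary scaler_sumr; apply: eq_bigr => j _.
by apply: sum_splitting => A sA; apply: vertex_split_setD.
Qed.

Lemma side_imset (T : finType) (f : T -> T) (S A : {set T}) : injective f ->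
  side (f @: S) (f @: A) = side S A.
Proof.
move=> fI; rewrite /side !card_imset //.
have -> : (f @: A \subset f @: S) = (A \subset S).
  apply/idP/idP; last exact: imsetS.
  by move/subsetP=> H; apply/subsetP=> x xA; rewrite -(mem_imset _ _ fI) H ?imset_f.
suff -> : f @: S :\: f @: A = f @: (S :\: A) by rewrite card_imset.
apply/setP=> y; rewrite inE; apply/andP/imsetP => [[yA /imsetP[x xS e]]|[x]].
  by exists x => //; rewrite inE xS andbT; apply: contraNN yA => xA; rewrite e imset_f.
by rewrite inE => /andP[xA xS] ->; rewrite !mem_imset.
Qed.

Lemma boundary_transfer m N k n q (G G' : pregraph k n q) (c : rat)
    (phi : half q -> half q) (s : 'I_n -> 'I_n) :
  good G -> good G' -> injective phi -> injective s ->
  (forall j, star G'.1 (inr (s j)) = phi @: star G.1 (inr j)) ->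
  (forall j A, side (star G.1 (inr j)) A ->
     gclass m N (vertex_split G' (s j) (phi @: A)) =
     c *: gclass m N (vertex_split G j A)) ->
  ograph_boundary m N G' = c *: ograph_boundary m N G.
Proof.
move=> gG gG' phiI sI st H; rewrite !ograph_boundaryE // scalerA mulrC -scalerA.
congr (_ *: _); rewrite scaler_sumr (reindex_inj sI); apply: eq_bigr => j _.
rewrite scaler_sumr (reindex_inj (imset_inj phiI)) st.
by apply: eq_big => [A|A sA]; rewrite ?side_imset //; apply: H; rewrite -(side_imset _ _ phiI).
Qed.

Lemma good_side k n q (G : pregraph k n q) j A :
  good G -> side (star G.1 (inr j)) A -> good (vertex_split G j A).
Proof. by move=> gG /and3P[*]; apply: good_split. Qed.

Section BoundaryRelations.
Variables (m N k n q : nat).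
Implicit Types G H : pregraph k n q.

Lemma boundary_iso fx fi fe G H : good G -> good H -> is_iso fx fi fe G H ->
  ograph_boundary m N H = ograph_boundary m N G.
Proof.
move=> gG gH [e1 e2]; rewrite -[RHS]scale1r.
pose phi (h : half q) : half q := (fe h.1, h.2).
have phiI : injective phi.
  by move=> [e b] [e' b'] E; have /= /perm_inj -> := congr1 fst E; have /= -> := congr1 snd E.
have vI : injective (vertex_map fx fi).
  move=> [i|i] [i'|i'] //= E.
    by congr inl; apply: (@perm_inj _ fx); apply: inl_inj E.
  by congr inr; apply: (@perm_inj _ fi); apply: inr_inj E.
have Hphi h : H.1 (phi h) = vertex_map fx fi (G.1 h) by case: h => e b; apply: e1.
have st j : star H.1 (inr (fi j)) = phi @: star G.1 (inr j).
  apply/setP=> h; have -> : h = phi ((fe^-1)%g h.1, h.2) by case: h => e b; rewrite /phi /= permKV.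
  by rewrite mem_imset // !inE Hphi -[inr (fi j)]/(vertex_map fx fi (inr j)) (inj_eq vI).
apply: (boundary_transfer gG gH phiI (@perm_inj _ fi) st) => j A sA.
rewrite scale1r.
pose fi' := lift_perm ord0 ord0 fi; pose fe' := lift_perm ord0 ord0 fe.
have ov v : old_vertex (vertex_map fx fi v) = vertex_map fx fi' (old_vertex v).
  by case: v => [i|i] //=; rewrite lift_perm_lift.
apply: (@gclass_iso _ _ _ _ _ fx fi' fe'); first exact: good_side.
  by apply: good_side => //; rewrite st side_imset.
split; last first.
  rewrite /= /split_order e2 /= !lift_perm_id -!map_comp; congr [:: _, _ & _].
  by apply: eq_map => -[v|e] /=; rewrite ?ov ?lift_perm_lift.
move=> e b; rewrite /vertex_split /=.
case: (halfP (e, b)) => [[-> ->]|[-> ->]|[[e' b'] [-> ->]]].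
- by rewrite lift_perm_id !split_new /= lift_perm_lift.
- by rewrite lift_perm_id !split_new /= lift_perm_id.
rewrite lift_perm_lift (split_up _ _ _ (phi (e', b'))) (split_up _ _ _ (e', b')).
rewrite mem_imset // Hphi; case: ifP => _ //=; by rewrite lift_perm_id.
Qed.

Lemma boundary_flip G H e : good G -> good H ->
  H.1 = flip G.1 e -> H.2 = G.2 ->
  ograph_boundary m N H = (-1) ^+ N *: ograph_boundary m N G.
Proof.
move=> gG gH e1 e2; have fI := inv_inj (@flip_halfK q e).
have st j : star H.1 (inr j) = flip_half e @: star G.1 (inr j) by rewrite e1 star_flip.
apply: (boundary_transfer gG gH fI (@inj_id _) st) => j A sA.
apply: (@gclass_flip _ _ _ _ _ _ _ (lift ord0 e)); first exact: good_side.
- by apply: good_side => //; rewrite st side_imset.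
- apply/ffunP=> h; rewrite [RHS]ffunE /=; case: (halfP h) => [->|->|[h' ->]] /=.
  + by rewrite !split_new.
  + by rewrite !split_new.
  rewrite (inj_eq lift_inj) split_up (split_up _ _ _ (flip_half e h')).
  rewrite -{1}(flip_halfK e h') mem_imset // e1 ffunE.
  by [].
- by rewrite /= e2.
Qed.

Lemma boundary_order G H : good G -> good H -> H.1 = G.1 ->
  ograph_boundary m N H = koszul m N G.2 H.2 *: ograph_boundary m N G.
Proof.
move=> gG gH e1.
have st j : star H.1 (inr j) = id @: star G.1 (inr j) by rewrite e1 imset_id.
apply: (boundary_transfer gG gH (@inj_id _) (@inj_id _) st) => j A sA.
rewrite imset_id (@gclass_order m N _ _ _ (vertex_split G j A)) ?koszul_split //.
- exact: good_side.
- by apply: good_side; rewrite // e1.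
- by rewrite /= e1.
Qed.

End BoundaryRelations.

Lemma good_ograph k n q (G : ograph k n q) : good (ogval G).
Proof. by case: G. Qed.

Section Differential.
Variables (m N : nat).

Definition free_boundary : {malg rat[any_ograph]} -> E_pi m N :=
  lin_ext (fun G : any_ograph => ograph_boundary m N (tagged G)).
HB.instance Definition _ := GRing.Linear.on free_boundary.

Lemma free_boundaryU k n q (G : ograph k n q) :
  free_boundary << any G >> = ograph_boundary m N G.
Proof. exact: lin_extU. Qed.

Lemma free_boundaryB (c : rat) x y :
  free_boundary (x - c *: y) = free_boundary x - c *: free_boundary y.
Proof. by rewrite linearB linearZ. Qed.

Lemma free_boundary_relator x : relator m N x -> free_boundary x = 0.
Proof.
have sub k n q (G G' : ograph k n q) c :
    ograph_boundary m N G' = c *: ograph_boundary m N G ->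
    free_boundary (<< any G' >> - c *: << any G >>) = 0.
  move=> E; apply: etrans (free_boundaryB _ _ _) _.
  apply: etrans (congr2 (fun a b => a - c *: b) (free_boundaryU G')
                   (free_boundaryU G)) _.
  by rewrite E subrr.
case=> {x} k n q G G' => [fx fi fe iGG'|e e1 e2|e1].
- have := sub _ _ _ G G' 1; rewrite !scale1r; apply.
  exact: boundary_iso (good_ograph G) (good_ograph G') iGG'.
- by apply: sub; apply: boundary_flip (good_ograph G) (good_ograph G') e1 e2.
- by apply: sub; apply: boundary_order (good_ograph G) (good_ograph G') e1.
Qed.

Definition boundary : E_pi m N -> E_pi m N := descend free_boundary_relator.
HB.instance Definition _ := GRing.Linear.on boundary.

Lemma boundary_gclass k n q (G : ograph k n q) :
  boundary (gclass m N G) = ograph_boundary m N G.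
Proof. by rewrite gclassE /boundary descendE /= /free_boundary lin_extU. Qed.

End Differential.

(** * The two-loop hairy graph-complex *)

(* The Hodge degree [k] part of the span of the two-loop hairy graphs of
   defect [i]. *)
Definition two_loop_chain (m N i k : nat) : E_pi m N -> Prop :=
  lspan (fun x => exists n q (G : ograph k n q),
    [/\ two_loop_hairy G.1, defect G.1 = i & x = gclass m N G]).

(* On defect 0 the condition [boundary x = 0] is vacuous, all the internal
   vertices being trivalent. *)
Definition two_loop_cycle (m N i k : nat) (x : E_pi m N) : Prop :=
  two_loop_chain i k x /\ boundary x = 0.

Definition two_loop_boundary (m N i k : nat) (x : E_pi m N) : Prop :=
  exists2 y : E_pi m N, two_loop_chain i.+1 k y & x = boundary y.

(* The Hodge degree [k] part of the defect [i] homology has dimension [d]. *)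
Definition two_loop_homology_dim (m N i k d : nat) : Prop :=
  subquotient_dim (@two_loop_cycle m N i k) (@two_loop_boundary m N i k) d.

Definition ceil_div (a b : nat) : nat := (a + b.-1) %/ b.

(* Main.v *)
(* A two-loop hairy graph is a theta graph with a, b, c hairs along its three
   arms and at most one hair at each of the two branch vertices; its defect is
   the number i of branch vertices carrying a hair. Up to sign its class
   theta_i(a,b,c) depends only on the multiset {a,b,c}: exchanging two arms acts
   by (-1)^(ab), and exchanging the branch vertices by
   (-1)^(C(a+1,2)+C(b+1,2)+C(c+1,2)); there are no other relations. Hence the
   chain groups consist of signed symmetric functions of three exponents, and
   the boundary is multiplication by x+y+z on skew polynomials in three
   anticommuting variables, followed by the projection onto the functions on
   which the exchange of the branch vertices acts trivially.

   Let D_rho be the part of this multiplication that raises exponents of parity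
   rho. Then D_rho^2 = 0, D_rho has an explicit contracting homotopy, and
   D_0 D_1 + D_1 D_0 is multiplication by s = x^2+y^2+z^2. Let pi be the parity
   of k-1, and grade by the number of exponents of parity other than pi. Then
   the complex unfolds into a zigzag of maps D_pi and D_(1-pi), whose homology
   is the cokernel of s on signed symmetric functions all of whose exponents
   have parity pi: in defect 1 and degree k-1 if k = 0, 1 mod 4, and in defect 0
   and degree k+1, through the homotopy of D_(1-pi), if k = 2, 3 mod 4. A basis
   of this cokernel is given by the orbits of (y+2pi, y, z) with z+2pi <= y: the
   relations s = 0 allow one to lower the largest exponent until it is as close
   as possible to the next one. *)

From HB Require Import structures.
From mathcomp Require Import all_boot all_order all_algebra perm.
From mathcomp Require Import boolp.
From mathcomp.multinomials Require Import monalg.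
From mathcomp Require Import zify ring lra.
Require Import Defs.

Set Implicit Arguments.
Unset Strict Implicit.
Unset Printing Implicit Defensive.

Import GRing.Theory Num.Theory Order.TTheory.

Local Open Scope ring_scope.

(** * Signs of orders and invariance of graph classes *)

(** For [N] odd and [m] even the internal vertices are the only cells of odd degree, so an
    orientation amounts to an order of the internal vertices up to even permutations together with
    edge directions, each reversal costing a sign. A graph is a bare function on half-edges, so a
    [marking] names the arms and [msign] compares orientations. That there are no other relations is
    shown by linear functionals on the graph-complex; they exist because two markings of a graph
    differ only by symmetries of a theta graph. Let A_j be the functions with j exponents of parity
    other than pi; D_pi maps A_j to A_(j+1), and D_(1-pi) maps it to A_(j-1). Defect 1 is A_0 + A_2;
    the reflection leaves one of A_1, A_3 in defect 0 and the other in defect 2. For k = 0, 1 mod 4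
    the complex is A_0 <- A_1 -> A_2 -> A_3, and exactness of D_pi leaves A_0 modulo D_(1-pi) D_pi
    A_0. Otherwise it is A_3 -> A_2 -> A_1 <- A_0, and D_(1-pi) identifies A_1 modulo the image of
    A_2 with A_0. As D_(1-pi) kills A_0, the composite D_(1-pi) D_pi on A_0 is multiplication by
    s. *)

Section Sign.
Variables (n : nat) (T : eqType) (c : 'I_n -> T).
Implicit Types s : seq T.

(* The sign of the order in which the elements [c i] occur in [s]. *)
Definition order_sign s : rat :=
  \prod_(i < n) \prod_(j < n | (i < j)%N) (-1) ^+ (index (c j) s < index (c i) s)%N.

Definition inversion s s' (i j : 'I_n) : bool :=
  (index (c i) s < index (c j) s)%N && (index (c j) s' < index (c i) s')%N.

Definition relative_sign s s' : rat :=
  \prod_(i < n) \prod_(j < n) (-1) ^+ inversion s s' i j.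

Lemma order_sign_sqr s : order_sign s * order_sign s = 1.
Proof.
rewrite /order_sign -big_split big1 // => i _ /=.
by rewrite -big_split big1 // => j _ /=; rewrite -signr_addb addbb.
Qed.

Lemma prod_pairs (F : 'I_n -> 'I_n -> rat) : (forall i, F i i = 1) ->
  \prod_i \prod_j F i j = \prod_(i < n) \prod_(j < n | (i < j)%N) (F i j * F j i).
Proof.
move=> F1.
under [RHS]eq_bigr do rewrite big_split.
rewrite big_split /= [X in _ * X](exchange_big_dep predT) //= -big_split /=.
apply: eq_bigr => i _.
rewrite (bigD1 i) //= F1 mul1r (bigID (fun j : 'I_n => (i < j)%N)) /=.
congr (_ * _); apply: eq_bigl => j; rewrite -val_eqE /=; lia.
Qed.

(** A pair is inverted between [s] and [s'] exactly when the two sequences disagree on it, so the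
    sign is a product of two factors that each depend on one order. Thus every order can be compared
    with the reference order of a marking. *)
Lemma relative_signE s s' : injective c ->
  (forall i, c i \in s) -> (forall i, c i \in s') ->
  relative_sign s s' = order_sign s * order_sign s'.
Proof.
move=> c_inj cs cs'; rewrite /relative_sign prod_pairs => [|i]; last first.
  by rewrite /inversion ltnn.
rewrite /order_sign -big_split; apply: eq_bigr => i _ /=.
rewrite -big_split; apply: eq_bigr => j ij /=.
have ne t : c i \in t -> c j \in t -> index (c i) t != index (c j) t.
  move=> ti tj; apply: contraTneq ij => e.
  have := nth_index (c i) ti; rewrite e nth_index // => /c_inj ->.
  by rewrite ltnn.
have := ne _ (cs i) (cs j); have := ne _ (cs' i) (cs' j); rewrite /inversion.
by case: (ltngtP (index (c i) s')) => //; case: (ltngtP (index (c i) s)) => // _ _ _ _; rewrite /= ?expr0 ?expr1 ?mulr1 ?mul1r ?mulrNN ?mulr1.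
Qed.

End Sign.

Section SeqSign.
Variable n : nat.
Implicit Types s t : seq 'I_n.

Notation seq_sign := (@order_sign n _ id).

Lemma order_sign_map (T : eqType) (c : 'I_n -> T) s : injective c ->
  order_sign c (map c s) = seq_sign s.
Proof.
by move=> ci; apply: eq_bigr => i _; apply: eq_bigr => j _; rewrite !index_map.
Qed.

Definition full s := uniq s && (size s == n).

Lemma full_mem s i : full s -> i \in s.
Proof.
case/andP=> us /eqP ss; have := uniq_min_size us (s2 := enum 'I_n).
rewrite size_enum_ord ss => /(_ _ (leqnn _)) [|_ ->]; last by rewrite mem_enum.
by move=> x _; rewrite mem_enum.
Qed.

Lemma full_perm s s' : perm_eq s s' -> full s = full s'.
Proof. by move=> p; rewrite /full (perm_uniq p) (perm_size p). Qed.

(** A position outside the adjacent pair [p], [p.+1] lies on the same side of both, so swapping the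
    pair creates no inversion with it. *)
Fact swap_arith (p x : nat) : ((x < p) || (p.+1 < x))%N ->
  [/\ (p < x) && (x < p.+1) = false, (p.+1 < x) && (x < p) = false,
      (x < p) && (p.+1 < x) = false & (x < p.+1) && (p < x) = false]%N.
Proof. by move=> o; split; apply/negbTE; move: o; lia. Qed.

Lemma seq_sign_swap s1 i j s2 : full (s1 ++ i :: j :: s2) ->
  seq_sign (s1 ++ j :: i :: s2) = - seq_sign (s1 ++ i :: j :: s2).
Proof.
set s := s1 ++ _; set s' := s1 ++ _ => fs.
have p : perm_eq s s' by rewrite perm_cat2l (perm_catCA [:: i] [:: j]).
have fs' : full s' by rewrite -(full_perm p).
suff e : relative_sign id s s' = -1.
  have := relative_signE (@inj_id _) (fun i => full_mem i fs) (fun i => full_mem i fs').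
  rewrite e => /(congr1 (fun x => x * order_sign id s)).
  by rewrite mulrAC order_sign_sqr mul1r => <-; rewrite mulN1r.
case/andP: fs; rewrite cat_uniq /= !inE !negb_or -!andbA.
move=> /and5P[us1 is1 js1 _ /and4P[ij is2 js2 us2]] _.
have ix : index i s = size s1 by rewrite index_cat (negbTE is1) /= eqxx addn0.
have jx : index j s = (size s1).+1 by rewrite index_cat (negbTE js1) /= (negbTE ij) eqxx addn1.
have ix' : index i s' = (size s1).+1 by rewrite index_cat (negbTE is1) /= eq_sym (negbTE ij) eqxx addn1.
have jx' : index j s' = size s1 by rewrite index_cat (negbTE js1) /= eqxx addn0.
have other x : x != i -> x != j -> index x s = index x s' /\
    ((index x s < size s1) || (index x s > (size s1).+1))%N.
  move=> xi xj; rewrite !index_cat; case: ifP => [xs|_]; first by rewrite index_mem xs.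
  rewrite /= ![_ == x]eq_sym (negbTE xi) (negbTE xj); split=> //.
  by rewrite !addnS !ltnS leq_addr orbT.
have z (b : bool) : b = false -> (-1) ^+ b = 1 :> rat by move=> ->.
rewrite /relative_sign (bigD1 i) //= (bigD1 j) 1?eq_sym //= /inversion ix jx ix' jx' ltnS leqnn /=.
have A x := @swap_arith (size s1) x.
rewrite big1 => [|x xj]; last first.
  have [->|xi] := eqVneq x i; first by rewrite ix ltnn.
  by have [<- o] := other x xi xj; apply: z; by have [-> _ _ _] := A _ o.
rewrite mulr1 big1 ?mulr1 // => x xi; rewrite big1 // => y _; apply: z.
have [->|xj] := eqVneq x j.
  have [->|yi] := eqVneq y i; first by rewrite ix jx ltnNge leqnSn.
  have [->|yj] := eqVneq y j; first by rewrite ltnn.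
  by have [<- o] := other y yi yj; rewrite jx jx'; by have [_ -> _ _] := A _ o.
have [<- o] := other x xi xj.
have [->|yi] := eqVneq y i; first by rewrite ix ix'; by have [_ _ -> _] := A _ o.
have [->|yj] := eqVneq y j; first by rewrite jx jx'; by have [_ _ _ ->] := A _ o.
by have [<- o'] := other y yi yj; case: ltngtP.
Qed.

Lemma seq_sign_move s1 i t s2 : full (s1 ++ i :: t ++ s2) ->
  seq_sign (s1 ++ t ++ i :: s2) = (-1) ^+ size t * seq_sign (s1 ++ i :: t ++ s2).
Proof.
elim: t s1 => [|j t IH] s1 /= f; first by rewrite mul1r.
rewrite -cat_rcons IH; last first.
  rewrite (full_perm _ (s' := s1 ++ i :: j :: t ++ s2)) //.
  by rewrite cat_rcons perm_cat2l (perm_catCA [:: j] [:: i]).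
by rewrite cat_rcons seq_sign_swap // exprS mulrN mulN1r mulNr.
Qed.

Lemma seq_sign_block s1 t1 t2 s2 : full (s1 ++ t1 ++ t2 ++ s2) ->
  seq_sign (s1 ++ t2 ++ t1 ++ s2) =
  (-1) ^+ (size t1 * size t2) * seq_sign (s1 ++ t1 ++ t2 ++ s2).
Proof.
elim: t1 s1 => [|i t1 IH] s1 /= f; first by rewrite mul1r.
rewrite seq_sign_move; last first.
  rewrite (full_perm _ (s' := s1 ++ i :: t1 ++ t2 ++ s2)) //.
  by rewrite perm_cat2l perm_cons perm_catCA.
rewrite -cat_rcons IH ?cat_rcons // mulSn exprD mulrA; congr (_ * _ * _).
Qed.

(** Each induction step carries the head of [t] across the rest; the numbers of elements crossed add
    up to the binomial coefficient. *)
Lemma seq_sign_rev s1 t s2 : full (s1 ++ t ++ s2) ->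
  seq_sign (s1 ++ rev t ++ s2) = (-1) ^+ 'C(size t, 2) * seq_sign (s1 ++ t ++ s2).
Proof.
elim: t s1 s2 => [|i t IH] s1 s2 /= f; first by rewrite mul1r.
rewrite rev_cons cat_rcons IH; last first.
  rewrite (full_perm _ (s' := s1 ++ i :: t ++ s2)) //.
  by rewrite perm_cat2l (perm_catCA t [:: i]).
by rewrite seq_sign_move // binS bin1 exprD mulrA.
Qed.

(** [order_sign] alone depends on the numbering by ['I_n]; relative signs do not, since relabelling
    only permutes the factors. *)
Lemma relative_sign_perm (T : eqType) (c : 'I_n -> T) (F : T -> T) (f : {perm 'I_n})
    (s s' : seq T) :
  injective F -> (forall i, F (c i) = c (f i)) ->
  relative_sign c (map F s) (map F s') = relative_sign c s s'.
Proof.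
move=> Fi Fc; rewrite /relative_sign (reindex_inj (@perm_inj _ f)); apply: eq_bigr => i _.
rewrite (reindex_inj (@perm_inj _ f)); apply: eq_bigr => j _.
by rewrite /inversion -!Fc !index_map.
Qed.

End SeqSign.
Notation seq_sign := (order_sign id).

Definition internal k n q (i : 'I_n) : cell k n q := inl (inr i).
Notation cell_sign := (order_sign (@internal _ _ _)).

Lemma internal_inj k n q : injective (@internal k n q).
Proof. by move=> i j []. Qed.

Lemma internal_order k n q (s : seq (cell k n q)) i : total_order s -> internal k q i \in s.
Proof. by case/andP=> _ /forallP. Qed.

(** * Koszul signs when only the internal vertices are odd *)

Section Koszul.
Variables m N : nat.
Hypotheses (N_odd : odd N) (m_even : ~~ odd m).

(** External vertices have degree [- m] and edges [N - 1], both even, so every factor involving one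
    of them is 1; two internal vertices contribute -1 when inverted. *)
Lemma koszul_sign k n q (s s' : seq (cell k n q)) : total_order s -> total_order s' ->
  koszul m N s s' = cell_sign s * cell_sign s'.
Proof.
move=> ts ts'; rewrite -relative_signE; last first.
- by move=> i; apply: internal_order.
- by move=> i; apply: internal_order.
- exact: internal_inj.
have even_deg (x : cell k n q) (d : int) : x \notin codom (@internal k n q) ->
    (-1) ^ (degree m N x * d) = 1 :> rat.
  move=> xf; have [z ->] : exists z : int, degree m N x = 2 * z.
    case: x xf => [[i|i]|e] xf.
    - exists (- (m./2)%:Z); rewrite /= mulrN -PoszM mul2n.
      by rewrite -{1}(odd_double_half m) (negbTE m_even) add0n.
    - by rewrite (codom_f (@internal k n q) i) in xf.
    - exists (N./2)%:Z; rewrite /= -PoszM mul2n.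
      by rewrite -{1}(odd_double_half N) N_odd PoszD addrC addKr.
  by rewrite -mulrA -exprz_exp -[(-1) ^ 2]/((-1) ^+ 2) sqrrN expr1n exp1rz.
have deg_odd i j : (-1) ^ (degree m N (internal k q i) * degree m N (internal k q j)) = -1 :> rat.
  rewrite /= mulrNN -PoszM -exprnP -signr_odd oddM N_odd /=; by rewrite expr1.
rewrite /koszul (prod_inj (@internal_inj k n q)) => [|x xf]; last first.
  by rewrite big1 // => y _; apply: even_deg.
apply: eq_bigr => i _; rewrite big_mkcond (prod_inj (@internal_inj k n q)) => [|x xf].
  by apply: eq_bigr => j _; rewrite deg_odd /inversion; case: ifP => _; rewrite ?expr1 ?expr0.
by case: ifP => // _; rewrite mulrC even_deg.
Qed.

Lemma gclass_reorder k n q (G H : pregraph k n q) : good G -> good H -> H.1 = G.1 ->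
  gclass m N H = (cell_sign G.2 * cell_sign H.2) *: gclass m N G.
Proof.
move=> gG gH e; rewrite (gclass_order m N gG gH e) koszul_sign //.
  by case/andP: gG.
by case/andP: gH.
Qed.

End Koszul.

(** * Markings of theta graphs *)

Definition opp_half q (h : half q) : half q := (h.1, ~~ h.2).

Lemma opp_halfK q : involutive (@opp_half q).
Proof. by case=> e b; rewrite /opp_half /= negbK. Qed.

Record arm k n q := Arm {
  darts : seq (half q); hairs : seq (half q); inner : seq 'I_n; tips : seq 'I_k
}.

Record stub k q := Stub { sdarts : seq (half q); stips : seq 'I_k }.

(* The darts of the three arms point from [src] to [tgt], those of the hairs
   point towards the external vertices. *)
Record theta k n q := Theta {
  src : 'I_n; tgt : 'I_n;
  arm1 : arm k n q; arm2 : arm k n q; arm3 : arm k n q;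
  ssrc : stub k q; stgt : stub k q
}.

Section Marking.
Variables k n q : nat.
Implicit Types (A : arm k n q) (M : theta k n q) (g : graph k n q).

Definition vertices M :=
  src M :: tgt M :: inner (arm1 M) ++ inner (arm2 M) ++ inner (arm3 M).
Definition frame_darts M := darts (arm1 M) ++ darts (arm2 M) ++ darts (arm3 M).
Definition hair_darts M :=
  hairs (arm1 M) ++ hairs (arm2 M) ++ hairs (arm3 M) ++ sdarts (ssrc M) ++ sdarts (stgt M).
Definition all_tips M :=
  tips (arm1 M) ++ tips (arm2 M) ++ tips (arm3 M) ++ stips (ssrc M) ++ stips (stgt M).
Definition all_darts M := frame_darts M ++ hair_darts M.

(** The sources [u :: inner A] and the targets [rcons (inner A) w] make the darts a path from [u] to
    [w]; each inner vertex carries one hair, listed in the same order. *)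
Definition arm_ok g u w A : Prop :=
  [/\ map g (darts A) = map inr (u :: inner A),
      map (g \o @opp_half q) (darts A) = map inr (rcons (inner A) w),
      map g (hairs A) = map inr (inner A) &
      map (g \o @opp_half q) (hairs A) = map inl (tips A)].

Definition stub_ok g (b : bool) (u : 'I_n) (S : stub k q) : Prop :=
  map g (sdarts S) = map inr (nseq b u) /\ map (g \o @opp_half q) (sdarts S) = map inl (stips S).

(** The last three fields leave nothing of the graph outside the theta graph and its hairs, and
    nothing listed twice. Edges are compared through [fst] because a marking chooses a direction for
    each of them. *)
Record marking g (bs bt : bool) M : Prop := Marking {
  mk1 : arm_ok g (src M) (tgt M) (arm1 M);
  mk2 : arm_ok g (src M) (tgt M) (arm2 M);
  mk3 : arm_ok g (src M) (tgt M) (arm3 M);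
  mks : stub_ok g bs (src M) (ssrc M);
  mkt : stub_ok g bt (tgt M) (stgt M);
  mkv : full (vertices M);
  mkx : full (all_tips M);
  mke : full (map fst (all_darts M))
}.

Definition msize M : nat * nat * nat :=
  (size (inner (arm1 M)), size (inner (arm2 M)), size (inner (arm3 M))).

(** Compares the orientation with the one suggested by the marking: each dart that runs against its
    edge costs -1, and the order of the internal vertices is measured against [vertices M]. *)
Definition msign M (s : seq (cell k n q)) : rat :=
  (-1) ^+ count snd (all_darts M) * seq_sign (vertices M) * cell_sign s.

Lemma msign_sqr M s : msign M s * msign M s = 1.
Proof.
rewrite /msign mulrACA order_sign_sqr mulr1 mulrACA order_sign_sqr mulr1.
by rewrite -expr2 sqrr_sign.
Qed.

Definition arm_map (f : half q -> half q) A := Arm (map f (darts A)) (map f (hairs A)) (inner A) (tips A).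
Definition stub_map (f : half q -> half q) (S : stub k q) := Stub (map f (sdarts S)) (stips S).
Definition theta_map f M := Theta (src M) (tgt M) (arm_map f (arm1 M)) (arm_map f (arm2 M))
   (arm_map f (arm3 M)) (stub_map f (ssrc M)) (stub_map f (stgt M)).

Lemma all_darts_map f M : all_darts (theta_map f M) = map f (all_darts M).
Proof. by rewrite /all_darts /frame_darts /hair_darts /= !map_cat. Qed.

Lemma mem_edges g bs bt M e : marking g bs bt M -> exists b, (e, b) \in all_darts M.
Proof.
move=> mM; have /(full_mem e) /mapP[[e' b] h /= ->] := mke mM.
by exists b.
Qed.

Lemma sources g bs bt M : marking g bs bt M ->
  map g (all_darts M) = map inr ((src M :: inner (arm1 M)) ++ (src M :: inner (arm2 M)) ++
     (src M :: inner (arm3 M)) ++ inner (arm1 M) ++ inner (arm2 M) ++ inner (arm3 M) ++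
     nseq bs (src M) ++ nseq bt (tgt M)).
Proof.
case=> [[e1 _ f1 _] [e2 _ f2 _] [e3 _ f3 _] [es _] [et _] _ _ _].
by rewrite /all_darts /frame_darts /hair_darts !map_cat e1 f1 e2 f2 e3 f3 es et -!catA.
Qed.

Lemma targets g bs bt M : marking g bs bt M ->
  map (g \o @opp_half q) (all_darts M) = map inr (rcons (inner (arm1 M)) (tgt M) ++
     rcons (inner (arm2 M)) (tgt M) ++ rcons (inner (arm3 M)) (tgt M)) ++ map inl (all_tips M).
Proof.
case=> [[_ e1 _ f1] [_ e2 _ f2] [_ e3 _ f3] [_ es] [_ et] _ _ _].
by rewrite /all_darts /frame_darts /hair_darts !map_cat e1 f1 e2 f2 e3 f3 es et -!catA.
Qed.

Lemma flip_halfE g e h : flip g e (flip_half e h) = g h.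
Proof. by rewrite ffunE -/(flip_half _ _) flip_halfK. Qed.

Lemma flip_opp (e : 'I_q) (h : half q) : opp_half (flip_half e h) = flip_half e (opp_half h).
Proof. by rewrite /opp_half /flip_half /= addNb. Qed.

Lemma marking_flip g bs bt M e : marking g bs bt M ->
  marking (flip g e) bs bt (theta_map (flip_half e) M).
Proof.
have E (s : seq (half q)) : map (flip g e) (map (flip_half e) s) = map g s.
  by rewrite -map_comp; apply: eq_map => h; exact: flip_halfE.
have F (s : seq (half q)) : map (flip g e \o @opp_half q) (map (flip_half e) s) = map (g \o @opp_half q) s.
  by rewrite -map_comp; apply: eq_map => h /=; rewrite flip_opp; exact: flip_halfE.
have A u w B : arm_ok g u w B -> arm_ok (flip g e) u w (arm_map (flip_half e) B).
  by case=> *; split; rewrite /= ?E ?F.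
have S b u B : stub_ok g b u B -> stub_ok (flip g e) b u (stub_map (flip_half e) B).
  by case=> *; split; rewrite /= ?E ?F.
case=> *; split=> //; try exact: A; try exact: S.
by rewrite all_darts_map -map_comp.
Qed.

Lemma count_flip (e : 'I_q) (s : seq (half q)) : uniq (map fst s) -> e \in map fst s ->
  (-1) ^+ count snd (map (flip_half e) s) = - (-1) ^+ count snd s :> rat.
Proof.
elim: s => //= -[e' b] s IH /= /andP[e's us]; rewrite inE => /orP[/eqP ->|es].
  rewrite eqxx addbT [X in count _ X](_ : _ = s); last first.
    rewrite -[RHS]map_id; apply/eq_in_map => -[a c] h; rewrite /flip_half /=.
    case: eqP => [ae|]; last by rewrite addbF.
    by move: e's; rewrite -ae -[X in X \notin _]/(fst (a, c)) map_f.
  by case: b; rewrite /= !exprD expr1 expr0 ?mulN1r ?mul1r ?opprK.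
rewrite !exprD IH //; case: eqP => [E|_]; first by rewrite E es in e's.
by rewrite addbF mulrN.
Qed.

Lemma count_straighten (e : 'I_q) (s : seq (half q)) : uniq (map fst s) -> (e, true) \in s ->
  (count snd (map (flip_half e) s)).+1 = count snd s.
Proof.
elim: s => //= -[e' b] s IH /= /andP[e's us]; rewrite inE xpair_eqE [e == _]eq_sym.
case: (eqVneq e' e) e's => [->|ne] e's /=; last first.
  by rewrite addbF => es; rewrite -(IH us es) addnS.
rewrite addbT => /orP[/eqP <-|es]; last first.
  by rewrite -[X in X \notin _]/(fst (e, true)) map_f in e's.
rewrite add0n add1n [X in count _ X](_ : _ = s) //.
rewrite -[RHS]map_id; apply/eq_in_map => -[a c] h; rewrite /flip_half /=.
case: eqP => [ae|]; last by rewrite addbF.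
by move: e's; rewrite -ae -[X in X \notin _]/(fst (a, c)) map_f.
Qed.

End Marking.

Lemma perm_of_full n (s t : seq 'I_n) : full s -> full t ->
  exists f : {perm 'I_n}, map f s = t.
Proof.
case: n s t => [|n] s t fs ft.
  case/andP: fs => _ /eqP/size0nil ->; case/andP: ft => _ /eqP/size0nil ->.
  by exists 1%g.
case/andP: (fs) (ft) => us /eqP ss /andP[ut /eqP st].
have sst : size t = size s by rewrite ss st.
pose f i := nth ord0 t (index i s).
have fi : injective f.
  move=> i j e; have [is_ js] := (full_mem i fs, full_mem j fs).
  have : index i s = index j s.
    by apply/eqP; rewrite -(@nth_uniq _ ord0 t) ?sst ?index_mem //; apply/eqP.
  by move=> e'; rewrite -(nth_index ord0 is_) e' nth_index.
exists (perm fi); apply: (@eq_from_nth _ ord0 _ t); first by rewrite size_map ss st.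
rewrite size_map => i li; rewrite (nth_map ord0) // permE /f index_uniq //.
Qed.

Lemma cell_map_bij k n q (fx : {perm 'I_k}) (fi : {perm 'I_n}) (fe : {perm 'I_q}) :
  bijective (@cell_map k n q fx fi fe).
Proof.
exists (@cell_map k n q (fx^-1)%g (fi^-1)%g (fe^-1)%g); case=> [[i|i]|i] /=;
by rewrite ?permK ?permKV.
Qed.

(** Each side is a relative sign, that of [s] against the list [v] read as cells, and relative signs
    are invariant under relabelling. *)
Lemma sign_relabel k n q (fx : {perm 'I_k}) (fi : {perm 'I_n}) (fe : {perm 'I_q}) v
    (s : seq (cell k n q)) : full v -> total_order s ->
  seq_sign (map fi v) * cell_sign (map (cell_map fx fi fe) s) = seq_sign v * cell_sign s.
Proof.
move=> fv ts; set cm := cell_map fx fi fe; have cm_bij := cell_map_bij fx fi fe.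
have := @relative_sign_perm n _ (@internal k n q) cm fi
  (map (@internal k n q) v) s (bij_inj cm_bij) (fun i => erefl).
have mem_int t : full t -> forall i, internal k q i \in map (@internal k n q) t.
  by move=> ft i; rewrite map_f // (full_mem _ ft).
have fv' : full (map fi v).
  case/andP: fv => uv sv; by rewrite /full size_map sv andbT map_inj_uniq //; apply: perm_inj.
have Ev : map cm (map (@internal k n q) v) = map (@internal k n q) (map fi v).
  by rewrite -!map_comp; apply: eq_map.
have int_inj := @internal_inj k n q.
have ts' : total_order (map cm s) by apply: total_order_map.
rewrite Ev (relative_signE int_inj (mem_int _ fv') (fun i => internal_order i ts')).
rewrite (relative_signE int_inj (mem_int _ fv) (fun i => internal_order i ts)).
by rewrite !(order_sign_map _ int_inj).
Qed.

(** * The class of a marked graph depends only on its arm lengths and stubs *)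

Section Class.
Variables m N : nat.
Hypotheses (N_odd : odd N) (m_even : ~~ odd m).

Lemma class_flip k n q bs bt (G : pregraph k n q) M e : good G -> marking G.1 bs bt M ->
  let G' := (flip G.1 e, G.2) in let M' := theta_map (flip_half e) M in
  msign M' G'.2 *: gclass m N G' = msign M G.2 *: gclass m N G.
Proof.
move=> gG mM G' M'; have gG' : good G'.
  by case/andP: gG => aG oG; rewrite /= admissible_flip.
rewrite (@gclass_flip m N _ _ _ G G' e) //.
rewrite scalerA /msign /M' all_darts_map /= count_flip; last 2 first.
- by case/andP: (mke mM).
- exact: full_mem (mke mM).
have -> : (-1) ^+ N = -1 :> rat by rewrite -signr_odd N_odd expr1.
by rewrite mulrN1 -!mulNr opprK.
Qed.

(** Isomorphisms must respect edge directions, so edges traversed backwards by the marking are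
    flipped one at a time; each flip changes the sign of the class and of [msign] alike. *)
Lemma straighten k n q bs bt (G : pregraph k n q) M : good G -> marking G.1 bs bt M ->
  exists (G' : pregraph k n q) M', [/\ good G', marking G'.1 bs bt M', msize M' = msize M,
    all (fun h => ~~ h.2) (all_darts M') &
    msign M' G'.2 *: gclass m N G' = msign M G.2 *: gclass m N G].
Proof.
move: {-1}(count _ _) (leqnn (count snd (all_darts M))) => r.
elim: r G M => [|r IH] G M lr gG mM.
  by exists G, M; split=> //; rewrite all_predC has_count -leqNgt.
have [|/allPn[[e b] h]] := boolP (all (fun h : half q => ~~ h.2) (all_darts M)).
  by exists G, M; split.
rewrite /= negbK => bt'; rewrite bt' in h.
have gG' : good (flip G.1 e, G.2).
  by case/andP: gG => aG oG; rewrite /= admissible_flip.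
have [|G' [M' [*]]] := IH _ _ _ gG' (marking_flip e mM); last first.
  by exists G', M'; split=> //; rewrite -(class_flip e gG mM).
rewrite all_darts_map -ltnS (leq_trans _ lr) //.
by rewrite count_straighten //; case/andP: (mke mM).
Qed.

Lemma nseq_map (T U : Type) (f : T -> U) r x : map f (nseq r x) = nseq r (f x).
Proof. by elim: r => //= r ->. Qed.

(** Once straightened, the permutations that match the lists of [M] with those of [L] form an
    isomorphism, because these lists determine the source and the target of every dart. Only the
    orders of the cells may still differ, and [msign] accounts for that. *)
Lemma normal_form k n q bs bt (G H : pregraph k n q) M L : good G -> good H ->
  marking G.1 bs bt M -> marking H.1 bs bt L -> msize M = msize L ->
  msign M G.2 *: gclass m N G = msign L H.2 *: gclass m N H.
Proof.
move=> gG gH mM mL sML.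
have [G' [M' [gG' mM' sM' fM' <-]]] := straighten gG mM.
have [H' [L' [gH' mL' sL' fL' <-]]] := straighten gH mL.
move: sML; rewrite -sM' -sL' => {sM' sL' gG gH mM mL G H M L}.
move: G' M' H' L' gG' mM' fM' gH' mL' fL' => G M H L gG mM fM gH mL fL [s1 s2 s3].
have [fi Ei] := perm_of_full (mkv mM) (mkv mL).
have [fx Ex] := perm_of_full (mkx mM) (mkx mL).
have [fe Ee] := perm_of_full (mke mM) (mke mL).
have [eu ew e1 e2 e3] : [/\ fi (src M) = src L, fi (tgt M) = tgt L,
    map fi (inner (arm1 M)) = inner (arm1 L), map fi (inner (arm2 M)) = inner (arm2 L) &
    map fi (inner (arm3 M)) = inner (arm3 L)].
  move: Ei; rewrite /vertices /= !map_cat => -[-> ->] /eqP.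
  rewrite eqseq_cat ?size_map // => /andP[/eqP-> /eqP E].
  by move/eqP: E; rewrite eqseq_cat ?size_map // => /andP[/eqP-> /eqP->].
pose vm := vertex_map fx fi; pose cm := @cell_map k n q fx fi fe.
have vmi l : map vm (map inr l) = map inr (map fi l) by rewrite -!map_comp.
have vmx l : map vm (map inl l) = map inl (map fx l) by rewrite -!map_comp.
have ES : map vm (map G.1 (all_darts M)) = map H.1 (all_darts L).
  rewrite (sources mM) (sources mL) vmi -e1 -e2 -e3 -eu -ew.
  by rewrite /= !(map_cat, map_cons, nseq_map).

have ET : map vm (map (G.1 \o @opp_half q) (all_darts M)) = map (H.1 \o @opp_half q) (all_darts L).
  rewrite (targets mM) (targets mL) map_cat vmi vmx -e1 -e2 -e3 -ew Ex.
  by rewrite !(map_cat, map_rcons).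
have false_darts s : all (fun h : half q => ~~ h.2) s -> s = map (fun e => (e, false)) (map fst s).
  by elim: s => //= -[e b] s IH /andP[/negbTE /= -> /IH <-].
have eG e b : H.1 (fe e, b) = vm (G.1 (e, b)).
  have eE : e \in map fst (all_darts M) by apply: full_mem (mke mM).
  (* All darts are of the form [(e, false)]: the source lists determine the graphs on the halves
     [(e, false)] and the target lists on the halves [(e, true)]. *)
  have EM := false_darts _ fM; have EL := false_darts _ fL.
  move: ES ET; rewrite EM EL -Ee; set E := map fst (all_darts M) in eE *.
  rewrite -!map_comp => /eq_in_map ES /eq_in_map ET.
  case/mapP: eE => d dE ->.
  by case: b; [exact: esym (ET _ dE) | exact: esym (ES _ dE)].
have cm_bij : bijective cm := cell_map_bij fx fi fe.
have gK : good (H.1, map cm G.2).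
  by case/andP: gG gH => _ oG /andP[aH _]; rewrite /= aH (total_order_map cm_bij oG).
have <- : gclass m N (H.1, map cm G.2) = gclass m N G by apply: (gclass_iso m N gG gK (fx := fx) (fi := fi) (fe := fe)).
rewrite (gclass_reorder N_odd m_even gK gH) // scalerA /=; congr (_ *: _).
rewrite /msign.
have count0 (s : seq (half q)) : all (fun h => ~~ h.2) s -> count snd s = 0%N.
  by rewrite all_predC has_count -leqNgt leqn0 => /eqP.
rewrite !count0 // !mul1r mulrACA order_sign_sqr mulr1.
rewrite -Ei -(sign_relabel fx fi fe (mkv mM)) //; by case/andP: gG.
Qed.

End Class.

(** * The symmetries of a theta graph and their signs *)

Section Symmetries.
Variables k n q : nat.
Implicit Types (A : arm k n q) (M : theta k n q) (g : graph k n q).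

Definition swap12 M := Theta (src M) (tgt M) (arm2 M) (arm1 M) (arm3 M) (ssrc M) (stgt M).
Definition swap23 M := Theta (src M) (tgt M) (arm1 M) (arm3 M) (arm2 M) (ssrc M) (stgt M).

Definition rev_arm A :=
  Arm (rev (map (@opp_half q) (darts A))) (rev (hairs A)) (rev (inner A)) (rev (tips A)).
Definition reflect M := Theta (tgt M) (src M) (rev_arm (arm1 M)) (rev_arm (arm2 M))
  (rev_arm (arm3 M)) (stgt M) (ssrc M).

(* The sign by which the reflection of the theta graph acts, [(-1)^(a(a+1)/2)]
   for an arm with [a] hairs. *)
Definition rsgn (a : nat) : rat := (-1) ^+ 'C(a.+1, 2).

Lemma marking_swap12 g bs bt M : marking g bs bt M -> marking g bs bt (swap12 M).
Proof.
case=> ? ? ? ? ? v x e; split=> //.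
- by rewrite -(full_perm _ (s := vertices M)) // !perm_cons perm_catCA.
- by rewrite -(full_perm _ (s := all_tips M)) // perm_catCA.
- rewrite -(full_perm _ (s := map fst (all_darts M))) // perm_map //.
  by apply: perm_cat; rewrite perm_catCA.
Qed.

Lemma marking_swap23 g bs bt M : marking g bs bt M -> marking g bs bt (swap23 M).
Proof.
case=> ? ? ? ? ? v x e; split=> //.
- rewrite -(full_perm _ (s := vertices M)) // !perm_cons perm_cat2l perm_catC.
  by rewrite perm_refl.
- by rewrite -(full_perm _ (s := all_tips M)) // perm_cat2l perm_catCA.
- rewrite -(full_perm _ (s := map fst (all_darts M))) // perm_map //.
  apply: perm_cat; rewrite perm_cat2l; last by rewrite perm_catCA.
  by rewrite perm_catC.
Qed.

Lemma rev_arm_ok g u w A : arm_ok g u w A -> arm_ok g w u (rev_arm A).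
Proof.
case=> e1 e2 e3 e4; split; rewrite /= map_rev.
- by rewrite -map_comp e2 -map_rev rev_rcons.
- rewrite -map_comp (_ : map _ _ = map g (darts A)); last first.
    by apply: eq_map => h /=; rewrite opp_halfK.
  by rewrite e1 -map_rev rev_cons.
- by rewrite e3 -map_rev.
- by rewrite e4 -map_rev.
Qed.

Lemma count_opp (s : seq (half q)) : count snd (map (@opp_half q) s) = (size s - count snd s)%N.
Proof.
rewrite -(count_predC snd s) addKn count_map.
by apply: eq_count => -[e b].
Qed.

Lemma marking_reflect g bs bt M : marking g bs bt M -> marking g bt bs (reflect M).
Proof.
case=> ? ? ? ? ? v x e; split=> //; try exact: rev_arm_ok.
- rewrite -(full_perm _ (s := vertices M)) // /vertices /= (perm_catCA [:: src M] [:: tgt M]).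
  by rewrite !perm_cons !perm_cat // perm_sym perm_rev.
- rewrite -(full_perm _ (s := all_tips M)) // /all_tips /=.
  do 3![apply: perm_cat; first by rewrite perm_sym perm_rev].
  by rewrite perm_catC.
- rewrite -(full_perm _ (s := map fst (all_darts M))) // /all_darts /frame_darts /hair_darts /=.
  have op (s : seq (half q)) : perm_eq (map fst s) (map fst (rev (map (@opp_half q) s))).
    by rewrite map_rev -map_comp perm_sym perm_rev.
  rewrite !map_cat -!catA; do 3![apply: perm_cat; first exact: op].
  do 3![apply: perm_cat; first by rewrite map_rev perm_sym perm_rev].
  by rewrite perm_catC.
Qed.

Lemma msign_swap12 g bs bt M s : marking g bs bt M ->
  msign (swap12 M) s = (-1) ^+ (size (inner (arm1 M)) * size (inner (arm2 M))) * msign M s.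
Proof.
move=> mM; rewrite /msign mulrCA mulrA; congr (_ * _); rewrite -mulrA; congr (_ * _).
  suff /seq.permP/(_ snd) -> : perm_eq (all_darts (swap12 M)) (all_darts M) by [].
  by apply: perm_cat; rewrite perm_catCA.
have := @seq_sign_block n [:: src M; tgt M] (inner (arm1 M)) (inner (arm2 M)) (inner (arm3 M)).
by move=> /(_ (mkv mM)); rewrite /vertices /= => ->; rewrite mulrC.
Qed.

Lemma msign_swap23 g bs bt M s : marking g bs bt M ->
  msign (swap23 M) s = (-1) ^+ (size (inner (arm2 M)) * size (inner (arm3 M))) * msign M s.
Proof.
move=> mM; rewrite /msign mulrCA mulrA; congr (_ * _); rewrite -mulrA; congr (_ * _).
  suff /seq.permP/(_ snd) -> : perm_eq (all_darts (swap23 M)) (all_darts M) by [].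
  apply: perm_cat; rewrite perm_cat2l; first by rewrite perm_catC.
  by rewrite perm_catCA.
have := @seq_sign_block n (src M :: tgt M :: inner (arm1 M)) (inner (arm2 M)) (inner (arm3 M)) [::].
by rewrite !cats0 => /(_ (mkv mM)); rewrite /vertices /= => ->; rewrite mulrC.
Qed.

Lemma arm_size g u w A : arm_ok g u w A ->
  [/\ size (darts A) = (size (inner A)).+1, size (hairs A) = size (inner A) &
      size (tips A) = size (inner A)].
Proof.
case=> /(congr1 size) + _ /(congr1 size) + /(congr1 size).
by rewrite !size_map => /= -> -> <-.
Qed.

(** An arm with a hairs has a + 1 darts to reverse and a inner vertices to list backwards, which
    gives the exponent a + 1 + C(a, 2). The three extra signs cancel with the one from exchanging
    the branch vertices, and a + C(a, 2) = C(a + 1, 2). *)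
Lemma msign_reflect g bs bt M s : marking g bs bt M ->
  msign (reflect M) s = rsgn (size (inner (arm1 M))) * rsgn (size (inner (arm2 M))) *
    rsgn (size (inner (arm3 M))) * msign M s.
Proof.
move=> mM; have [a1 _ _] := arm_size (mk1 mM).
have [a2 _ _] := arm_size (mk2 mM); have [a3 _ _] := arm_size (mk3 mM).
rewrite /msign mulrA; congr (_ * _).
set a := size (inner (arm1 M)) in a1 *; set b := size (inner (arm2 M)) in a2 *; set c := size (inner (arm3 M)) in a3 *.
have -> : (-1) ^+ count snd (all_darts (reflect M)) =
    (-1) ^+ (a.+1 + b.+1 + c.+1) * (-1) ^+ count snd (all_darts M) :> rat.
  rewrite /all_darts /frame_darts /hair_darts !count_cat /= !count_rev !count_opp a1 a2 a3.
  have B (t : seq (half q)) r : size t = r -> (-1) ^+ (r - count snd t) = (-1) ^+ (r + count snd t) :> rat.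
    by move=> <-; rewrite -signr_odd oddB ?count_size // -oddD signr_odd.
  rewrite !exprD (B _ _ a1) (B _ _ a2) (B _ _ a3) !exprD; ring.
have -> : seq_sign (vertices (reflect M)) =
    - ((-1) ^+ 'C(a, 2) * (-1) ^+ 'C(b, 2) * (-1) ^+ 'C(c, 2)) * seq_sign (vertices M).
  have := mkv mM; have := mkv (marking_reflect mM); rewrite /vertices /=.
  set u := src M; set w := tgt M => f1 f0.
  set s1 := inner (arm1 M) in f0 f1 *; set s2 := inner (arm2 M) in f0 f1 *.
  set s3 := inner (arm3 M) in f0 f1 *.
  have r2 (x y : seq 'I_n) : perm_eq x y -> perm_eq (u :: w :: x) (w :: u :: y).
    by move=> xy; rewrite (perm_catCA [:: u] [:: w]) !perm_cons.
  have fp (x y : seq 'I_n) : full y -> perm_eq y x -> full x by move=> fy /full_perm <-.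
  have f2 : full ([:: w; u] ++ s1 ++ rev s2 ++ rev s3).
    apply: (fp _ _ f0).
    by apply: r2; rewrite !perm_cat // perm_sym perm_rev.
  have -> := seq_sign_rev f2; rewrite -/a.
  have f3 : full (([:: w; u] ++ s1) ++ s2 ++ rev s3).
    apply: (fp _ _ f0).
    by rewrite -catA; apply: r2; rewrite !perm_cat // perm_sym perm_rev.
  have := seq_sign_rev f3; rewrite -!catA /= => ->.
  have f4 : full (([:: w; u] ++ s1 ++ s2) ++ s3 ++ [::]).
    apply: (fp _ _ f0).
    by rewrite cats0 -!catA; apply: r2.
  have := seq_sign_rev f4; rewrite -!catA !cats0 /= => ->.
  by have /= -> := @seq_sign_swap n [::] u w _ f0; rewrite -/b -/c; ring.
rewrite /rsgn !binS !bin1 -/a -/b -/c !exprD !exprS; ring.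
Qed.

Lemma marking_dims g bs bt M : marking g bs bt M ->
  let r := (size (inner (arm1 M)) + size (inner (arm2 M)) + size (inner (arm3 M)))%N in
  [/\ k = (r + bs + bt)%N, n = r.+2 & q = (r.+3 + (r + bs + bt))%N].
Proof.
move=> mM r; have [a1 h1 t1] := arm_size (mk1 mM).
have [a2 h2 t2] := arm_size (mk2 mM); have [a3 h3 t3] := arm_size (mk3 mM).
have S b u (Z : stub k q) : stub_ok g b u Z -> size (sdarts Z) = b /\ size (stips Z) = b.
  case=> /(congr1 size) + /(congr1 size); rewrite !size_map size_nseq => -> <-.
  by [].
have [s1 s2] := S _ _ _ (mks mM); have [s3 s4] := S _ _ _ (mkt mM).
have /andP[_ /eqP] := mkv mM; have /andP[_ /eqP] := mkx mM; have /andP[_ /eqP] := mke mM.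
rewrite /vertices /all_darts /frame_darts /hair_darts /all_tips /r.
rewrite size_map /= !size_cat a1 a2 a3 h1 h2 h3 t1 t2 t3 s1 s2 s3 s4.
by move=> eq ek en; clear -eq ek en; split; lia.
Qed.

End Symmetries.

(** * Marked graphs with prescribed arm lengths *)

Lemma full_enum n : full (enum 'I_n).
Proof. by rewrite /full enum_uniq size_enum_ord eqxx. Qed.

Lemma cut_seq (T : Type) (l : seq T) a r : size l = (a + r)%N ->
  exists l1 l2, [/\ l = l1 ++ l2, size l1 = a & size l2 = r].
Proof.
move=> sl; exists (take a l), (drop a l); rewrite cat_take_drop size_drop size_take sl addKn.
by split=> //; case: ltnP => //; lia.
Qed.

Lemma map_nth_index (T : eqType) (U : Type) (x0 : U) (s : seq T) (t : seq U) :
  uniq s -> size t = size s -> map (fun x => nth x0 t (index x s)) s = t.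
Proof.
move=> us st; apply: (@eq_from_nth _ x0); first by rewrite size_map.
move=> i; rewrite size_map => li; case: s us st li => // y s us st li.
by rewrite (nth_map y) // index_uniq.
Qed.

(** The enumerations of the three ordinals are cut into consecutive blocks, one for each list of the
    marking; the graph is then read off the lists of sources [S] and of targets [T] that a marking
    forces. *)
Lemma marking_exists (bs bt : bool) (a b c : nat) :
  exists k n q (g : graph k n q) (M : theta k n q), marking g bs bt M /\ msize M = (a, b, c).
Proof.
pose r := (a + b + c)%N; pose k := (a + (b + (c + (bs + bt))))%N.
pose q := (a.+1 + (b.+1 + (c.+1 + (a + (b + (c + (bs + bt)))))))%N.
have [u [w [I0 [EI sI]]]] : exists u w I0, enum 'I_r.+2 = u :: w :: I0 /\ size I0 = (a + (b + c))%N.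
  have := size_enum_ord r.+2; case: (enum 'I_r.+2) => // u [|w I0] //= [sI].
  by exists u, w, I0; rewrite sI /r addnA.
have [I1 [I' [E1 sI1 sI']]] := cut_seq sI.
have [I2 [I3 [E2 sI2 sI3]]] := cut_seq sI'.
have [X1 [X' [EX sX1 /cut_seq[X2 [X'' [EX' sX2 /cut_seq[X3 [X3' [EX'' sX3 /cut_seq[Xs [Xt [EX3 sXs sXt]]]]]]]]]]]] :=
  cut_seq (size_enum_ord k : size _ = (a + _)%N).
have [D1 [D' [ED sD1 /cut_seq[D2 [D'' [ED' sD2 /cut_seq[D3 [F' [ED'' sD3 /cut_seq[F1 [F'' [EF sF1 /cut_seq[F2 [F3' [EF' sF2 /cut_seq[F3 [F4 [EF'' sF3 /cut_seq[Fs [Ft [EF4 sFs sFt]]]]]]]]]]]]]]]]]]]]] :=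
  cut_seq (size_enum_ord q : size _ = (a.+1 + _)%N).
subst I0 I' X' X'' X3' D' D'' F' F'' F3' F4.
pose S : seq (vertex k r.+2) := map inr ((u :: I1) ++ (u :: I2) ++ (u :: I3) ++ I1 ++ I2 ++ I3 ++ nseq bs u ++ nseq bt w).
pose T : seq (vertex k r.+2) := map inr (rcons I1 w ++ rcons I2 w ++ rcons I3 w) ++ map inl (enum 'I_k).
pose g : graph k r.+2 q := [ffun h => nth (inr u) (if h.2 then T else S) (index h.1 (enum 'I_q))].
have ue := enum_uniq 'I_q.
have sS : size S = size (enum 'I_q).
  by rewrite size_enum_ord /S size_map /= !size_cat /= !size_cat /= !size_cat !size_nseq sI1 sI2 sI3 /q; lia.
have sT : size T = size (enum 'I_q).
  by rewrite size_enum_ord /T size_cat !size_map -enumT size_enum_ord !size_cat !size_rcons sI1 sI2 sI3 /q /k; lia.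
pose d (e : 'I_q) : half q := (e, false).
have eS : map (fun e => g (d e)) (enum 'I_q) = S.
  rewrite -[RHS](map_nth_index (inr u) ue sS); apply: eq_map => e.
  by rewrite ffunE.
have eT : map (fun e => g (opp_half (d e))) (enum 'I_q) = T.
  rewrite -[RHS](map_nth_index (inr u) ue sT); apply: eq_map => e.
  by rewrite ffunE.
exists k, r.+2, q, g.
exists (Theta u w (Arm (map d D1) (map d F1) I1 X1) (Arm (map d D2) (map d F2) I2 X2)
  (Arm (map d D3) (map d F3) I3 X3) (Stub (map d Fs) Xs) (Stub (map d Ft) Xt)).
split; last by rewrite /msize /= sI1 sI2 sI3.
have sz := (sD1, sD2, sD3, sF1, sF2, sF3, sFs, sFt, sI1, sI2, sI3, sX1, sX2, sX3, sXs, sXt).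
move: eS; rewrite ED /S !map_cat => /eqP.
do 7! (rewrite eqseq_cat; last by rewrite !size_map ?size_nseq /= ?sz).
case/and5P => /eqP S1 /eqP S2 /eqP S3 /eqP S4 /and4P[/eqP S5 /eqP S6 /eqP S7 /eqP S8].
move: eT; rewrite ED /T EX !map_cat -!catA => /eqP.
do 7! (rewrite eqseq_cat; last by rewrite !size_map ?size_rcons ?sz).
case/and5P => /eqP T1 /eqP T2 /eqP T3 /eqP T4 /and4P[/eqP T5 /eqP T6 /eqP T7 /eqP T8].
split; rewrite /=; try by split; rewrite -map_comp.
- by rewrite [vertices _](_ : _ = enum 'I_r.+2) ?full_enum // EI.
- by rewrite [all_tips _](_ : _ = enum 'I_k) ?full_enum // EX.
- rewrite /all_darts /frame_darts /hair_darts /= -!catA -!map_cat -map_comp.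
  by rewrite (eq_map (g := id)) // map_id -ED full_enum.
Qed.

(** * Marked graphs are two-loop hairy graphs *)

Lemma connect_along (T : finType) (e r : rel T) (x0 : T) (p : seq T) :
  path e x0 p -> (forall x y, x \in x0 :: p -> y \in x0 :: p -> e x y -> r x y) ->
  forall y, y \in x0 :: p -> connect r x0 y.
Proof.
elim: p x0 => [|z p IH] x0 /= => [_ _ y|/andP[xz pz] sub y]; first by rewrite inE => /eqP->.
rewrite inE => /orP[/eqP -> //|yp]; apply: (@connect_trans _ _ z).
  by apply: connect1; apply: sub => //; rewrite !inE eqxx ?orbT.
by apply: IH => // a b ap bp; apply: sub; rewrite inE ?ap ?bp orbT.
Qed.

(* Removing one vertex from a path leaves every other vertex connected to one
   of the two ends. *)
Lemma connect_path (T : finType) (e r : rel T) (c x0 : T) (p : seq T) :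
  connect_sym r -> path e x0 p -> uniq (x0 :: p) ->
  (forall x y, x \in x0 :: p -> y \in x0 :: p -> x != c -> y != c -> e x y -> r x y) ->
  forall y, y \in x0 :: p -> y != c ->
  x0 != c /\ connect r y x0 \/ last x0 p != c /\ connect r y (last x0 p).
Proof.
move=> rs; elim: p x0 => [|z p IH] x0 /=.
  by move=> _ _ _ y; rewrite !inE => /eqP -> ->; rewrite connect0; left.
move=> /andP[xz pz] /andP[x0p us] sub y.
have subz : forall a b, a \in z :: p -> b \in z :: p -> a != c -> b != c -> e a b -> r a b.
  by move=> a b ap bp; apply: sub; rewrite inE ?ap ?bp orbT.
have IHz := IH z pz us subz; rewrite inE => /orP[/eqP -> yc|yp yc].
  by rewrite yc connect0; left.
have [[zc yz]|] := IHz _ yp yc; last by right.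
have [x0c|x0c] := eqVneq x0 c; last first.
  left; split=> //; apply: (connect_trans yz); rewrite rs; apply: connect1.
  by apply: sub => //; rewrite !inE eqxx ?orbT.
have nc a : a \in z :: p -> a != c by move=> ap; apply: contraNneq x0p => ac; rewrite x0c -ac.
right; split; first by apply: nc; rewrite mem_last.
apply: (connect_trans yz); apply: (connect_along pz); last exact: mem_last.
by move=> a b ap bp; apply: subz => //; apply: nc.
Qed.

(** Turns the lists describing an arm into a path of the incidence relation, alternating between
    edges and vertices. *)
Lemma arm_walk k n q (g : graph k n q) u w (P : seq (half q)) I :
  map g P = map inr (u :: I) -> map (g \o @opp_half q) P = map inr (rcons I w) ->
  exists p, [/\ path (incident g) (inl (inr u)) p, last (inl (inr u)) p = inl (inr w) &
    perm_eq p (map inr (map fst P) ++ map (@internal k n q) (rcons I w))].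
Proof.
have step (h : half q) (x : 'I_n) y : g h = inr x -> g (opp_half h) = inr y ->
    incident g (inl (inr x)) (inr h.1) && incident g (inr h.1) (inl (inr y)).
  by case: h => e [] /= -> ->; rewrite !eqxx ?orbT.
elim: I u P => [|v I IH] u [|h P] //= [eu] E1 [ev] E2.
  case: P E1 E2 => //= _ _; exists [:: inr h.1; inl (inr w)].
  by have /= /andP[-> ->] := step _ _ _ eu ev.
have [p [pp lp qp]] := IH _ _ E1 E2; exists [:: inr h.1, inl (inr v) & p].
have /= /andP[-> ->] := step _ _ _ eu ev; split=> //.
rewrite perm_cons -(perm_cons (internal k q v)) in qp *.
by apply: (perm_trans qp); rewrite -cat1s perm_catCA.
Qed.

Lemma mem_map_eq (T U V : eqType) (f : T -> V) (j : U -> V) s t x :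
  map f s = map j t -> x \in s -> exists2 y, y \in t & f x = j y.
Proof. by move=> e /(map_f f); rewrite e => /mapP[y yt ->]; exists y. Qed.

Section MarkedGraph.
Variables (k n q : nat) (g : graph k n q) (bs bt : bool) (M : theta k n q).
Hypothesis mM : marking g bs bt M.

Lemma all_darts_uniq : uniq (all_darts M).
Proof. by apply: (@map_uniq _ _ fst); case/andP: (mke mM). Qed.

Lemma all_darts_inj h h' : h \in all_darts M -> h' \in all_darts M -> h.1 = h'.1 -> h = h'.
Proof.
have /andP[+ _] := mke mM; elim: (all_darts M) => //= d s IH /andP[ds us].
rewrite !inE => /orP[/eqP->|hs] /orP[/eqP->|h's] //; last exact: IH.
  by move=> e; rewrite e map_f in ds.
by move=> e; rewrite -e map_f in ds.
Qed.

Lemma opp_neq (h : half q) : opp_half h != h.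
Proof. by case: h => e b; rewrite xpair_eqE eqxx /=; case: b. Qed.

Definition all_halves := all_darts M ++ map (@opp_half q) (all_darts M).

Lemma all_halves_mem h : h \in all_halves.
Proof.
case: h => e b; have [b' h'] := mem_edges e mM; rewrite mem_cat.
case: (eqVneq b b') => [->|bb]; first by rewrite h'.
apply/orP; right; apply/mapP; exists (e, b') => //.
by congr pair; case: b b' bb {h'} => [] [].
Qed.

Lemma all_halves_uniq : uniq all_halves.
Proof.
rewrite cat_uniq all_darts_uniq map_inj_uniq ?all_darts_uniq ?andbT; last first.
  exact: (can_inj (@opp_halfK q)).
apply/hasPn => _ /mapP[h hD ->] /=; apply/negP => h'D.
by have := all_darts_inj hD h'D erefl => /eqP; rewrite eq_sym (negbTE (opp_neq h)).
Qed.

Lemma card_halves (P : pred (half q)) : #|[set h | P h]| = count P all_halves.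
Proof.
rewrite -size_filter -(card_uniqP (filter_uniq P all_halves_uniq)).
by apply: eq_card => h; rewrite inE mem_filter all_halves_mem andbT.
Qed.

Lemma valence_count v : valence g v =
  count_mem v (map g (all_darts M) ++ map (g \o @opp_half q) (all_darts M)).
Proof.
rewrite /valence /star card_halves /all_halves; move: (all_darts M) => D.
by rewrite !count_cat !count_map.
Qed.

Let cinr (T U : eqType) (s : seq U) x : count_mem (inr x : T + U)%type (map inr s) = count_mem x s.
Proof. by rewrite count_map; apply: eq_count => y /=; apply/eqP/eqP => [[]|->]. Qed.

Let cinl (T U : eqType) (s : seq T) x : count_mem (inl x : T + U)%type (map inl s) = count_mem x s.
Proof. by rewrite count_map; apply: eq_count => y /=; apply/eqP/eqP => [[]|->]. Qed.

Let cinrl (T U : eqType) (s : seq U) x : count_mem (inl x : T + U)%type (map inr s) = 0%N.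
Proof. by rewrite count_map (eq_count (a2 := pred0)) ?count_pred0. Qed.

Let cinlr (T U : eqType) (s : seq T) x : count_mem (inr x : T + U)%type (map inl s) = 0%N.
Proof. by rewrite count_map (eq_count (a2 := pred0)) ?count_pred0. Qed.

Lemma full_count r (s : seq 'I_r) i : full s -> count_mem i s = 1%N.
Proof. by move=> fs; rewrite count_uniq_mem ?(full_mem i fs) //; case/andP: fs. Qed.

Lemma valence_inr i : valence g (inr i) = (3 + bs * (src M == i) + bt * (tgt M == i))%N.
Proof.
have := full_count i (mkv mM); rewrite valence_count (sources mM) (targets mM).
rewrite /vertices !count_cat cinlr !cinr -!cats1 !(count_cat, count_nseq) /= !(count_cat, count_nseq) /= ?(count_cat, count_nseq) /=.
by case: bs bt => [] []; case: (src M == i); case: (tgt M == i); lia.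
Qed.

Lemma valence_inl x : valence g (inl x) = 1%N.
Proof.
rewrite -(full_count x (mkx mM)) valence_count (sources mM) (targets mM).
by rewrite count_cat cinrl count_cat cinrl cinl.
Qed.

Lemma src_neq_tgt : src M != tgt M.
Proof. by have /andP[/= /andP[+ _] _] := mkv mM; rewrite inE negb_or => /andP[]. Qed.

Lemma defect_marking : defect g = (bs + bt)%N.
Proof.
rewrite /defect (eq_bigr (fun i => (bs * (src M == i) + bt * (tgt M == i))%N)); last first.
  by move=> i _; rewrite valence_inr -addnA addKn.
rewrite big_split -!big_distrr /=; congr (_ + _)%N.
  by rewrite (bigD1 (src M)) //= eqxx big1 ?addn0 ?muln1 // => i /negbTE; rewrite eq_sym => ->.
by rewrite (bigD1 (tgt M)) //= eqxx big1 ?addn0 ?muln1 // => i /negbTE; rewrite eq_sym => ->.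
Qed.

Lemma frame_dart h : h \in frame_darts M -> exists i j, g h = inr i /\ g (opp_half h) = inr j.
Proof.
have [[a1 b1 _ _] [a2 b2 _ _] [a3 b3 _ _] _ _ _ _ _] := mM.
rewrite !mem_cat => /or3P[] hP.
- have [i _ ei] := mem_map_eq a1 hP; have [j _ ej] := mem_map_eq b1 hP.
  by exists i, j.
- have [i _ ei] := mem_map_eq a2 hP; have [j _ ej] := mem_map_eq b2 hP.
  by exists i, j.
- have [i _ ei] := mem_map_eq a3 hP; have [j _ ej] := mem_map_eq b3 hP.
  by exists i, j.
Qed.

Definition hair_roots := inner (arm1 M) ++ inner (arm2 M) ++ inner (arm3 M) ++
  nseq bs (src M) ++ nseq bt (tgt M).

Lemma hair_roots_uniq : uniq hair_roots.
Proof.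
apply: count_mem_uniq => i; have := full_count i (mkv mM).
suff le1 : (count_mem i hair_roots <= count_mem i (vertices M))%N.
  by move: le1 => /[swap] ->; rewrite -has_pred1 has_count; case: (count_mem i _) => [|[]].
rewrite /hair_roots /vertices !(count_cat, count_nseq) /= !(count_cat, count_nseq) /=.
by case: bs bt => [] []; case: (src M == i); case: (tgt M == i); lia.
Qed.

Lemma hair_sources : map g (hair_darts M) = map inr hair_roots.
Proof.
have [[_ _ a1 _] [_ _ a2 _] [_ _ a3 _] [a4 _] [a5 _] _ _ _] := mM.
by rewrite /hair_darts /hair_roots !map_cat a1 a2 a3 a4 a5.
Qed.

Lemma hair_targets : map (g \o @opp_half q) (hair_darts M) = map inl (all_tips M).
Proof.
have [[_ _ _ a1] [_ _ _ a2] [_ _ _ a3] [_ a4] [_ a5] _ _ _] := mM.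
by rewrite /hair_darts /all_tips !map_cat a1 a2 a3 a4 a5.
Qed.

Lemma hair_dart h : h \in hair_darts M -> exists i x, g h = inr i /\ g (opp_half h) = inl x.
Proof.
move=> hP; have [i _ ei] := mem_map_eq hair_sources hP.
by have [x _ ex] := mem_map_eq hair_targets hP; exists i, x.
Qed.

Lemma frame_or_hair e : e \in map fst (frame_darts M) \/ e \in map fst (hair_darts M).
Proof.
have [b] := mem_edges e mM; rewrite mem_cat => /orP[] h; [left|right];
by apply/mapP; exists (e, b).
Qed.

Lemma frame_not_hair h h' : h \in frame_darts M -> h' \in hair_darts M -> h.1 != h'.1.
Proof.
move=> hF hH; apply/eqP => e; have [i [j [_ gj]]] := frame_dart hF.
have [i' [x [_ gx]]] := hair_dart hH.
have E : h = h' by apply: all_darts_inj; rewrite // mem_cat ?hF ?hH ?orbT.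
by rewrite E gx in gj.
Qed.

(** The frame as predicted by the marking; [frameE] identifies it with [frame] once the tree-type
    edges are known. *)
Definition core_cell (x : cell k n q) : bool :=
  match x with inl (inl _) => false | inl (inr _) => true | inr e => e \in map fst (frame_darts M) end.

Definition arms := [:: arm1 M; arm2 M; arm3 M].

Definition arm_cells (A : arm k n q) : seq (cell k n q) :=
  [:: internal k q (src M), internal k q (tgt M) &
      map inr (map fst (darts A)) ++ map (@internal k n q) (inner A)].

Lemma arms_ok A : List.In A arms -> arm_ok g (src M) (tgt M) A.
Proof. by case: mM => ? ? ? _ _ _ _ _ /= [<-|[<-|[<-|]]]. Qed.

Lemma sub_uniq (T : eqType) (s1 s2 : seq T) : (forall x, count_mem x s1 <= count_mem x s2)%N ->
  uniq s2 -> uniq s1.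
Proof.
move=> le u2; apply: count_mem_uniq => x; have := le x; rewrite (count_uniq_mem _ u2).
rewrite -[in RHS]has_pred1 has_count; case: (count_mem x s1) => [|[|r]] //=; by case: (x \in s2).
Qed.

Lemma arm_cells_uniq A : List.In A arms -> uniq (arm_cells A).
Proof.
move=> AM; rewrite -[arm_cells A]/(map (@internal k n q) [:: src M; tgt M] ++ _ ++ _).
rewrite uniq_catCA cat_uniq -map_cat (map_inj_uniq inr_inj) (map_inj_uniq (@internal_inj k n q)).
have /andP[uv _] := mkv mM; have /andP[ue _] := mke mM.
apply/and3P; split.
- apply: sub_uniq ue => x; rewrite /all_darts /frame_darts !map_cat !count_cat.
  by case: AM => [<-|[<-|[<-|]]] //; lia.
- by apply/hasPn => _ /mapP[i _ ->]; apply/mapP => -[].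
- apply: sub_uniq uv => x; rewrite /vertices /= !count_cat.
  by case: AM => [<-|[<-|[<-|]]] //; lia.
Qed.

Lemma core_cellP x : core_cell x -> exists2 A, List.In A arms & x \in arm_cells A.
Proof.
case: x => [[//|i]|e] /=.
  move=> _; have := full_mem i (mkv mM); rewrite /vertices !inE !mem_cat.
  case/or3P=> [/eqP->|/eqP->|/or3P[] iI].
  - by exists (arm1 M); [left|rewrite inE eqxx].
  - by exists (arm1 M); [left|rewrite !inE eqxx orbT].
  - by exists (arm1 M); [left|rewrite !inE mem_cat (map_f (@internal k n q) iI) !orbT].
  - by exists (arm2 M); [right; left|rewrite !inE mem_cat (map_f (@internal k n q) iI) !orbT].
  - by exists (arm3 M); [do 2 right; left|rewrite !inE mem_cat (map_f (@internal k n q) iI) !orbT].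
rewrite /frame_darts !map_cat !mem_cat => /or3P[] eP.
- by exists (arm1 M); [left|rewrite !inE mem_cat (map_f _ eP) !orbT].
- by exists (arm2 M); [right; left|rewrite !inE mem_cat (map_f _ eP) !orbT].
- by exists (arm3 M); [do 2 right; left|rewrite !inE mem_cat (map_f _ eP) !orbT].
Qed.

Lemma arm_cells_core A x : List.In A arms -> x \in arm_cells A -> core_cell x.
Proof.
move=> AM; rewrite !inE mem_cat => /or3P[/eqP->|/eqP->|/orP[/mapP[e eA ->]|/mapP[i _ ->]]] //=.
rewrite /frame_darts !map_cat !mem_cat.
by case: AM eA => [<-|[<-|[<-|//]]] ->; rewrite ?orbT.
Qed.

(** * Connectedness of a theta graph without one of its cells *)

Section Connect.
Variables (S : {set cell k n q}) (c : cell k n q).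
Hypothesis coreS : forall x, core_cell x -> x != c -> x \in S.

Let r := incident_in g S.
Let rs : connect_sym r.
Proof. by apply: sym_connect_sym; apply: incident_in_sym. Qed.
Let u := internal k q (src M).
Let w := internal k q (tgt M).

Lemma connect_arm A x : List.In A arms -> x \in arm_cells A -> x != c ->
  u != c /\ connect r x u \/ w != c /\ connect r x w.
Proof.
move=> AM xA xc; have [a1 a2 _ _] := arms_ok AM.
have [p [pp lp qp]] := arm_walk a1 a2.
have qA : perm_eq (u :: p) (arm_cells A).
  rewrite perm_cons (permPl qp) map_rcons -cats1 catA perm_catC /=.
  by rewrite perm_cons perm_refl.
rewrite -[w](lp : last u p = w); apply: (connect_path rs pp) => //; last by rewrite (perm_mem qA).
  by rewrite (perm_uniq qA) arm_cells_uniq.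
move=> y z; rewrite !(perm_mem qA) => yA zA yc zc yz.
by rewrite /r /incident_in !coreS // (arm_cells_core AM).
Qed.

(** Arms share only the branch vertices, so [c] misses one of the first two arms. *)
Lemma connect_through : u != c -> w != c -> connect r u w.
Proof.
move=> uc wc; have [A AM cA] : exists2 A, List.In A arms & c \notin arm_cells A.
  have [c1|c1] := boolP (c \in arm_cells (arm1 M)); last by exists (arm1 M) => //; left.
  exists (arm2 M); first by right; left.
  apply/negP=> c2; move: c1 c2; rewrite !inE ![c == _]eq_sym (negbTE uc) (negbTE wc) /= !mem_cat.
  have /andP[uv _] := mkv mM; have /andP[ue _] := mke mM.
  move=> /orP[] /mapP[x x1 ->] /orP[] /mapP[y y1] //= [xy]; rewrite -{}xy in y1.
    move: ue; rewrite /all_darts /frame_darts !map_cat -!catA cat_uniq => /and3P[_ /hasPn H _].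
    by have := H x; rewrite mem_cat y1 x1 => /(_ isT).
  move: uv; rewrite /vertices /= cat_uniq => /and5P[_ _ _ /hasPn H _].
  by have := H x; rewrite mem_cat y1 x1 => /(_ isT).
have [a1 a2 _ _] := arms_ok AM.
have [p [pp lp qp]] := arm_walk a1 a2.
have qA : perm_eq (u :: p) (arm_cells A).
  rewrite perm_cons (permPl qp) map_rcons -cats1 catA perm_catC /=.
  by rewrite perm_cons perm_refl.
rewrite -[w](lp : last u p = w); apply: (connect_along pp); last exact: mem_last.
move=> y z; rewrite !(perm_mem qA) => yA zA yz.
rewrite /r /incident_in !coreS ?(arm_cells_core AM) //.
  by apply: contraNneq cA => <-.
by apply: contraNneq cA => <-.
Qed.

(** Every cell is joined along its arm to a branch vertex other than [c], and an arm that avoids [c]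
    joins the two branch vertices. Taking for [c] an internal vertex excludes cut vertices, a frame
    edge shows that it is not tree-type, and a cell outside the core means that nothing is
    removed. *)
Lemma connect_core x y : core_cell x -> core_cell y -> x != c -> y != c -> connect r x y.
Proof.
move=> /core_cellP[A AM xA] /core_cellP[B BM yB] xc yc.
have [[uc xu]|[wc xw]] := connect_arm AM xA xc.
  have [[_ yu]|[wc yw]] := connect_arm BM yB yc.
    by apply: (connect_trans xu); rewrite rs.
  by apply: (connect_trans xu); apply: (connect_trans (connect_through uc wc)); rewrite rs.
have [[uc yu]|[_ yw]] := connect_arm BM yB yc; last by apply: (connect_trans xw); rewrite rs.
by apply: (connect_trans xw); rewrite rs; apply: (connect_trans yu); apply: connect_through.
Qed.

End Connect.

End MarkedGraph.

Lemma uniq_map_inj (T U : eqType) (f : T -> U) (s : seq T) x y :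
  uniq (map f s) -> x \in s -> y \in s -> f x = f y -> x = y.
Proof.
elim: s => //= d s IH /andP[ds us].
rewrite !inE => /orP[/eqP->|hs] /orP[/eqP->|h's] //; last exact: IH.
  by move=> e; rewrite e map_f in ds.
by move=> e; rewrite -e map_f in ds.
Qed.

Lemma incident_halves k n q (g : graph k n q) (h : half q) : incident g (inl (g h)) (inr h.1).
Proof. by case: h => e [] /=; rewrite eqxx ?orbT. Qed.

(** * Removing the edge at a univalent vertex *)

Section Leaf.
Variables (k n q : nat) (g : graph k n q) (v : vertex k n) (h : half q).
Hypothesis star_v : star g v = [set h].

Let gh : g h = v.
Proof. by have := set11 h; rewrite -star_v inE => /eqP. Qed.

Let S : {set cell k n q} := ~: [set inr h.1].

Lemma incident_leaf x : incident g (inl v) x -> x = inr h.1.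
Proof.
case: x => //= e ge; have [b] : exists b, (e, b) \in star g v.
  by case/orP: ge => ge; [exists false|exists true]; rewrite inE.
by rewrite star_v inE => /eqP <-.
Qed.

Lemma component_leaf : component g S (inl v) = [set inl v].
Proof.
apply/setP => y; rewrite !inE; apply/andP/eqP => [[_ /connectP[p]]|->]; last by rewrite connect0.
case: p => [_ -> //|z p /= /andP[/and3P[_ zS xz] _] _].
by move: zS; rewrite (incident_leaf xz) !inE eqxx.
Qed.

Hypothesis conn : connected g setT.
Hypothesis opp_v : g (opp_half h) != v.

Lemma component_trunk : component g S (inl (g (opp_half h))) = ~: [set inr h.1; inl v].
Proof.
have := opp_v; set y := g (opp_half h) => yv.
have cs := sym_connect_sym (@incident_in_sym _ _ _ g S).
have yS : inl y \in S by rewrite !inE.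
apply/setP => z; rewrite in_setC in_set2 negb_or; apply/idP/andP => [|[ze zv]].
  rewrite !inE => /andP[-> yz]; split=> //; apply: contraNneq yv => zv.
  have : inl y \in component g S (inl v) by rewrite inE yS cs -zv.
  by rewrite component_leaf inE (inj_eq inl_inj).
(* The edge, the leaf and the component are together closed under incidence in the whole connected
   graph, hence exhaust it. *)
pose D := inr h.1 |: (inl v |: component g S (inl y)).
have D1 : closed (incident_in g setT) (mem D).
  apply: intro_closed => [|a b /and3P[_ _ ab]]; first by apply: sym_connect_sym; apply: incident_in_sym.
  rewrite !inE => /or3P[/eqP ae|/eqP av|/andP[aS ya]].
  - move: ab; rewrite ae; case: b => //= b; have hE : h = (h.1, h.2) by case: (h).
    move=> H; have /orP : (b == v) || (b == y).
      move: H; rewrite -gh /y hE /opp_half /= => /orP[] /eqP <-; case: (h.2); by rewrite eqxx ?orbT.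
    by case=> /eqP ->; rewrite ?eqxx ?connect0 ?orbT.
  - by move: ab; rewrite av => /incident_leaf ->; rewrite eqxx.
  - case: eqP => //= be; case: eqP => //= bv.
    apply: (connect_trans ya); apply: connect1; rewrite /incident_in ab andbT !inE aS.
    exact/eqP.
have yD : inl y \in D by rewrite !inE connect0 orbT.
have : z \in D.
  rewrite -(closed_connect D1 (x := inl y)) //.
  by have /forallP/(_ (inl y))/implyP/(_ (in_setT _))/forallP/(_ z)/implyP := conn; apply.
by rewrite !inE (negbTE ze) (negbTE zv).
Qed.

Hypothesis betti2 : betti1 (k := k) (n := n) (q := q) setT = 2%N.

(** One side is a point, a tree; the other side has lost one edge and one vertex, so its first Betti
    number is still 2. *)
Lemma tree_type_leaf : tree_type g h.1.
Proof.
have tip : is_tree g (component g S (inl v)).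
  rewrite component_leaf /is_tree /betti1; apply/andP; split.
    apply/forallP => x; apply/implyP; rewrite inE => /eqP ->.
    by apply/forallP => y; apply/implyP; rewrite inE => /eqP ->; apply: connect0.
  rewrite (_ : [set _ | _] = set0); last by apply/setP => e; rewrite !inE.
  rewrite (_ : [set _ | _] = [set v]) ?cards0 ?cards1 //.
  by apply/setP => v'; rewrite !inE (inj_eq inl_inj).
have trunk : is_tree g (component g S (inl (g (opp_half h)))) = false.
  rewrite component_trunk /is_tree; apply/negbTE; rewrite negb_and; apply/orP; right.
  suff -> : betti1 (~: [set inr h.1; inl v]) = 2%N by [].
  move: betti2; rewrite /betti1.
  rewrite [X in (_ - #|pred_of_set X|)%N = 2%N -> _](_ : _ = setT); last by apply/setP => e; rewrite !inE.
  rewrite [X in (#|pred_of_set X| + 1 - _)%N = 2%N -> _](_ : _ = setT); last by apply/setP => e; rewrite !inE.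
  rewrite [X in _ -> (#|pred_of_set X| + 1 - _)%N = _](_ : _ = ~: [set h.1]); last first.
    by apply/setP => e; rewrite !inE orbF (inj_eq inr_inj).
  rewrite [X in _ -> (_ - #|pred_of_set X|)%N = _](_ : _ = ~: [set v]); last first.
    by apply/setP => e; rewrite !inE /= (inj_eq inl_inj).
  have v1 : (0 < #|[set: vertex k n]|)%N by apply/card_gt0P; exists v.
  by rewrite !cardsC1; move: v1; rewrite !cardsT !card_sum !card_ord; lia.
rewrite /tree_type; apply/andP; split.
  apply/negP => /forallP/(_ (inl v))/implyP; rewrite !inE => /(_ isT).
  move=> /forallP/(_ (inl (g (opp_half h))))/implyP; rewrite !inE => /(_ isT) C.
  have : inl (g (opp_half h)) \in component g S (inl v) by rewrite !inE.
  by rewrite component_leaf inE (inj_eq inl_inj) (negbTE opp_v).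
move: tip trunk; rewrite -{1}gh /S; case: (h) => e [] /=; rewrite /opp_half /=; by move=> -> ->.
Qed.

End Leaf.

Section TwoLoopHairy.
Variables (k n q : nat) (g : graph k n q) (bs bt : bool) (M : theta k n q).
Hypothesis mM : marking g bs bt M.
Hypothesis k_gt0 : (0 < k)%N.

Let ext0 : cell k n q := inl (inl (Ordinal k_gt0)).

Lemma connect_rootP (S : {set cell k n q}) z : (forall x, x \in S -> connect (incident_in g S) x z) ->
  connected g S.
Proof.
move=> H; apply/forallP => x; apply/implyP => xS; apply/forallP => y; apply/implyP => yS.
apply: connect_trans (H x xS) _.
by rewrite (sym_connect_sym (@incident_in_sym _ _ _ g S)); apply: H.
Qed.

Lemma connect_half (S : {set cell k n q}) (h : half q) : inl (g h) \in S -> inr h.1 \in S ->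
  connect (incident_in g S) (inl (g h)) (inr h.1).
Proof. by move=> *; apply: connect1; rewrite /incident_in incident_halves; apply/and3P. Qed.

Lemma tip_hair (x : 'I_k) : exists2 h, h \in hair_darts M & g (opp_half h) = inl x.
Proof.
have : (inl x : vertex k n) \in map inl (all_tips M) by rewrite map_f // full_mem // (mkx mM).
by rewrite -(hair_targets mM) => /mapP[h hH e]; exists h.
Qed.

(* The cells of a subset containing the core, possibly except for [c], are
   connected to a given core cell as soon as hairs are not cut. *)
Lemma connect_to_core (S : {set cell k n q}) c z : core_cell M z -> z != c ->
  (forall i, internal k q i != c) ->
  (forall x, core_cell M x -> x != c -> x \in S) -> c \notin S ->
  (forall h, h \in hair_darts M -> inl (g (opp_half h)) \in S -> inr h.1 \in S) ->
  forall x, x \in S -> connect (incident_in g S) x z.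
Proof.
move=> zc zn cv coreS cS hairS.
have cs := sym_connect_sym (@incident_in_sym _ _ _ g S).
have core x : core_cell M x -> x \in S -> connect (incident_in g S) x z.
  move=> xc xS; apply: (connect_core mM coreS) => //.
  by apply: contraNneq cS => <-.
have hair h : h \in hair_darts M -> inr h.1 \in S -> connect (incident_in g S) (inr h.1) z.
  move=> hH hS; have [i [x [gi gx]]] := hair_dart mM hH.
  have iS : internal k q i \in S by apply: coreS.
  apply: (@connect_trans _ _ (inl (g h))); last by rewrite gi; apply: core.
  by rewrite cs connect_half // gi.
case=> [[x|i]|e] xS; last 2 first.
- exact: core.
- have [eF|] := frame_or_hair mM e; first exact: core.
  by move=> /mapP[h hH ee]; rewrite ee in xS *; apply: hair.
have [h hH gx] := tip_hair x; rewrite -gx in xS *.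
have hS := hairS h hH xS; apply: connect_trans (hair h hH hS).
exact: (connect_half (h := opp_half h)).
Qed.

Lemma marking_connected : connected g setT.
Proof.
apply: (@connect_rootP _ (internal k q (src M))) => x _.
have cs := sym_connect_sym (@incident_in_sym _ _ _ g setT).
(* The excluded cell is an external vertex, which is outside the core. *)
have c1 := connect_core mM (S := setT) (c := ext0).
have core y : core_cell M y -> connect (incident_in g setT) y (internal k q (src M)).
  move=> yc; apply: c1 => //; first by move=> *; rewrite inE.
  by case: y yc => [[]|].
have hair h : h \in hair_darts M -> connect (incident_in g setT) (inr h.1) (internal k q (src M)).
  move=> hH; have [i [x' [gi gx]]] := hair_dart mM hH.
  apply: (@connect_trans _ _ (inl (g h))); last by rewrite gi; apply: core.
  by rewrite cs connect_half // inE.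
case: x => [[x|i]|e']; last 2 first.
- exact: core.
- have [eF|] := frame_or_hair mM e'; first exact: core.
  by move=> /mapP[h hH ->]; apply: hair.
have [h hH gx] := tip_hair x; rewrite -gx; apply: connect_trans (hair h hH).
by apply: (connect_half (h := opp_half h)); rewrite inE.
Qed.

Lemma marking_admissible : admissible g.
Proof.
apply/and4P; split=> //; first exact: marking_connected.
  by apply/forallP => x; rewrite (valence_inl mM).
by apply/forallP => i; rewrite (valence_inr mM) -addnA leq_addr.
Qed.

Lemma betti1_setT : betti1 (k := k) (n := n) (q := q) setT = 2%N.
Proof.
rewrite /betti1 (eq_card (B := predT)) => [|e]; last by rewrite !inE.
rewrite [X in (_ - X)%N](eq_card (B := predT)) => [|e]; last by rewrite !inE.
rewrite card_ord card_sum !card_ord; have [ek en eq] := marking_dims mM.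
move: ek en eq; set r := (_ + _ + _)%N; move: (nat_of_bool bs) (nat_of_bool bt) => ? ?; lia.
Qed.

Lemma frame_edge_connected e : e \in map fst (frame_darts M) -> connected g (~: [set inr e]).
Proof.
move=> eF; apply: (@connect_rootP _ (internal k q (src M))).
apply: (@connect_to_core _ (inr e)) => //.
- by move=> x _ xe; rewrite !inE.
- by rewrite !inE eqxx.
- move=> h hH _; rewrite !inE; apply/eqP => -[he]; move: eF => /mapP[h' hF].
  by rewrite -he => E; have := frame_not_hair mM hF hH; rewrite E eqxx.
Qed.

Lemma star_tip h x : h \in hair_darts M -> g (opp_half h) = inl x ->
  star g (inl x) = [set opp_half h].
Proof.
move=> hH gx; have : #|star g (inl x)| == 1%N by rewrite -[#|_|]/(valence _ _) (valence_inl mM).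
case/cards1P => h0 E; have : opp_half h \in star g (inl x) by rewrite inE gx.
by rewrite E inE => /eqP ->.
Qed.

Lemma tree_type_hair e : tree_type g e = (e \in map fst (hair_darts M)).
Proof.
have [eF|/mapP[h hH ->]] := frame_or_hair mM e.
  rewrite /tree_type frame_edge_connected //=; apply/esym/negbTE/negP => /mapP[h hH E].
  case/mapP: eF => h' hF E'; have := frame_not_hair mM hF hH.
  by rewrite -E -E' eqxx.
rewrite (map_f _ hH); have [i [x [gi gx]]] := hair_dart mM hH.
have opp_x : g (opp_half (opp_half h)) != inl x by rewrite opp_halfK gi.
exact: (tree_type_leaf (star_tip hH gx) marking_connected opp_x betti1_setT).
Qed.

Lemma internal_frame i : inl (inr i) \in frame g.
Proof.
rewrite inE; have in_frame h : h \in frame_darts M -> ~~ tree_type g h.1.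
  move=> hF; rewrite tree_type_hair; apply/mapP => -[h' h'H E].
  by have := frame_not_hair mM hF h'H; rewrite E eqxx.
suff [h [hF gh]] : exists h, h \in frame_darts M /\ (g h = inr i \/ g (opp_half h) = inr i).
  case: gh => gh; apply/existsP; [exists h|exists (opp_half h)];
  by apply/andP; split; [rewrite inE gh eqxx|exact: in_frame hF].
have F A : List.In A (arms M) -> {subset darts A <= frame_darts M}.
  by move=> AM h hA; rewrite /frame_darts !mem_cat; case: AM hA => [<-|[<-|[<-|//]]] ->; rewrite ?orbT.
have V A : List.In A (arms M) -> i \in src M :: inner A -> exists h, h \in frame_darts M /\ (g h = inr i \/ g (opp_half h) = inr i).
  move=> AM iA; have [e _ _ _] := arms_ok mM AM.
  have : (inr i : vertex k n) \in map inr (src M :: inner A) by rewrite map_f.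
  by rewrite -e => /mapP[h hA ->]; exists h; split; [apply: F hA|left].
have := full_mem i (mkv mM); rewrite /vertices !inE !mem_cat => /or3P[iu|/eqP->|/or3P[] iI].
- by apply: (V (arm1 M)); [left|rewrite inE iu].
- have [_ e _ _] := mk1 mM.
  have : (inr (tgt M) : vertex k n) \in map inr (rcons (inner (arm1 M)) (tgt M)).
    by rewrite map_f // mem_rcons inE eqxx.
  rewrite -e => /mapP[h hA ->]; exists h; split; [apply: (F (arm1 M)) hA|by right].
  by left.
- by apply: (V (arm1 M)); [left|rewrite inE iI orbT].
- by apply: (V (arm2 M)); [right; left|rewrite inE iI orbT].
- by apply: (V (arm3 M)); [do 2 right; left|rewrite inE iI orbT].
Qed.

Lemma frameE x : (x \in frame g) = core_cell M x.
Proof.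
case: x => [[x|i]|e]; last 2 first.
- exact: internal_frame.
- rewrite inE tree_type_hair; have [eF|eH] := frame_or_hair mM e.
    rewrite /= eF; apply/mapP => -[h' h'H E]; case/mapP: eF => h hF E'.
    by have := frame_not_hair mM hF h'H; rewrite -E -E' eqxx.
  rewrite eH; apply/esym/negbTE/negP => /= /mapP[h hF E].
  case/mapP: eH => h' h'H E'; have := frame_not_hair mM hF h'H.
  by rewrite -E -E' eqxx.
rewrite inE /=; apply/existsP => -[h /andP[hx]]; rewrite tree_type_hair; case/negP.
have [h' h'H gx] := tip_hair x.
by move: hx; rewrite (star_tip h'H gx) inE => /eqP ->; rewrite -[_.1]/(h'.1) map_f.
Qed.

Lemma marking_hair h : h \in hair_darts M -> hair g h.1.
Proof.
move=> hH; rewrite /hair tree_type_hair map_f //=.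
have [i [x [gi gx]]] := hair_dart mM hH.
suff H : [&& valence g (g (opp_half h)) == 1%N, inl (g h) \in frame g &
   [forall h' in star g (g h), tree_type g h'.1 ==> (h'.1 == h.1)]].
  by apply/existsP; exists (~~ h.2); rewrite negbK -surjective_pairing.
rewrite gx gi (valence_inl mM) eqxx internal_frame /=.
apply/forallP => h'; apply/implyP; rewrite inE => /eqP gh'; apply/implyP.
rewrite tree_type_hair => /mapP[h2 h2H E].
have [i2 [x2 [gi2 gx2]]] := hair_dart mM h2H.
have Eh : h' = h2.
  case: h' h2 E gh' gx2 {h2H gi2} => e b [e2 b2] /= -> gh'; rewrite /opp_half /=.
  by case: b b2 gh' => [] [] //= ->.
rewrite Eh in gh' *; apply/eqP; congr fst.
(* No two hairs have the same root. *)
apply: (uniq_map_inj (f := g) (s := hair_darts M)) => //; last by rewrite gh' gi.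
by rewrite (hair_sources mM) (map_inj_uniq inr_inj) (hair_roots_uniq mM).
Qed.

Lemma marking_two_loop_hairy : two_loop_hairy g.
Proof.
rewrite /two_loop_hairy marking_admissible betti1_setT eqxx /=; apply/andP; split.
  apply/forallP => v; rewrite /cut_vertex frameE; case: v => [//|i] /=.
  apply/negPn; have vc : connect_sym (incident_in g (frame g :\ internal k q i)).
    by apply: sym_connect_sym; apply: incident_in_sym.
  apply/forallP => x; apply/implyP; rewrite in_setD1 frameE => /andP[xi xc].
  apply/forallP => y; apply/implyP; rewrite in_setD1 frameE => /andP[yi yc].
  apply: (connect_core mM (c := internal k q i)) => // z zc zi.
  by rewrite in_setD1 zi frameE.
apply/forallP => e; rewrite tree_type_hair; apply/implyP => /mapP[h hH ->].
exact: marking_hair.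
Qed.

End TwoLoopHairy.

(** * Two-loop hairy graphs have markings *)

Definition is_int k n (v : vertex k n) : bool := if v is inr _ then true else false.

Lemma map_inr_of k n (s : seq (vertex k n)) : all (@is_int k n) s -> exists t, s = map inr t.
Proof.
elim: s => [|v s IH] /=; first by exists [::].
by case: v => //= i /IH[t ->]; exists (i :: t).
Qed.

Lemma map_inl_of k n (s : seq (vertex k n)) : all (predC (@is_int k n)) s -> exists t, s = map inl t.
Proof.
elim: s => [|v s IH] /=; first by exists [::].
by case: v => //= i /IH[t ->]; exists (i :: t).
Qed.

(** * Walks along the frame between branch vertices *)

Section FrameWalks.
Variables (k n q : nat) (g : graph k n q).

(** In a two-loop hairy graph these are the darts of the frame, by [inner_dartE]. *)
Definition inner_dart (h : half q) : bool := is_int (g h) && is_int (g (opp_half h)).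

Definition inner_star (v : vertex k n) : {set half q} := [set h | inner_dart h && (g h == v)].

Definition branch (v : vertex k n) : bool := (2 < #|inner_star v|)%N.

(** Taking [h] as its own partner at all other vertices makes [partner] an involution on the inner
    darts, and hence [next] injective on them. *)
Definition partner (h : half q) : half q :=
  if #|inner_star (g h)| == 2%N then odflt h [pick h' in inner_star (g h) :\ h] else h.

Lemma inner_dart_opp h : inner_dart (opp_half h) = inner_dart h.
Proof. by rewrite /inner_dart opp_halfK andbC. Qed.

Lemma partnerP h : inner_dart h -> #|inner_star (g h)| = 2%N ->
  [/\ partner h != h, g (partner h) = g h, inner_dart (partner h) &
      inner_star (g h) = [set h; partner h]].
Proof.
move=> ih c2; have hS : h \in inner_star (g h) by rewrite inE ih eqxx.
have : #|inner_star (g h) :\ h| == 1%N by move: (cardsD1 h (inner_star (g h))); rewrite hS c2 add1n => /eqP; rewrite eqSS eq_sym.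
rewrite /partner c2 eqxx => /cards1P[h' E]; case: pickP => [x|/(_ h')]; last by rewrite E set11.
rewrite E inE => /eqP -> /=; have : h' \in inner_star (g h) :\ h by rewrite E set11.
rewrite !inE => /and3P[-> -> /eqP]; split=> //.
by rewrite -(setD1K hS) E.
Qed.

Lemma partner_root h : g (partner h) = g h.
Proof.
rewrite /partner; case: ifP => // _; case: pickP => //= x.
by rewrite !inE => /and3P[_ _ /eqP].
Qed.

Lemma partner_inner h : inner_dart h -> inner_dart (partner h).
Proof.
rewrite /partner; case: ifP => // _; case: pickP => //= x.
by rewrite !inE => /and3P[].
Qed.

Lemma partnerK h : inner_dart h -> partner (partner h) = h.
Proof.
move=> ih; have [c2|c2] := eqVneq #|inner_star (g h)| 2%N; last first.
  have -> : partner h = h by rewrite /partner (negbTE c2).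
  by rewrite /partner (negbTE c2).
have [nh gh ih' E] := partnerP ih c2.
have [] := partnerP ih'; first by rewrite gh.
rewrite gh E => n2 g2 i2 E2.
have : partner (partner h) \in [set h; partner h].
  by rewrite E2 !inE eqxx orbT.
by rewrite !inE (negbTE n2) orbF => /eqP.
Qed.

(* The next dart when walking along the frame; a walk turns back only at the
   vertices which do not have exactly two inner darts. *)
Definition next (h : half q) : half q := partner (opp_half h).

Lemma next_root h : g (next h) = g (opp_half h).
Proof. exact: partner_root. Qed.

Lemma next_inner h : inner_dart h -> inner_dart (next h).
Proof. by rewrite -inner_dart_opp => /partner_inner. Qed.

Lemma next_inj h h' : inner_dart h -> inner_dart h' -> next h = next h' -> h = h'.
Proof.
rewrite -inner_dart_opp -(inner_dart_opp h') => ih ih' E.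
by apply: (can_inj (@opp_halfK q)); rewrite -(partnerK ih) -(partnerK ih') -/(next h) E.
Qed.

Lemma iter_next_inner i h : inner_dart h -> inner_dart (iter i next h).
Proof. by move=> ih; elim: i => //= i; apply: next_inner. Qed.

Lemma iter_next_inj i h h' : inner_dart h -> inner_dart h' -> iter i next h = iter i next h' -> h = h'.
Proof.
move=> ih ih'; elim: i => //= i IH /next_inj E; apply: IH; apply: E; exact: iter_next_inner.
Qed.

(** [j] counts the vertices passed strictly between the two branch vertices; the darts are the
    iterates 0 to [j]. *)
Definition trail (a : half q) (j : nat) : Prop :=
  [/\ inner_dart a, branch (g a),
      forall i, (i < j)%N -> ~~ branch (g (opp_half (iter i next a))) &
      branch (g (opp_half (iter j next a)))].

(** [next] is injective on a finite set, so the walk returns to [a]; the dart before that ends at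
    the branch vertex [g a]. The first dart ending at a branch vertex gives [j]. *)
Lemma trail_exists a : inner_dart a -> branch (g a) -> exists j, trail a j.
Proof.
move=> ia ba; pose P j := branch (g (opp_half (iter j next a))).
have exP : exists j, P j.
  have /injectivePn[x [y xy]] : ~~ injectiveb (fun i : 'I_#|{: half q}|.+1 => iter i next a).
    apply/negP => /injectiveP /leq_card; rewrite card_ord => H; by rewrite ltnn in H.
  wlog lt : x y xy / (x < y)%N => [H|] E.
    move: (xy); rewrite neq_ltn => /orP[] lt; first exact: (H x y).
    by apply: (H y x) => //; rewrite eq_sym.
  exists (y - x).-1; rewrite /P -next_root -iterS prednK ?subn_gt0 //.
  suff <- : a = iter (y - x) next a by [].
  apply: (@iter_next_inj x) => //; first exact: iter_next_inner.
  by rewrite -iterD subnKC // ltnW.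
exists (ex_minn exP); case: ex_minnP => j Pj jmin; split=> // i ij.
by apply/negP => /jmin; rewrite leqNgt ij.
Qed.

Hypothesis inner2 : forall h, inner_dart h -> (1 < #|inner_star (g h)|)%N.

Section Trail.
Variables (a : half q) (j : nat).
Hypothesis ta : trail a j.

Notation d i := (iter i next a).

Lemma trail_inner i : inner_dart (d i).
Proof. by case: ta => ia *; apply: iter_next_inner. Qed.

Lemma trail_nonbranch i : (0 < i <= j)%N -> ~~ branch (g (d i)).
Proof. by case: i => // i /= ij; rewrite next_root; case: ta => _ _ ->. Qed.

Lemma nonbranch2 h : inner_dart h -> ~~ branch (g h) -> #|inner_star (g h)| = 2%N.
Proof. by move=> /inner2; rewrite /branch; lia. Qed.

Lemma trail_star i : (i < j)%N ->
  inner_star (g (d i.+1)) = [set opp_half (d i); d i.+1] /\ d i.+1 != opp_half (d i).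
Proof.
move=> ij; have io : inner_dart (opp_half (d i)) by rewrite inner_dart_opp trail_inner.
have c2 : #|inner_star (g (opp_half (d i)))| = 2%N.
  by apply: nonbranch2 => //; case: ta => _ _ ->.
by have [n2 g2 i2 E2] := partnerP io c2; rewrite /= next_root -E2.
Qed.

Lemma trail_back i : (i < j)%N -> partner (d i.+1) = opp_half (d i).
Proof. by move=> ij; rewrite iterS /next partnerK // inner_dart_opp trail_inner. Qed.

Lemma trail_root i h : (0 < i <= j)%N -> inner_dart h -> g h = g (d i) ->
  h = opp_half (d i.-1) \/ h = d i.
Proof.
case: i => // i /= ij ih gh; have [E _] := trail_star ij.
have : h \in inner_star (g (d i.+1)) by rewrite inE ih gh eqxx.
by rewrite E !inE => /orP[] /eqP ->; [left|right].
Qed.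

End Trail.

(** Both walks are followed backwards until one reaches its start. This is a branch vertex, and the
    other trail meets branch vertices only at its ends. *)
Lemma trail_disjoint a j b l i i' : trail a j -> trail b l -> (i <= j)%N -> (i' <= l)%N ->
  iter i next a = iter i' next b -> i = i' /\ a = b.
Proof.
wlog le : a j b l i i' / (i <= i')%N => [H ta tb ij il E|ta tb ij il].
  case/orP: (leq_total i i') => le; first exact: (H a j b l).
  by have [] := H b l a j i' i le tb ta il ij (esym E).
have [[ia ba _ _] [ib bb _ _]] := (ta, tb).
rewrite -(subnKC le) iterD => /iter_next_inj E.
have {}E : a = iter (i' - i) next b by apply: E => //; apply: iter_next_inner.
have [z|p] := posnP (i' - i); first by rewrite z in E; split; [lia|].
by have := trail_nonbranch tb (i := i' - i); rewrite -E ba p (leq_trans (leq_subr _ _)) // => /(_ isT).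
Qed.

(** If dart i of one trail is the reverse of dart i' of the other, then dart i - 1 is the reverse of
    dart i' + 1. Descending to i = 0 puts the start of the first trail at the end of the second. *)
Lemma trail_opp a j b l : trail a j -> trail b l -> g a != g (opp_half (iter l next b)) ->
  g a = g b ->
  forall i i', (i <= j)%N -> (i' <= l)%N -> iter i next a <> opp_half (iter i' next b).
Proof.
move=> ta tb ne _ i; have [[ia ba _ _] [ib bb nb be]] := (ta, tb).
elim: i => [|i IH] i' ij il E.
  move: il; rewrite leq_eqVlt => /orP[/eqP il|/nb]; first by rewrite -il -E eqxx in ne.
  by rewrite -E ba.
have nbi := trail_nonbranch ta (i := i.+1) ij.
move: il; rewrite leq_eqVlt => /orP[/eqP il|il]; first by rewrite E il be in nbi.
apply: (IH i'.+1 (ltnW ij) il).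
by rewrite -[LHS](@opp_halfK q) -(trail_back ta) // E.
Qed.

End FrameWalks.

Local Open Scope nat_scope.

(** * The branch vertices of a two-loop hairy graph *)

Section Recognition.
Variables (k n q : nat) (g : graph k n q).
Hypothesis gH : two_loop_hairy g.

Let adm : admissible g. Proof. by case/and4P: gH. Qed.
Let conn : connected g setT. Proof. by case/and4P: adm. Qed.
Let betti2 : betti1 (k := k) (n := n) (q := q) setT = 2%N. Proof. by case/and4P: gH => _ /eqP. Qed.

Lemma ext_star x : exists h, star g (inl x) = [set h].
Proof. by case/and4P: adm => _ _ /forallP/(_ x)/cards1P. Qed.

Lemma ext_root_inj h h' x : g h = inl x -> g h' = inl x -> h = h'.
Proof.
have [h0 E] := ext_star x => gh gh'.
have : h \in star g (inl x) by rewrite inE gh.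
have : h' \in star g (inl x) by rewrite inE gh'.
by rewrite E !inE => /eqP -> /eqP ->.
Qed.

Lemma ext_opp_neq h x : g h = inl x -> g (opp_half h) <> inl x.
Proof. by move=> gh gh'; have := ext_root_inj gh gh' => /eqP; rewrite eq_sym (negbTE (opp_neq h)). Qed.

Lemma ext_tree h x : g h = inl x -> tree_type g h.1.
Proof.
move=> gh; have [h0 E] := ext_star x.
have hh : h = h0 by have : h \in star g (inl x) by [rewrite inE gh]; rewrite E inE => /eqP.
rewrite hh in gh *; apply: (tree_type_leaf E) => //.
by apply/eqP; apply: ext_opp_neq gh.
Qed.

Lemma tree_ext e : tree_type g e -> exists h x i, [/\ h.1 = e, g h = inr i, g (opp_half h) = inl x &
  forall h', g h' = inr i -> tree_type g h'.1 -> h'.1 = e].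
Proof.
move=> te; case/and4P: gH => _ _ _ /forallP/(_ e)/implyP/(_ te).
case/andP=> _ /existsP[b /and3P[v1 fr /forallP un]].
have [x gx] : exists x, g (e, b) = inl x.
  move: v1; case: (g (e, b)) => [x|i]; first by exists x.
  by case/and4P: adm => _ _ _ /forallP/(_ i) + /eqP v1; rewrite v1.
(* The end in the frame is internal: the only edge at an external vertex would be [e] itself, which
   is tree-type. *)
case gi: (g (e, ~~ b)) fr un => [x'|i] fr un.
  move: fr; rewrite inE => /existsP[h /andP[]]; rewrite inE => /eqP gh; case/negP.
  by have -> : h = (e, ~~ b) by apply: (ext_root_inj gh gi).
exists (e, ~~ b), x, i; split=> //; first by rewrite /opp_half /= negbK.
move=> h' gh' th'; apply/eqP; apply: (implyP (implyP (un h') _)) => //.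
by rewrite inE gh'.
Qed.

Lemma inner_dartE h : inner_dart g h = ~~ tree_type g h.1.
Proof.
apply/idP/negP => [/andP[i1 i2] /tree_ext[h' [x [i [E _ gx _]]]]|nt].
  have [hh|hh] : h = h' \/ h = opp_half h'.
    case: h h' E {i1 i2 gx} => e b [e' b'] /= ->; rewrite /opp_half /=.
    by case: b b' => [] []; [left|right|right|left].
  - by move: i2; rewrite hh gx.
  - by move: i1; rewrite hh gx.
apply/andP; split; first by case gh: (g h) => [x|//]; have := ext_tree gh => /nt.
by case gh: (g (opp_half h)) => [x|//]; have := ext_tree gh => /nt.
Qed.

Definition hair_star i : {set half q} := [set h | ~~ is_int (g (opp_half h)) && (g h == inr i)].

Lemma hair_starP h i : h \in hair_star i -> g h = inr i /\ exists x, g (opp_half h) = inl x.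
Proof.
rewrite inE => /andP[H /eqP ->]; split=> //.
by case E: (g (opp_half h)) H => [x|//] _; exists x.
Qed.

Lemma star_split i : star g (inr i) = inner_star g (inr i) :|: hair_star i.
Proof.
apply/setP => h; rewrite !inE /inner_dart; case: eqP => [->|]; rewrite ?andbF //= !andbT.
by case: is_int.
Qed.

Lemma hair_star_uniq i h h' : h \in hair_star i -> h' \in hair_star i -> h = h'.
Proof.
move=> /hair_starP[gi [x gx]] /hair_starP[gi' [x' gx']].
have /tree_ext[h1 [x1 [i1 [E g1 gx1 U]]]] : tree_type g h.1 by exact: (ext_tree gx).
have hh : h = h1.
  case: h h1 E gi gx1 {gx g1 U} => e b [e' b'] /= ->; rewrite /opp_half /=.
  by case: b b' => [] [] //= -> .
rewrite -hh gi in g1; case: g1 => i1E; rewrite -i1E in U.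
have E' := U h' gi' (ext_tree gx').
case: h h' E' gi' gx {gi gx' E hh U} => e b [e' b'] /= ->; rewrite /opp_half /=.
by case: b b' => [] [] //= ->.
Qed.

Lemma hair_star_le1 i : (#|hair_star i| <= 1)%N.
Proof.
rewrite leqNgt; apply/negP => /card_gt1P[h [h' [hS h'S]]].
by rewrite (hair_star_uniq hS h'S) eqxx.
Qed.

Lemma valence_split i : valence g (inr i) = (#|inner_star g (inr i)| + #|hair_star i|)%N.
Proof.
rewrite /valence star_split cardsU (_ : _ :&: _ = set0) ?cards0 ?subn0 //.
apply/setP => h; rewrite !inE /inner_dart; by case: (is_int (g (opp_half h))); rewrite ?andbF.
Qed.

Lemma inner_star_ge2 i : (1 < #|inner_star g (inr i)|)%N.
Proof.
case/and4P: adm => _ _ _ /forallP/(_ i); rewrite valence_split.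
by have := hair_star_le1 i; lia.
Qed.

Lemma inner2 h : inner_dart g h -> (1 < #|inner_star g (g h)|)%N.
Proof. by case/andP; case: (g h) => // i _ _; apply: inner_star_ge2. Qed.

Lemma card_by_root (P : pred (half q)) : #|[set h | P h]| =
  (\sum_(x < k) #|[set h | P h && (g h == inl x)]| + \sum_(i < n) #|[set h | P h && (g h == inr i)]|)%N.
Proof.
rewrite -sum1_card (partition_big g predT) //= big_sumType /=; congr (_ + _)%N;
by apply: eq_bigr => x _; rewrite -sum1_card; apply: eq_bigl => h; rewrite !inE.
Qed.

(** The Betti number gives q = k + n + 1 edges, and k of them end at the k external vertices, which
    leaves n + 1 frame edges with two half-edges each. *)
Lemma sum_inner_star : \sum_(i < n) #|inner_star g (inr i)| = (2 * n + 2)%N.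
Proof.
have ext1 : \sum_(x < k) #|star g (inl x)| = k.
  rewrite (eq_bigr (fun=> 1%N)) ?sum1_card ?card_ord // => x _.
  by have [h ->] := ext_star x; rewrite cards1.
have A : (2 * q)%N = (k + \sum_(i < n) valence g (inr i))%N.
  have := card_by_root predT; rewrite (eq_card (B := predT)) => [|h]; last by rewrite !inE.
  rewrite card_prod card_ord card_bool mulnC => ->; congr (_ + _)%N.
  by apply: etrans ext1; apply: eq_bigr => x _; apply: eq_card => h; rewrite !inE.
have B : \sum_(i < n) #|hair_star i| = k.
  have := card_by_root (fun h => ~~ is_int (g (opp_half h))).
  rewrite big1 => [|x _]; last first.
    apply/eqP; rewrite cards_eq0; apply/eqP/setP => h; rewrite !inE; apply/negbTE/negP.
    case/andP=> ext /eqP gh; case gx: (g (opp_half h)) ext => [x'|//] _.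
    have := tree_ext (ext_tree gh) => -[h1 [x1 [i1 [E1 g1 _ _]]]].
    case: h h1 E1 gh gx g1 => e b [e' b'] /= ->; rewrite /opp_half /=.
    by case: b b' => [] [] /=; congruence.
  rewrite add0n => <-; rewrite -(card_imset _ (can_inj (@opp_halfK q))).
  have := card_by_root (fun h => ~~ is_int (g h)); rewrite [X in (_ + X)%N]big1 => [|i _]; last first.
    by apply/eqP; rewrite cards_eq0; apply/eqP/setP => h; rewrite !inE; case: eqP => [->|]; rewrite ?andbF.
  rewrite addn0 (eq_bigr (fun x => #|star g (inl x)|)) => [|x _]; last first.
    by apply: eq_card => h; rewrite !inE; case: eqP => [->|]; rewrite ?andbF.
  rewrite ext1 => E; apply: etrans E; apply: eq_card => h; rewrite inE; apply/imsetP/idP => [[h' + ->]|hx].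
    by rewrite inE.
  by exists (opp_half h); rewrite ?opp_halfK // inE opp_halfK.
have C : \sum_(i < n) valence g (inr i) = (\sum_(i < n) #|inner_star g (inr i)| + k)%N.
  by apply: etrans (congr1 (addn _) B); rewrite -big_split; apply: eq_bigr => i _; rewrite valence_split.
move: betti2 A C; rewrite /betti1 (eq_card (B := predT)) => [|e]; last by rewrite !inE.
rewrite [X in (_ - X)%N = 2%N -> _](eq_card (B := predT)) => [|e]; last by rewrite !inE.
by rewrite card_ord card_sum !card_ord; lia.
Qed.

(** Leaves two shapes: two branch vertices with three inner darts each, or a single one with four.
    The latter is excluded by [trail_end], which provides a second branch vertex. *)
Lemma sum_excess : \sum_(i < n) (#|inner_star g (inr i)| - 2) = 2%N.
Proof.
apply/eqP; rewrite -(eqn_add2r (2 * n)) addnC -[X in (X + _)%N](_ : \sum_(i < n) 2 = _)%N; last first.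
  by rewrite sum_nat_const card_ord mulnC.
rewrite -big_split /= [X in _ == X]addnC -sum_inner_star; apply/eqP/eq_bigr => i _.
by rewrite subnKC // inner_star_ge2.
Qed.

Lemma branch_exists : exists u, branch g (inr u).
Proof.
have [/existsP //|] := boolP [exists u, branch g (inr u)].
rewrite negb_exists => /forallP nb; by have := sum_excess; rewrite big1 // => i _; apply/eqP; rewrite subn_eq0 leqNgt; apply: nb.
Qed.

Lemma two_branches u w : u != w -> branch g (inr u) -> branch g (inr w) ->
  [/\ #|inner_star g (inr u)| = 3%N, #|inner_star g (inr w)| = 3%N &
      forall i, i != u -> i != w -> ~~ branch g (inr i)].
Proof.
move=> uw bu bw; have := sum_excess; rewrite (bigD1 u) // (bigD1 w) 1?eq_sym //=.
set R := (\sum_(_ | _) _) => S.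
have [eu ew R0] : [/\ #|inner_star g (inr u)| = 3, #|inner_star g (inr w)| = 3 & R = 0].
  move: bu bw S; rewrite /branch; move: R #|inner_star g (inr u)| #|inner_star g (inr w)|.
  by move=> *; split; lia.
split=> // i iu iw; move/eqP: R0; rewrite sum_nat_eq0 => /forallP/(_ i).
by rewrite iu iw /= /branch subn_eq0 -leqNgt.
Qed.

Lemma frame_inner h : inner_dart g h -> inr h.1 \in frame g.
Proof. by rewrite inE -inner_dartE. Qed.

Lemma frame_root h : inner_dart g h -> inl (g h) \in frame g.
Proof. by move=> ih; rewrite inE; apply/existsP; exists h; rewrite inE eqxx -inner_dartE. Qed.

(* Otherwise the trail would be a loop based at a cut vertex of the frame. *)
Lemma trail_end a j : trail g a j -> g (opp_half (iter j (next g) a)) != g a.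
Proof.
move=> ta; apply/eqP => loop; have [ia ba nb bj] := ta.
pose d i := iter i (next g) a; have di i : inner_dart g (d i) by apply: iter_next_inner.
(* A branch vertex has at least three inner darts, and the loop uses at most two of them there. *)
have [h [hS ha hj]] : exists h, [/\ h \in inner_star g (g a), h != a & h != opp_half (d j)].
  have : (0 < #|inner_star g (g a) :\ a :\ opp_half (d j)|)%N.
    move: ba; set A := inner_star g (g a); rewrite /branch.
    by rewrite (cardsD1 a A) (cardsD1 (opp_half (d j)) (A :\ a)); move: (a \in A) (_ \in _) #|A :\ a :\ _| => [] [] r; lia.
  by case/card_gt0P => h; rewrite !in_setD1 => /and3P[hj ha hS]; exists h.
move: hS; rewrite inE => /andP[ih /eqP gh].
case/and4P: gH => _ _ /forallP/(_ (g a)) + _; case/negP; rewrite /cut_vertex frame_root //=.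
apply/negP => /forallP/(_ (inr a.1))/implyP; rewrite in_setD1 frame_inner //= => /(_ isT).
move=> /forallP/(_ (inr h.1))/implyP; rewrite in_setD1 frame_inner //= => /(_ isT).
set S := frame g :\ _.
(* The cells of the loop other than its base: closed in the frame without the base, containing the
   edge of [a] but not that of [h]. *)
pose K : pred (cell k n q) := fun x => match x with
  | inl v => [exists i : 'I_j.+1, (0 < i)%N && (g (d i) == v)]
  | inr e => [exists i : 'I_j.+1, (d i).1 == e] end.
have Kvert b h' : (b <= j)%N -> g h' = g (d b) \/ g h' = g (opp_half (d b)) -> g h' <> g a ->
    K (inl (g h')).
  move=> bj' [E|E] na; rewrite E /=; apply/existsP.
    have b0 : (0 < b)%N by rewrite lt0n; apply/eqP => b0; rewrite E b0 in na.
    by exists (Ordinal (bj' : b < j.+1)%N); rewrite /= b0 eqxx.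
  have bl : (b < j)%N.
    by rewrite ltn_neqAle bj' andbT; apply/eqP => bE; rewrite E bE in na.
  by exists (Ordinal (bl : b.+1 < j.+1)%N); rewrite /= next_root.
have Kc : closed (incident_in g S) K.
  apply: intro_closed => [|x y /and3P[xS yS xy] xK].
    by apply: sym_connect_sym; apply: incident_in_sym.
  case: x y xS yS xy xK => [v|e] [v'|e'] // xS yS.
    move=> /= ev /existsP[[b bj'] /= /andP[b0 /eqP gb]].
    have [h' [h'e gh']] : exists h', h'.1 = e' /\ g h' = v.
      by case/orP: ev => /eqP E; [exists (e', false)|exists (e', true)].
    have ih' : inner_dart g h' by move: yS; rewrite in_setD1 inE inner_dartE h'e => /andP[].
    have b0j : (0 < b <= j)%N by rewrite b0 -ltnS.
    have [E|E] := trail_root inner2 ta b0j ih' (etrans gh' (esym gb)); apply/existsP.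
      by exists (Ordinal (leq_ltn_trans (leq_pred b) bj')); rewrite -h'e E.
    by exists (Ordinal bj'); rewrite -h'e E.
  move=> /= ev /existsP[[b bj'] /= /eqP be].
  have nv : v' <> g a by move: xS yS; rewrite !in_setD1 => _ /andP[/eqP + _] => H E; apply: H; rewrite E.
  have [h' [h'e gh']] : exists h', h'.1 = e /\ g h' = v'.
    by case/orP: ev => /eqP E; [exists (e, false)|exists (e, true)].
  rewrite -gh' in nv *; apply: (Kvert b) => //.
  have [->|->] : h' = d b \/ h' = opp_half (d b); [|by left|by right].
  rewrite -h'e in be; case: (d b) h' be {gh' nv h'e} => e1 b1 [e2 b2] /= ->; rewrite /opp_half /=.
  by case: b1 b2 => [] []; [left|right|right|left].
move=> C; have := closed_connect Kc C.
have -> : inr a.1 \in K by apply/existsP; exists ord0.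
move/esym/existsP => [[b bj'] /= /eqP be].
have [E|E] : h = d b \/ h = opp_half (d b).
  case: h (d b) be {ih gh ha hj C} => e1 b1 [e2 b2] /= ->; rewrite /opp_half /=.
  by case: b1 b2 => [] []; [left|right|right|left].
  case: (posnP b) => b0; first by rewrite E b0 eqxx in ha.
  by have := trail_nonbranch ta (i := b); rewrite -/(d b) -E gh ba b0 -ltnS => /(_ bj').
have : (b <= j)%N by []. 
rewrite leq_eqVlt => /orP[/eqP b0|/nb]; first by rewrite E b0 eqxx in hj.
by rewrite -/(d b) -E gh ba.
Qed.

End Recognition.

Lemma full_of_mem n (s : seq 'I_n) : uniq s -> (forall i, i \in s) -> full s.
Proof.
move=> us ms; rewrite /full us /= -(card_uniqP us) -[X in _ == X]card_ord.
by apply/eqP; apply: eq_card => i; rewrite ms.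
Qed.

Lemma map_const (T U : eqType) (f : T -> U) c (s : seq T) :
  {in s, forall x, f x = c} -> map f s = nseq (size s) c.
Proof.
elim: s => //= x s IH H; rewrite H ?mem_head // IH // => y ys.
by apply: H; rewrite inE ys orbT.
Qed.

Lemma mem_iota0 n i : (i \in iota 0 n.+1) = (i <= n).
Proof. by rewrite mem_iota. Qed.

Lemma mem_iota1 n i : (i \in iota 1 n) = (0 < i <= n).
Proof. by rewrite mem_iota. Qed.

(** * Building a marking from the three trails at a branch vertex *)

Section Assembly.
Variables (k n q : nat) (g : graph k n q).
Hypothesis gH : two_loop_hairy g.

Let connect_all x y : connect (incident_in g setT) x y.
Proof.
case/and4P: gH => /and4P[_ + _ _] _ _ _ => /forallP/(_ x)/implyP/(_ (in_setT _)).
by move=> /forallP/(_ y)/implyP/(_ (in_setT _)).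
Qed.

Variables (u w : 'I_n) (len : half q -> nat).
Let s := enum (inner_star g (inr u)).
Notation d a i := (iter i (next g) a).
Hypothesis uw : u != w.
Hypothesis trails : forall a, a \in s -> trail g a (len a) /\ g (opp_half (d a (len a))) = inr w.
Hypotheses (cu : #|inner_star g (inr u)| = 3) (cw : #|inner_star g (inr w)| = 3).

Let in2 := @inner2 _ _ _ _ gH.

Let sP a : a \in s -> inner_dart g a /\ g a = inr u.
Proof. by rewrite mem_enum inE => /andP[-> /eqP]. Qed.

Lemma arm_inj a b i i' : a \in s -> b \in s -> i <= len a -> i' <= len b ->
  d a i = d b i' -> i = i' /\ a = b.
Proof. by move=> /trails[ta _] /trails[tb _]; apply: trail_disjoint. Qed.

Lemma arm_opp a b i i' : a \in s -> b \in s -> i <= len a -> i' <= len b ->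
  d a i <> opp_half (d b i').
Proof.
move=> as_ bs; have [ta ea] := trails as_; have [tb eb] := trails bs.
have [[_ ga] [_ gb]] := (sP as_, sP bs).
have ne : g a != g (opp_half (d b (len b))) by rewrite ga eb (inj_eq inr_inj).
by move=> il il'; exact: (trail_opp ta tb ne (etrans ga (esym gb)) il il').
Qed.

Lemma arm_root_inj a b i i' : a \in s -> b \in s -> 0 < i <= len a -> 0 < i' <= len b ->
  g (d a i) = g (d b i') -> i = i' /\ a = b.
Proof.
move=> as_ bs il il' E; have [ta _] := trails as_; have [tb _] := trails bs.
have := trail_root in2 ta il (trail_inner tb i') (esym E); case.
  move=> F; exfalso; move: F; apply: (arm_opp bs as_); lia.
by move/esym; apply: arm_inj => //; lia.
Qed.

Definition reached v := v = u \/ v = w \/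
  exists a i, [/\ a \in s, 0 < i <= len a & g (d a i) = inr v].

(** The reversed last darts of the three trails are distinct inner darts at [w], which has only
    three. *)
Lemma tgt_star : inner_star g (inr w) = [set opp_half (d a (len a)) | a in inner_star g (inr u)].
Proof.
apply/esym/eqP; rewrite eqEcard cw card_in_imset ?cu ?leqnn ?andbT => [|a b].
  apply/subsetP => _ /imsetP[a + ->]; rewrite -mem_enum => aS.
  have [ta ea] := trails aS; rewrite inE ea eqxx inner_dart_opp (trail_inner ta) //.
move=> aI bI /(can_inj (@opp_halfK q)) E.
have [aS bS] : a \in s /\ b \in s by rewrite !mem_enum.
by have [] := arm_inj aS bS (leqnn _) (leqnn _) E.
Qed.

Lemma reached_dart h v : inner_dart g h -> g h = inr v -> reached v ->
  exists a i, [/\ a \in s, i <= len a & h = d a i \/ h = opp_half (d a i)].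
Proof.
move=> ih gh [vu|[vw|[a [i [as_ il gv]]]]].
- by exists h, 0; split=> //; [rewrite mem_enum inE ih gh vu eqxx|left].
- have : h \in inner_star g (inr w) by rewrite inE ih gh vw eqxx.
  rewrite tgt_star => /imsetP[a]; rewrite -mem_enum => aS ->.
  by exists a, (len a); split=> //; right.
- have [ta _] := trails as_.
  have [->|->] := trail_root in2 ta il ih (etrans gh (esym gv)).
    by exists a, i.-1; split=> //; [lia|right].
  by exists a, i; split=> //; [lia|left].
Qed.

Lemma reached_opp h v v' : inner_dart g h -> g h = inr v -> g (opp_half h) = inr v' ->
  reached v -> reached v'.
Proof.
move=> ih gh gh' /(reached_dart ih gh)[a [i [as_ il [E|E]]]]; rewrite E ?opp_halfK in gh'.
  move: il; rewrite leq_eqVlt => /orP[/eqP il|il].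
    by move: gh'; rewrite il (proj2 (trails as_)) => -[<-]; right; left.
  by right; right; exists a, i.+1; split=> //; rewrite /= next_root.
case: (posnP i) => i0; last by right; right; exists a, i; rewrite i0.
by move: gh'; rewrite i0 /= (proj2 (sP as_)) => -[<-]; left.
Qed.

(** The reached vertices, their edges and their external neighbours are closed under incidence, and
    the graph is connected. *)
Lemma all_reached v : reached v.
Proof.
pose K : pred (cell k n q) := fun x => match x with
  | inl (inr v) => `[< reached v >]
  | inl (inl x) => `[< exists h v, [/\ g h = inl x, g (opp_half h) = inr v & reached v] >]
  | inr e => `[< exists h v, [/\ h.1 = e, g h = inr v & reached v] >] end.
have Kc : closed (incident_in g setT) K.
  apply: intro_closed => [|x y /and3P[_ _ xy] xK].
    by apply: sym_connect_sym; apply: incident_in_sym.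
  case: x y xy xK => [[x|v0]|e] [y|e'] //= ee'.
  - move=> /asboolP[h [v' [gh gh' rv]]]; apply/asboolP; exists (opp_half h), v'.
    split=> //; case/orP: ee' => /eqP E; by rewrite (ext_root_inj gH gh E).
  - move=> /asboolP rv; apply/asboolP.
    by case/orP: ee' => /eqP E; [exists (e', false), v0|exists (e', true), v0].
  - move=> /asboolP[h [v' [he gh' rv]]].
    have [E|E] : g h = y \/ g (opp_half h) = y.
      rewrite -he in ee'; case: h {he gh'} ee' => e1 [] /=; rewrite /opp_half /= => /orP[] /eqP; tauto.
      by rewrite -E gh'; apply/asboolP.
    case: y E {ee'} => [x|v1] E; apply/asboolP; first by exists (opp_half h), v'; rewrite opp_halfK.
    by apply: (reached_opp _ gh' E rv); rewrite /inner_dart gh' E.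
have := closed_connect Kc (connect_all (inl (inr u)) (inl (inr v))).
have -> : (inl (inr u) : cell k n q) \in K by apply/asboolP; left.
by move/esym/asboolP.
Qed.

Definition arm_darts a := [seq d a i | i <- iota 0 (len a).+1].
Definition arm_tail a := [seq d a i | i <- iota 1 (len a)].
Definition hairs_at i := enum (hair_star g i).

(** Valence at least 3 with only two inner darts forces a hair, and there is at most one. *)
Lemma inner_hairs a i v : a \in s -> 0 < i <= len a -> g (d a i) = inr v -> #|hair_star g v| = 1.
Proof.
move=> as_ il gv; have [ta _] := trails as_.
have := nonbranch2 in2 (trail_inner ta i) (trail_nonbranch ta il); rewrite gv => c2.
apply/eqP; rewrite eqn_leq hair_star_le1 //.
case/and4P: gH => /and4P[_ _ _ /forallP/(_ v) +] _ _ _; rewrite valence_split c2.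
by case: #|_|.
Qed.

Lemma hairs_at_roots i : map g (hairs_at i) = nseq #|hair_star g i| (inr i).
Proof.
rewrite cardE; apply: map_const => h; rewrite mem_enum => /hair_starP[]; exact.
Qed.

Lemma hairs_at_ext (t : seq 'I_n) : exists x, map (g \o @opp_half q) (flatten (map hairs_at t)) = map inl x.
Proof.
apply: map_inl_of; apply/allP => _ /mapP[h /flatten_mapP[i _ hi] ->].
by move: hi; rewrite mem_enum => /hair_starP[_ [x /= ->]].
Qed.

Lemma arm_exists a : a \in s -> exists A, [/\ arm_ok g u w A, darts A = arm_darts a,
  map g (arm_tail a) = map inr (inner A) & hairs A = flatten (map hairs_at (inner A))].
Proof.
move=> as_; have [ta ea] := trails as_.
have [I EI] : exists I, map g (arm_tail a) = map inr I.
  apply: map_inr_of; apply/allP => _ /mapP[_ /mapP[i _ ->] ->].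
  by have /andP[] := trail_inner ta i.
have [x Ex] := hairs_at_ext I.
have E2 : map (g \o @opp_half q) (arm_darts a) = map inr (rcons I w).
  rewrite map_rcons -EI /arm_darts /arm_tail -(addn1 (len a)) iotaD add0n !map_cat -cats1.
  rewrite /= ea -[1]addn0 iotaDl -!map_comp; congr (_ ++ _).
  by apply: eq_map => i /=; rewrite next_root.
have E3 t : {subset t <= I} -> map g (flatten (map hairs_at t)) = map inr t.
  elim: t => //= v t IH tI; rewrite map_cat IH => [|y yt]; last by apply: tI; rewrite inE yt orbT.
  have : (inr v : vertex k n) \in map inr I by rewrite map_f // tI ?mem_head.
  rewrite -EI => /mapP[_ /mapP[i il ->] E].
  by rewrite hairs_at_roots (inner_hairs as_ _ (esym E)) //; move: il; rewrite mem_iota1.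
exists (Arm (arm_darts a) (flatten (map hairs_at I)) I x); split=> //; split=> //.
  by rewrite /= -EI -(proj2 (sP as_)).
exact: E3.
Qed.

Lemma stub_exists v : exists S : stub k q, stub_ok g (#|hair_star g v| == 1) v S /\ sdarts S = hairs_at v.
Proof.
have [x] := hairs_at_ext [:: v]; rewrite /= cats0 => Ex.
exists (Stub (hairs_at v) x); split=> //; split=> //=; rewrite hairs_at_roots.
by have := hair_star_le1 gH v; case: #|_| => [|[|]].
Qed.

(** The lists have no repetitions because distinct trails share no dart, not even reversed, and no
    vertex between their ends; they are exhaustive by [all_reached]. *)
Lemma marking_assembled : exists bs bt M, marking g bs bt M.
Proof.
have [a1 [a2 [a3 Es]]] : exists a1 a2 a3, s = [:: a1; a2; a3].
  have : size s = 3 by rewrite -cardE.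
  by case: s => [|a1 [|a2 [|a3 []]]] //; exists a1, a2, a3.
have us : uniq s by apply: enum_uniq.
have s1 : a1 \in s by rewrite Es !inE eqxx.
have s2 : a2 \in s by rewrite Es !inE eqxx orbT.
have s3 : a3 \in s by rewrite Es !inE eqxx !orbT.
have [A1 [ok1 d1 i1 h1]] := arm_exists s1.
have [A2 [ok2 d2 i2 h2]] := arm_exists s2.
have [A3 [ok3 d3 i3 h3]] := arm_exists s3.
have [Su [oku hu]] := stub_exists u; have [Sw [okw hw]] := stub_exists w.
pose M := Theta u w A1 A2 A3 Su Sw.
have EI : map inr (inner A1 ++ inner A2 ++ inner A3) = [seq g (d a i) | a <- s, i <- iota 1 (len a)].
  by rewrite !map_cat -i1 -i2 -i3 Es /= cats0 /arm_tail -!map_comp.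
have ED : frame_darts M = [seq d a i | a <- s, i <- iota 0 (len a).+1].
  by rewrite /frame_darts /= d1 d2 d3 Es /= cats0.
have fV : full (vertices M).
  apply: full_of_mem => [|v].
    rewrite -(map_inj_uniq (@inr_inj 'I_k _)) /vertices !map_cons EI.
    have nb v : branch g (inr v) -> inr v \notin [seq g (d a i) | a <- s, i <- iota 1 (len a)].
      move=> bv; apply/allpairsPdep => -[a [i [as_ il E]]].
      by have := trail_nonbranch (proj1 (trails as_)) (i := i); rewrite -E bv; move: il; rewrite mem_iota1 => -> /(_ isT).
    rewrite /= inE negb_or (inj_eq (@inr_inj 'I_k _)) uw !nb /branch ?cu ?cw //=.
    apply: allpairs_uniq_dep => // [a _|]; first exact: iota_uniq.
    move=> [a i] [b i'] /allpairsPdep[a' [j [a's jl [E1 E2]]]] /allpairsPdep[b' [j' [b's jl' [E1' E2']]]] /= E.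
    move: E1 E2 E1' E2' => ?; subst a'; move=> ?; subst j; move=> ?; subst b'; move=> ?; subst j'.
    by rewrite mem_iota1 in jl; rewrite mem_iota1 in jl'; have [-> ->] := arm_root_inj a's b's jl jl' E.
  have [->|[->|[a [i [as_ il gv]]]]] := all_reached v; rewrite !inE ?eqxx ?orbT //.
  rewrite -(mem_map (@inr_inj 'I_k _)) EI (_ : inr v \in _) ?orbT // -gv.
  by apply/allpairsPdep; exists a, i; split=> //; rewrite mem_iota1.
have pH : perm_eq (hair_darts M) (flatten (map hairs_at (vertices M))).
  rewrite /hair_darts /vertices /= h1 h2 h3 hu hw !map_cat !flatten_cat perm_sym.
  rewrite catA perm_catC -!catA; do 3![apply: perm_cat => //].
have mH h : (h \in hair_darts M) = ~~ is_int (g (opp_half h)) && is_int (g h).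
  rewrite (perm_mem pH); apply/flatten_mapP/andP => [[v _]|[nh]].
    by rewrite mem_enum inE => /andP[-> /eqP ->].
  case gh: (g h) => [//|v] _; exists v; first exact: full_mem.
  by rewrite mem_enum inE nh gh eqxx.
have uH : uniq (hair_darts M).
  rewrite (perm_uniq pH) (_ : flatten _ = [seq h | v <- vertices M, h <- hairs_at v]); last first.
    by congr flatten; apply: eq_map => v; rewrite map_id.
  apply: allpairs_uniq_dep => [|v _|]; [by case/andP: fV|exact: enum_uniq|].
  move=> [v h] [v' h'] /allpairsPdep[v1 [h1' [_ hS [E1 E2]]]] /allpairsPdep[v2 [h2' [_ hS' [E1' E2']]]] /= E.
  move: E1 E2 E1' E2' => ?; subst v1; move=> ?; subst h1'; move=> ?; subst v2; move=> ?; subst h2'.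
  move: hS hS'; rewrite !mem_enum => /hair_starP[gh _] /hair_starP[gh' _].
  by move: gh'; rewrite -E gh => -[->].
have EX : map inl (all_tips M) = map (g \o @opp_half q) (hair_darts M).
  have [_ _ _ x1] := ok1; have [_ _ _ x2] := ok2; have [_ _ _ x3] := ok3.
  have [_ x4] := oku; have [_ x5] := okw.
  by rewrite /all_tips /hair_darts !map_cat /= x1 x2 x3 x4 x5.
exists (#|hair_star g u| == 1), (#|hair_star g w| == 1), M; split=> //.
- apply: full_of_mem => [|x].
    rewrite -(map_inj_uniq (@inl_inj _ 'I_n)) EX map_inj_in_uniq // => h h'.
    rewrite !mH => /andP[]; case gh: (g (opp_half h)) => [x|//] _ _ _ /= E.
    by apply: (can_inj (@opp_halfK q)); apply: (ext_root_inj gH gh); rewrite -gh -E.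
  have [h Eh] := ext_star gH x; have gh : g h = inl x by have := set11 h; rewrite -Eh inE => /eqP.
  rewrite -(mem_map (@inl_inj _ 'I_n)) EX -gh -(opp_halfK h); apply: map_f.
  rewrite mH opp_halfK gh /=; case gh': (g (opp_half h)) => [x'|//].
  have [h1' [x1 [v [E1 g1 _ _]]]] := tree_ext gH (ext_tree gH gh).
  case: h h1' E1 gh gh' g1 {Eh} => e b [e' b'] /= ->; rewrite /opp_half /=.
  by case: b b' => [] [] /=; congruence.
- have frame_inner h : h \in frame_darts M -> inner_dart g h.
    rewrite ED => /allpairsPdep[a [i [as_ _ ->]]]; exact: trail_inner (proj1 (trails as_)) _.
  have hair_outer h : h \in hair_darts M -> ~~ inner_dart g h.
    by rewrite mH /inner_dart => /andP[/negbTE -> _]; rewrite andbF.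
  apply: full_of_mem => [|e].
    rewrite map_inj_in_uniq => [|h h'].
      rewrite cat_uniq uH ED allpairs_uniq_dep ?andbT //.
      - by rewrite -ED; apply/hasPn => h /hair_outer; apply: contraNN => /frame_inner.
      - by move=> a _; apply: (iota_uniq 0 (len a).+1).
      move=> [a i] [b i'] /allpairsPdep[a' [j [a's jl [E1 E2]]]] /allpairsPdep[b' [j' [b's jl' [E1' E2']]]] /= E.
      move: E1 E2 E1' E2' => ?; subst a'; move=> ?; subst j; move=> ?; subst b'; move=> ?; subst j'.
      by rewrite mem_iota0 in jl; rewrite mem_iota0 in jl'; have [-> ->] := arm_inj a's b's jl jl' E.
    move=> hD h'D E; have [//|hh'] : h = h' \/ h = opp_half h'.
      case: h h' E {hD h'D} => e b [e' b'] /= ->; rewrite /opp_half /=.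
      by case: b b' => [] []; [left|right|right|left].
    move: hD h'D; rewrite (mem_cat h) (mem_cat h') => /orP[hF|hH] /orP[h'F|h'H].
    - move: hF h'F; rewrite ED => /allpairsPdep[a [i [as_ il Ei]]] /allpairsPdep[b [i' [bs il' Ei']]].
      exfalso; move: hh'; rewrite Ei Ei'; rewrite mem_iota0 in il; rewrite mem_iota0 in il'.
      exact: arm_opp.
    - by have := frame_inner _ hF; rewrite hh' inner_dart_opp (negbTE (hair_outer _ h'H)).
    - by have := frame_inner _ h'F; rewrite -inner_dart_opp -hh' (negbTE (hair_outer _ hH)).
    - by move: hH h'H; rewrite hh' !mH opp_halfK => /andP[/negbTE -> _]; rewrite andbF.
  have [ih|] := boolP (inner_dart g (e, false)).
    have [v gv] : exists v, g (e, false) = inr v.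
      by move: ih; rewrite /inner_dart; case: (g (e, false)) => // v; exists v.
    have [a [i [as_ il E]]] := reached_dart ih gv (all_reached v).
    apply/mapP; exists (d a i); last by case: E => [<-|/(congr1 (@opp_half q))]; rewrite ?opp_halfK // => <-.
    rewrite mem_cat ED (_ : d a i \in _) //; apply/allpairsPdep; exists a, i; split=> //.
    by rewrite mem_iota0.
  rewrite (inner_dartE gH) negbK => /(tree_ext gH)[h [x [v [E gv gx _]]]].
  apply/mapP; exists h; last by rewrite E.
  by rewrite mem_cat mH gv gx orbT.
Qed.

End Assembly.

(** The inner darts at one branch vertex start trails that end at a different branch vertex, and
    there is only one other. *)
Theorem hairy_marking k n q (g : graph k n q) : two_loop_hairy g -> exists bs bt M, marking g bs bt M.
Proof.
move=> gH; have [u bu] := branch_exists gH.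
have trails a : exists j, a \in inner_star g (inr u) -> trail g a j.
  have [|] := boolP (a \in inner_star g (inr u)); last by exists 0.
  rewrite inE => /andP[ia /eqP ga]; have [|j tj] := @trail_exists _ _ _ g a ia; first by rewrite ga.
  by exists j.
have [len tl] := choice trails.
have ends a : a \in inner_star g (inr u) -> exists w, [/\ u != w, branch g (inr w) & g (opp_half (iter (len a) (next g) a)) = inr w].
  move=> aS; have ta := tl a aS; move: aS; rewrite inE => /andP[ia /eqP ga].
  have := trail_end gH ta; have := trail_inner ta (len a) => /andP[_]; have [_ _ _] := ta.
  rewrite ga; case: (g _) => // w bw _ wu; exists w; split=> //.
  by apply: contraNneq wu => ->.
have [a aS] : exists a, a \in inner_star g (inr u) by apply/card_gt0P; rewrite (leq_trans _ bu).
have [w [uw bw _]] := ends a aS.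
have [cu cw nb] := two_branches gH uw bu bw.
apply: (@marking_assembled k n q g gH u w len) => // b; rewrite mem_enum => bS; split; first exact: tl.
have [w' [uw' bw' ->]] := ends b bS; have [-> //|ww'] := eqVneq w' w.
by have := nb w'; rewrite eq_sym uw' ww' bw' => /(_ isT isT).
Qed.

Local Open Scope ring_scope.

(** * Theta classes and the boundary *)

Definition tsum (t : nat * nat * nat) : nat := (t.1.1 + t.1.2 + t.2)%N.

Definition tsgn (t : nat * nat * nat) : rat := rsgn t.1.1 * rsgn t.1.2 * rsgn t.2.

Lemma total_order_enum (T : finType) : total_order (enum T).
Proof. by rewrite /total_order enum_uniq; apply/forallP => x; rewrite mem_enum. Qed.

Section ThetaClass.
Variables m N : nat.
Hypotheses (N_odd : odd N) (m_even : ~~ odd m).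

Definition is_theta (bs bt : bool) t (x : E_pi m N) : Prop :=
  exists k n q (G : pregraph k n q) M,
    [/\ good G, marking G.1 bs bt M, msize M = t & x = msign M G.2 *: gclass m N G].

(** By [is_theta_uniq] the choice does not matter. The value 0 is taken for want of a graph only
    when there are no hairs at all, since admissible graphs have an external vertex. *)
Definition theta_class bs bt t : E_pi m N :=
  if pselect (exists x, is_theta bs bt t x) is left H then projT1 (cid H) else 0.

(** Arm lengths and stubs determine [k], [n] and [q], so the two graphs have the same type and
    [normal_form] applies. *)
Lemma is_theta_uniq bs bt t x y : is_theta bs bt t x -> is_theta bs bt t y -> x = y.
Proof.
move=> [k [n [q [G [M [gG mM sM ->]]]]]] [k' [n' [q' [G' [M' [gG' mM' sM' ->]]]]]].
have [ek en eq] := marking_dims mM; have [ek' en' eq'] := marking_dims mM'.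
move: (sM); rewrite -sM' => -[e1 e2 e3].
have Ek : k = k' by apply: etrans ek (esym (etrans ek' _)); rewrite e1 e2 e3.
have En : n = n' by apply: etrans en (esym (etrans en' _)); rewrite e1 e2 e3.
have Eq : q = q' by apply: etrans eq (esym (etrans eq' _)); rewrite e1 e2 e3.
move: e1 e2 e3 sM => _ _ _ sM; clear ek en eq ek' en' eq'; subst k' n' q'.
by apply: normal_form mM mM' _ => //; rewrite sM sM'.
Qed.

Lemma is_theta_class bs bt t x : is_theta bs bt t x -> theta_class bs bt t = x.
Proof.
move=> tx; rewrite /theta_class; case: pselect => [H|[]]; last by exists x.
by apply: is_theta_uniq tx; apply: projT2 (cid H).
Qed.

Lemma theta_classE k n q (G : pregraph k n q) bs bt M : good G -> marking G.1 bs bt M ->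
  theta_class bs bt (msize M) = msign M G.2 *: gclass m N G.
Proof. by move=> gG mM; apply: is_theta_class; exists k, n, q, G, M. Qed.

Lemma gclass_theta k n q (G : pregraph k n q) bs bt M : good G -> marking G.1 bs bt M ->
  gclass m N G = msign M G.2 *: theta_class bs bt (msize M).
Proof. by move=> gG mM; rewrite (theta_classE gG mM) scalerA msign_sqr scale1r. Qed.

Lemma marked_exists (bs bt : bool) t : (0 < tsum t + bs + bt)%N ->
  exists k n q (G : ograph k n q) M, [/\ marking (ogval G).1 bs bt M, msize M = t & (0 < k)%N].
Proof.
case: t => [[a b] c]; rewrite /tsum /= => s0.
have [k [n [q [g [M [mM [sa sb sc]]]]]]] := marking_exists bs bt a b c.
have [ek _ _] := marking_dims mM; rewrite sa sb sc in ek.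
have k0 : (0 < k)%N by rewrite ek.
have gG : good (g, enum {: cell k n q}).
  by rewrite /= (marking_admissible mM k0) total_order_enum.
by exists k, n, q, (OGraph gG), M; split=> //; rewrite /msize sa sb sc.
Qed.

Lemma no_theta (bs bt : bool) t : tsum t + bs + bt = 0%N -> theta_class bs bt t = 0.
Proof.
move=> s0; rewrite /theta_class; case: pselect => // H; exfalso; have [x [k [n [q [G [M [gG mM sM _]]]]]]] := H.
have [ek _ _] := marking_dims mM; case/andP: gG => /and4P[+ _ _ _] _.
have E : k = 0%N by apply: etrans ek _; rewrite -[RHS]s0 -sM.
by rewrite {1}E.
Qed.

Lemma theta_swap12 (bs bt : bool) a b c :
  theta_class bs bt (b, a, c) = (-1) ^+ (a * b) *: theta_class bs bt (a, b, c).
Proof.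
have [s0|s0] := posnP (tsum (a, b, c) + bs + bt).
  rewrite !no_theta ?scaler0 //; by move: s0; rewrite /tsum /= (addnC b).
have [k [n [q [G [M [mM [sa sb sc] k0]]]]]] := marked_exists s0; have gG := good_ograph G.
have := theta_classE gG (marking_swap12 mM); have := theta_classE gG mM.
rewrite /msize /= sa sb sc => -> ->; by rewrite (msign_swap12 _ mM) sa sb scalerA.
Qed.

Lemma theta_swap23 (bs bt : bool) a b c :
  theta_class bs bt (a, c, b) = (-1) ^+ (b * c) *: theta_class bs bt (a, b, c).
Proof.
have [s0|s0] := posnP (tsum (a, b, c) + bs + bt).
  rewrite !no_theta ?scaler0 //; by move: s0; rewrite /tsum /= (addnAC a).
have [k [n [q [G [M [mM [sa sb sc] k0]]]]]] := marked_exists s0; have gG := good_ograph G.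
have := theta_classE gG (marking_swap23 mM); have := theta_classE gG mM.
rewrite /msize /= sa sb sc => -> ->; by rewrite (msign_swap23 _ mM) sb sc scalerA.
Qed.

Lemma theta_reflect (bs bt : bool) t : theta_class bt bs t = tsgn t *: theta_class bs bt t.
Proof.
have [s0|s0] := posnP (tsum t + bs + bt).
  rewrite !no_theta ?scaler0 //; by move: s0; rewrite /tsum /= addnAC.
have [k [n [q [G [M [mM sM k0]]]]]] := marked_exists s0; have gG := good_ograph G.
have := theta_classE gG (marking_reflect mM); have := theta_classE gG mM.
rewrite /msize /= !size_rev -/(msize M) sM => -> ->.
by rewrite (msign_reflect _ mM) scalerA -sM.
Qed.

Lemma theta_chain (bs bt : bool) t : two_loop_chain (bs + bt) (tsum t + bs + bt) (theta_class bs bt t).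
Proof.
have [s0|s0] := posnP (tsum t + bs + bt); first by rewrite no_theta //; apply: lspan0.
have [k [n [q [G [M [mM sM k0]]]]]] := marked_exists s0; have gG := good_ograph G.
have := theta_classE gG mM; rewrite sM => ->; apply/lspanZ/lspan_gen.
have [ek _ _] := marking_dims mM.
have {}ek : k = (tsum t + bs + bt)%N by rewrite ek -sM.
subst k; exists n, q, G; split=> //; last exact: defect_marking mM.
exact: marking_two_loop_hairy mM k0.
Qed.

(** Chains are spanned by theta classes because every two-loop hairy graph has a marking; this is
    phrased as an induction principle. *)
Lemma chain_span i k (P : E_pi m N -> Prop) :
  P 0 -> (forall x y, P x -> P y -> P (x + y)) -> (forall a x, P x -> P (a *: x)) ->
  (forall (bs bt : bool) t, (bs + bt = i)%N -> (tsum t + i = k)%N -> P (theta_class bs bt t)) ->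
  forall x, two_loop_chain i k x -> P x.
Proof.
move=> P0 PD PZ Pt x [r [c [f [Gf ->]]]].
apply: (big_ind P) => // j _; apply: (PZ); have [n [q [G [hG dG ->]]]] := Gf j.
have [bs [bt [M mM]]] := hairy_marking hG.
rewrite (gclass_theta (good_ograph G) mM); apply/PZ/(Pt bs bt).
  by rewrite -dG (defect_marking mM).
have [ek _ _] := marking_dims mM; apply/esym; apply: etrans ek _.
by rewrite -dG (defect_marking mM) addnA.
Qed.

End ThetaClass.

Lemma no_side (T : finType) (S A : {set T}) : (#|S| <= 3)%N -> side S A = false.
Proof.
move=> S3; apply/negbTE/negP => /and3P[sA A2]; rewrite cardsD (setIidPr sA) => B2.
by move: S3 A2 B2; move: #|S| #|A| => *; lia.
Qed.

(** Both sides of a partition have two elements, so those containing [x] are the three pairs shown;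
    the complements contribute the same again. *)
Lemma sum_side4 (T : finType) (W : lmodType rat) (x y1 y2 y3 : T) (F : {set T} -> W) :
  uniq [:: x; y1; y2; y3] -> let S := [set x; y1; y2; y3] in
  (forall A, side S A -> F (S :\: A) = F A) ->
  \sum_(A | side S A) F A = 2 *: (F [set x; y1] + F [set x; y2] + F [set x; y3]).
Proof.
rewrite /= !inE !negb_or => /and4P[/and3P[xy1 xy2 xy3] /andP[y12 y13] y23 _].
set S := [set x; y1; y2; y3] => FD.
have S4 : #|S| = 4%N.
  rewrite /S -!setUA !cardsU1 cards1 !inE !negb_or xy1 xy2 xy3 y12 y13 y23 //.
have side2 A : side S A -> #|A| = 2%N.
  move=> /and3P[sA A2]; rewrite cardsD (setIidPr sA) S4.
  by move: A2; move: #|A| => *; lia.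
have sideD A : side S A -> side S (S :\: A).
  move=> /and3P[sA A2 B2]; apply/and3P; split=> //; first exact: subsetDl.
  by rewrite setDDr setDv set0U (setIidPr sA).
rewrite (bigID (fun A : {set T} => x \in A)) /= [X in _ + X](_ : _ = \sum_(A | side S A && (x \in A)) F A).
  rewrite -mulr2n -scaler_nat; congr (_ *: _).
  rewrite (eq_bigl (mem [set [set x; y] | y in [set y1; y2; y3]])) => [|A].
    rewrite big_imset /= => [|y y' yS y'S /setP/(_ y)].
      by rewrite -setUA big_setU1 ?big_setU1 ?big_set1 ?inE ?negb_or ?y12 ?y13 ?y23 //= addrA.
    rewrite !inE eqxx orbT => /esym/orP[/eqP yx|/eqP //].
    by move: yS; rewrite !inE yx (negbTE xy1) (negbTE xy2) (negbTE xy3).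
  apply/andP/imsetP => [[sA xA]|[y yS ->]].
    have := side2 A sA; rewrite (cardsD1 x) xA add1n => /eqP; rewrite eqSS => /cards1P[y Ey].
    have yA : y \in A :\ x by rewrite Ey set11.
    exists y; last by rewrite -Ey setD1K.
    case/and3P: sA => /subsetP/(_ y) + _ _; move: yA; rewrite !inE => /andP[/negbTE -> ->].
    by move/(_ isT).
  split; last by rewrite !inE eqxx.
  have xy : x != y by move: yS; rewrite !inE -orbA => /or3P[] /eqP ->.
  have sS : [set x; y] \subset S.
    by apply/subsetP => z; rewrite !inE => /orP[] /eqP ->; rewrite ?eqxx //; move: yS; rewrite !inE => /orP[/orP[]|] ->; rewrite ?orbT.
  by apply/and3P; split; rewrite // ?cardsD ?(setIidPr sS) ?S4 cards2 xy.
rewrite (reindex_onto (fun A => S :\: A) (fun A => S :\: A)) /= => [|A /andP[/and3P[sA _ _] _]].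
  apply: eq_big => [A|A /andP[/andP[sA _] /eqP E]]; last by rewrite -FD // E.
  apply/andP/andP => [[/andP[sA nx] /eqP E]|[sA xA]].
    by rewrite -E sideD //; split=> //; rewrite inE nx !inE eqxx.
  by rewrite sideD // inE xA /=; split=> //; rewrite setDDr setDv set0U; case/and3P: sA => /setIidPr ->.
by rewrite setDDr setDv set0U (setIidPr sA).
Qed.

(** The new element has the smallest number and comes first, so it takes part in no inversion; the
    old ones are shifted uniformly by [d]. *)
Lemma order_sign_lift (n d : nat) (T T' : eqType) (c : 'I_n -> T) (c' : 'I_n.+1 -> T') s s' :
  index (c' ord0) s' = 0%N -> (forall i, index (c' (lift ord0 i)) s' = (index (c i) s + d)%N) ->
  order_sign c' s' = order_sign c s.
Proof.
move=> i0 il; rewrite /order_sign big_ord_recl big1 ?mul1r => [|j _]; last by rewrite i0 ltn0.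
apply: eq_bigr => i _; rewrite big_mkcond big_ord_recl /= mul1r [RHS]big_mkcond.
by apply: eq_bigr => j _; rewrite !il ltn_add2r /= /bump !leq0n !add1n ltnS.
Qed.

(** * Splitting a branch vertex that carries a hair *)

Section SplitMarking.
Variables (k n q : nat) (G : pregraph k n q) (bt : bool) (M : theta k n q).
Let g := G.1.
Hypotheses (mM : marking g true bt M) (gG : good G).
Variables (h1 : half q) (p1 : seq (half q)) (x : half q).
Hypotheses (Ed : darts (arm1 M) = h1 :: p1) (Ex : sdarts (ssrc M) = [:: x]).

Let up (h : half q) : half q.+1 := (lift ord0 h.1, h.2).
Let lv : 'I_n -> 'I_n.+1 := lift ord0.
Let A := [set x; h1].
Let gs := split_graph g (src M) A.

Definition arm_up (B : arm k n q) : arm k n.+1 q.+1 :=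
  Arm (map up (darts B)) (map up (hairs B)) (map lv (inner B)) (tips B).

(** The new vertex takes over the hair [x] and the first dart of the first arm. It becomes the first
    inner vertex of this arm, and the new edge becomes the first dart. *)
Definition theta_split : theta k n.+1 q.+1 :=
  Theta (lv (src M)) (lv (tgt M))
    (Arm ((ord0, false) :: map up (darts (arm1 M))) (map up (sdarts (ssrc M) ++ hairs (arm1 M)))
         (ord0 :: map lv (inner (arm1 M))) (stips (ssrc M) ++ tips (arm1 M)))
    (arm_up (arm2 M)) (arm_up (arm3 M)) (Stub [::] [::])
    (Stub (map up (sdarts (stgt M))) (stips (stgt M))).

Let xD : x \in all_darts M.
Proof. by rewrite /all_darts /hair_darts !mem_cat Ex inE eqxx !orbT. Qed.

Let hD : h1 \in all_darts M.
Proof. by rewrite /all_darts /frame_darts !mem_cat Ed inE eqxx. Qed.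

Let opp_notin h : h \in all_darts M -> opp_half h \notin A.
Proof.
move=> h_in; apply/negP; rewrite !inE => /orP[] /eqP E.
  have := all_darts_inj mM h_in xD; rewrite -E => /(_ erefl) /eqP.
  by rewrite eq_sym (negbTE (opp_neq _)).
have := all_darts_inj mM h_in hD; rewrite -E => /(_ erefl) /eqP.
by rewrite eq_sym (negbTE (opp_neq _)).
Qed.

Let gs_notin (s : seq (half q)) : {in s, forall h, h \notin A} ->
  map gs (map up s) = map (@old_vertex k n) (map g s).
Proof.
move=> sA; rewrite -!map_comp; apply/eq_in_map => h hs /=.
by rewrite /gs split_up (negbTE (sA h hs)).
Qed.

Let gs_opp (s : seq (half q)) : {subset s <= all_darts M} ->
  map (gs \o @opp_half _) (map up s) = map (@old_vertex k n) (map (g \o @opp_half q) s).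
Proof.
move=> sD; have -> : map (g \o @opp_half q) s = map g (map (@opp_half q) s) by rewrite -map_comp.
rewrite -gs_notin => [|_ /mapP[h hs ->]]; last by apply: opp_notin; apply: sD.
by rewrite -!map_comp.
Qed.

Let old_inr s : map (@old_vertex k n) (map inr s) = map inr (map lv s).
Proof. by rewrite -!map_comp. Qed.

Let old_inl s : map (@old_vertex k n) (map inl s) = map inl s.
Proof. by rewrite -!map_comp. Qed.

Lemma full_lift r (s : seq 'I_r) : full s -> full (ord0 :: map (lift ord0) s).
Proof.
case/andP=> us /eqP ss; rewrite /full /= size_map ss eqxx map_inj_uniq ?us ?andbT //.
  by apply/mapP => -[i _] /eqP; rewrite (negbTE (neq_lift _ _)).
exact: lift_inj.
Qed.

Lemma perm_split : perm_eq (all_darts theta_split) ((ord0, false) :: map up (all_darts M)).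
Proof.
rewrite /all_darts /frame_darts /hair_darts /= perm_cons !map_cat -!catA.
do 3![apply: perm_cat => //]; rewrite perm_catC -!catA; do 3![apply: perm_cat => //].
by rewrite perm_catC.
Qed.

Let split_arm B : arm_ok g (src M) (tgt M) B -> {subset darts B <= all_darts M} ->
  {subset hairs B <= all_darts M} -> {in darts B, forall h, h \notin A} ->
  {in hairs B, forall h, h \notin A} -> arm_ok gs (lv (src M)) (lv (tgt M)) (arm_up B).
Proof.
move=> [e1 e2 e3 e4] sd sh nd nh; split; rewrite /=.
- by rewrite gs_notin // e1 old_inr.
- by rewrite gs_opp // e2 old_inr map_rcons.
- by rewrite gs_notin // e3 old_inr.
- by rewrite gs_opp // e4 old_inl.
Qed.

Let notin (s : seq (half q)) :
  (forall h, count_mem h (h1 :: x :: s) <= count_mem h (all_darts M))%N ->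
  {in s, forall h, h \notin A}.
Proof.
move=> le h hs; have := le h; rewrite (count_uniq_mem _ (all_darts_uniq mM)) /=.
have : (0 < count_mem h s)%N by rewrite -has_count has_pred1.
rewrite !inE negb_or ![h == _]eq_sym; move: (h \in _) (count_mem h s).
by case: (x == h); case: (h1 == h); case=> r; clear; lia.
Qed.

Let all_dartsE : all_darts M = ((h1 :: p1) ++ darts (arm2 M) ++ darts (arm3 M)) ++
  hairs (arm1 M) ++ hairs (arm2 M) ++ hairs (arm3 M) ++ [:: x] ++ sdarts (stgt M).
Proof. by rewrite /all_darts /frame_darts /hair_darts Ed Ex. Qed.

Let count_all h : count_mem h (all_darts M) = ((h1 == h) + count_mem h p1 + count_mem h (darts (arm2 M)) +
  count_mem h (darts (arm3 M)) + count_mem h (hairs (arm1 M)) + count_mem h (hairs (arm2 M)) +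
  count_mem h (hairs (arm3 M)) + (x == h) + count_mem h (sdarts (stgt M)))%N.
Proof. by rewrite all_dartsE !count_cat /= addn0 !addnA. Qed.

Let sub_darts (s : seq (half q)) : (forall h, count_mem h s <= count_mem h (all_darts M))%N ->
  {subset s <= all_darts M}.
Proof.
move=> le h; rewrite -!has_pred1 !has_count => c; exact: leq_trans c (le h).
Qed.

Lemma marking_split : marking gs false bt theta_split.
Proof.
have [o1 o2 o3 os ot fv fx fe] := mM.
have [e1 e2 e3 e4] := o1; have [f1 f2] := os; have [t1 t2] := ot.
rewrite Ed in e1 e2; case: e1 => gh1 e1; rewrite Ex in f1 f2; case: f1 => gx.
have new_h1 : gs (up h1) = inr ord0 by rewrite /gs split_up !inE eqxx orbT.
have new_x : gs (up x) = inr ord0 by rewrite /gs split_up !inE eqxx.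
have n1 : {in p1, forall h, h \notin A} by apply: notin => h; rewrite count_all /=; clear; lia.
have n2 : {in hairs (arm1 M), forall h, h \notin A} by apply: notin => h; rewrite count_all /=; clear; lia.
have nt : {in sdarts (stgt M), forall h, h \notin A} by apply: notin => h; rewrite count_all /=; clear; lia.
split=> //=.
- split; rewrite /= ?Ed /=.
  + have -> : gs (ord0, false) = inr (lv (src M)) by rewrite /gs split_new.
    by rewrite new_h1 gs_notin // e1 old_inr.
  + have sub1 : {subset h1 :: p1 <= all_darts M} by apply: sub_darts => h; rewrite count_all /=; clear; lia.
    have := gs_opp sub1; rewrite e2 old_inr map_rcons /= => ->.
    by rewrite /gs {1}/opp_half /= split_new.
  + by rewrite Ex /= new_x gs_notin // e3 old_inr.
  + rewrite gs_opp; last by apply: sub_darts => h; rewrite count_cat count_all Ex /=; clear; lia.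
    by rewrite map_cat Ex f2 e4 -map_cat old_inl.
- by apply: split_arm => //; try (by apply: notin => h; rewrite count_all /=; clear; lia);
  apply: sub_darts => h; rewrite count_all /=; clear; lia.
- by apply: split_arm => //; try (by apply: notin => h; rewrite count_all /=; clear; lia);
  apply: sub_darts => h; rewrite count_all /=; clear; lia.
- split=> //=; first by rewrite gs_notin // t1 old_inr nseq_map.
  by rewrite gs_opp ?t2 ?old_inl //; apply: sub_darts => h; rewrite count_all /=; clear; lia.
- rewrite (full_perm _ (s' := ord0 :: map lv (vertices M))); first exact: full_lift.
  rewrite /vertices /= !map_cat (perm_catCA [:: lv (src M); lv (tgt M)] [:: ord0]) //.
- rewrite (full_perm _ (s' := all_tips M)) // /all_tips /= -!catA perm_catC -!catA.
  do 3![apply: perm_cat => //]; by rewrite perm_catC.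
- rewrite (full_perm _ (s' := ord0 :: map (lift ord0) (map fst (all_darts M)))); first exact: full_lift.
  have := perm_map fst perm_split; rewrite /= -!map_comp; apply.
Qed.

Lemma msign_split s : msign theta_split (split_order s) = msign M s.
Proof.
rewrite /msign; congr (_ * _ * _).
- have /seq.permP/(_ snd) -> := perm_split; rewrite /= add0n count_map.
  by congr (_ ^+ _); apply: eq_count.
(* In [vertices] the new vertex stands behind the two branch vertices; moving it to the front takes
   two transpositions. *)
- have := @seq_sign_move n.+1 [::] ord0 [:: lv (src M); lv (tgt M)]
    (map lv (inner (arm1 M) ++ inner (arm2 M) ++ inner (arm3 M))).
  rewrite /= /vertices /= !map_cat => ->; last first.
    have := full_lift (mkv mM); by rewrite /vertices /= !map_cat.
  rewrite sqrrN expr1n mul1r.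
  rewrite -[RHS](@order_sign_lift n 1 _ _ id id (vertices M) (ord0 :: map lv (vertices M))) //=.
    by rewrite /vertices /= !map_cat.
  by move=> i; rewrite /= index_map ?addn1 //; apply: lift_inj.
- apply: (@order_sign_lift n 2) => // i.
  by rewrite -[internal _ _ _]/(old_cell (internal k q i)) index_split_order addn2.
Qed.

Lemma split_class m N : odd N -> ~~ odd m -> side (star g (inr (src M))) A ->
  gclass m N (vertex_split G (src M) A) = msign M G.2 *: theta_class m N false bt
    ((size (inner (arm1 M))).+1, size (inner (arm2 M)), size (inner (arm3 M))).
Proof.
move=> No me sA; have mS : marking (vertex_split G (src M) A).1 false bt theta_split := marking_split.
rewrite (gclass_theta No me (good_side gG sA) mS) msign_split.
by rewrite /msize /= !size_map.
Qed.

End SplitMarking.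

(** * The boundary of a theta class *)

Section Boundary.
Variables m N : nat.
Hypotheses (N_odd : odd N) (m_even : ~~ odd m).
Notation theta_class := (theta_class m N).

(** The signs are those of (x + y + z) x^a y^b z^c in anticommuting variables: y passes x^a, and z
    passes x^a y^b. *)
Definition theta_sum bs bt (t : nat * nat * nat) : E_pi m N :=
  theta_class bs bt (t.1.1.+1, t.1.2, t.2)
  + (-1) ^+ t.1.1 *: theta_class bs bt (t.1.1, t.1.2.+1, t.2)
  + (-1) ^+ (t.1.1 + t.1.2) *: theta_class bs bt (t.1.1, t.1.2, t.2.+1).

Lemma sum_sides_src k n q (G : pregraph k n q) bt M : good G -> marking G.1 true bt M ->
  \sum_(A | side (star G.1 (inr (src M))) A) gclass m N (vertex_split G (src M) A) =
  2 *: (msign M G.2 *: theta_sum false bt (msize M)).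
Proof.
move=> gG mM; have [o1 o2 o3 os ot fv fx fe] := mM.
have head_arm B : arm_ok G.1 (src M) (tgt M) B -> exists h p, darts B = h :: p /\ G.1 h = inr (src M).
  by case: B => [[|h p] ? ? ?] [] //= [gh _] _ _ _; exists h, p.
have [h1 [p1 [E1 g1]]] := head_arm _ o1; have [h2 [p2 [E2 g2]]] := head_arm _ o2.
have [h3 [p3 [E3 g3]]] := head_arm _ o3.
have [x [Ex gx]] : exists x, sdarts (ssrc M) = [:: x] /\ G.1 x = inr (src M).
  have [] := os; case: (sdarts _) => [|x [|]] //= [gx] _; by exists x.
have u4 : uniq [:: x; h1; h2; h3].
  apply: sub_uniq (all_darts_uniq mM) => y.
  rewrite /all_darts /frame_darts /hair_darts E1 E2 E3 Ex !count_cat /=; clear; lia.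
have star4 : star G.1 (inr (src M)) = [set x; h1; h2; h3].
  apply/esym/eqP; rewrite eqEcard -[#|star _ _|]/(valence _ _) (valence_inr mM) eqxx.
  rewrite eq_sym (negbTE (src_neq_tgt mM)) muln0; apply/andP; split.
    by apply/subsetP => y; rewrite !inE -!orbA => /or4P[] /eqP ->; rewrite ?gx ?g1 ?g2 ?g3.
  move: u4; rewrite /= !inE !negb_or => /and4P[/and3P[a1 a2 a3] /andP[a4 a5] a6 _].
  by rewrite -!setUA !cardsU1 cards1 !inE !negb_or a1 a2 a3 a4 a5 a6.
have FD A : side (star G.1 (inr (src M))) A ->
    gclass m N (vertex_split G (src M) (star G.1 (inr (src M)) :\: A)) = gclass m N (vertex_split G (src M) A).
  exact: vertex_split_setD.
rewrite star4 in FD *; rewrite (sum_side4 u4 FD); congr (_ *: _).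
have side_i y : y \in [:: h1; h2; h3] -> side (star G.1 (inr (src M))) [set x; y].
  move=> yh; rewrite star4; have xy : x != y.
    by move: u4 => /= /andP[+ _]; apply: contraNneq => ->.
  have sS : [set x; y] \subset [set x; h1; h2; h3].
    apply/subsetP => z; rewrite !inE => /orP[] /eqP ->; rewrite ?eqxx //; move: yh.
    by rewrite !inE => /or3P[] ->; rewrite ?orbT.
  apply/and3P; split=> //; rewrite ?cardsD ?(setIidPr sS) ?cards2 ?xy //.
  by rewrite -star4 -[#|star _ _|]/(valence _ _) (valence_inr mM) eqxx.
(* The hair may move into any arm; the second and the third arm are brought to the front so that
   [split_class] applies to each. *)
have m2 := marking_swap12 mM; have m3 := marking_swap12 (marking_swap23 mM).
rewrite (split_class mM gG E1 Ex N_odd m_even) ?side_i ?inE ?eqxx //.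
rewrite (split_class m2 gG E2 Ex N_odd m_even) ?side_i ?inE ?eqxx ?orbT //.
rewrite (split_class m3 gG E3 Ex N_odd m_even) ?side_i ?inE ?eqxx ?orbT //.
rewrite (msign_swap12 _ (marking_swap23 mM)) (msign_swap23 _ mM) (msign_swap12 _ mM) /=.
rewrite /msize /theta_sum /=; set a := size _; set b := size _; set c := size _.
rewrite [theta_class _ _ (b.+1, a, c)]theta_swap12 // [theta_class _ _ (c.+1, a, b)]theta_swap12 //.
rewrite [theta_class _ _ (a, c.+1, b)]theta_swap23 // !scalerDr !scalerA !mulnS !exprD.
have sqr r : (-1) ^+ r * (-1) ^+ r = 1 :> rat by rewrite -expr2 sqrr_sign.
have c2 (X y z : rat) : X * X = 1 -> X * y * (z * X) = y * z.
  by move=> XX; rewrite -[RHS]mulr1 -XX; ring.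
have c3 (X Y y z w : rat) : X * X = 1 -> Y * Y = 1 -> X * (Y * y) * (z * X * (w * Y)) = y * (z * w).
  by move=> XX YY; rewrite -[RHS]mulr1 -XX -[X in _ = _ * (X * _)]mulr1 -YY; ring.
by rewrite (c2 _ _ _ (sqr _)) (c3 _ _ _ _ _ (sqr _) (sqr _)).
Qed.

Lemma sum_sides_trivalent k n q (G : pregraph k n q) j : (valence G.1 (inr j) <= 3)%N ->
  \sum_(A | side (star G.1 (inr j)) A) gclass m N (vertex_split G j A) = 0.
Proof. by move=> v3; rewrite big_pred0 // => A; apply: no_side. Qed.

(** Only branch vertices with a hair have valence 4 and can be split. A splitting at the target is
    one at the source of the reflected graph, whence the factor [tsgn t]. *)
Lemma boundary_theta bs bt t : boundary (theta_class bs bt t) =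
  bs%:R *: theta_sum false bt t + (bt%:R * tsgn t) *: theta_sum false bs t.
Proof.
have [s0|s0] := posnP (tsum t + bs + bt)%N.
  rewrite no_theta // linear0; move: s0 => /eqP; rewrite !addn_eq0.
  by case: bs bt => [] []; rewrite ?andbF //= mul0r !scale0r addr0.
have [k [n [q [G [M [mM sM k0]]]]]] := marked_exists s0; have gG := good_ograph G.
have E := theta_classE N_odd m_even gG mM; rewrite sM in E.
rewrite {}E linearZ /= boundary_gclass ograph_boundaryE //.
have U : \sum_(A | side (star G.1 (inr (src M))) A) gclass m N (vertex_split G (src M) A) =
    2 *: (msign M G.2 *: (bs%:R *: theta_sum false bt t)).
  case: bs mM {s0} => mM; first by rewrite (sum_sides_src gG mM) sM scale1r.
  rewrite sum_sides_trivalent ?scale0r ?scaler0 // (valence_inr mM) eqxx.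
  by rewrite eq_sym (negbTE (src_neq_tgt mM)) muln0.
have W : \sum_(A | side (star G.1 (inr (tgt M))) A) gclass m N (vertex_split G (tgt M) A) =
    2 *: (msign M G.2 *: ((bt%:R * tsgn t) *: theta_sum false bs t)).
  case: bt mM {s0 U} => mM.
    have := sum_sides_src gG (marking_reflect mM); rewrite /= => ->.
    rewrite (msign_reflect _ mM) mul1r (_ : msize (reflect M) = t); last first.
      by rewrite -sM /msize /= !size_rev.
    by rewrite !scalerA -sM /tsgn /=; congr (_ *: _); ring.
  rewrite sum_sides_trivalent ?mul0r ?scale0r ?scaler0 // (valence_inr mM) eqxx.
  by rewrite (negbTE (src_neq_tgt mM)) muln0.
rewrite (bigD1 (src M)) //= (bigD1 (tgt M)) 1?eq_sym ?(src_neq_tgt mM) //= {}U {}W.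
rewrite [X in _ + (_ + X)]big1 => [|j /andP[ju jw]]; last first.
  apply: sum_sides_trivalent; rewrite (valence_inr mM) ![_ == j]eq_sym.
  by rewrite (negbTE ju) (negbTE jw) !muln0.
rewrite [X in _ + X]addr0.
move: (_ *: theta_sum false bt t) (_ *: theta_sum false bs t) => X Y.
by rewrite -!scalerDr [2^-1 *: _]scalerA mulVf // scale1r scalerA msign_sqr scale1r.
Qed.

End Boundary.

(** * Linear functionals separating theta classes *)

Section Rigidity.
Variables (k n q : nat) (g : graph k n q).

Lemma trail_uniq a j j' : trail g a j -> trail g a j' -> j = j'.
Proof.
move=> [_ _ nb b] [_ _ nb' b']; case: (ltngtP j j') => // jj.
  by have := nb' _ jj; rewrite b.
by have := nb _ jj; rewrite b'.
Qed.

Section OneMarking.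
Variables (bs bt : bool) (M : theta k n q).
Hypothesis mM : marking g bs bt M.

Lemma frame_dart_inner h : h \in frame_darts M -> inner_dart g h.
Proof. by move=> /(frame_dart mM)[i [j [gi gj]]]; rewrite /inner_dart gi gj. Qed.

Lemma hair_dart_outer h : h \in hair_darts M -> ~~ inner_dart g h.
Proof. by move=> /(hair_dart mM)[i [j [gi gj]]]; rewrite /inner_dart gj andbF. Qed.

Lemma hair_dartE h : (h \in hair_darts M) = is_int (g h) && ~~ is_int (g (opp_half h)).
Proof.
apply/idP/andP => [/(hair_dart mM)[i [j [gi gj]]]|[gi gj]]; first by rewrite gi gj.
have := all_halves_mem mM h; rewrite mem_cat => /orP[|/mapP[h' + hh]]; rewrite mem_cat.
  by case/orP=> // /frame_dart_inner; rewrite /inner_dart (negbTE gj) andbF.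
case/orP=> [/frame_dart_inner|/(hair_dart mM)[i [j [gi' gj']]]].
  by rewrite -inner_dart_opp -hh /inner_dart (negbTE gj) andbF.
by move: gi; rewrite hh gj'.
Qed.

Lemma inner_valence i : #|inner_star g (inr i)| = (2 + (src M == i) + (tgt M == i))%N.
Proof.
have Ef : #|inner_star g (inr i)| =
    (count_mem (inr i : vertex k n) (map g (frame_darts M)) +
     count_mem (inr i : vertex k n) (map (g \o @opp_half q) (frame_darts M)))%N.
  rewrite /inner_star (card_halves mM) /all_halves /all_darts.
  have := frame_dart_inner; have := hair_dart_outer.
  move: (frame_darts M) (hair_darts M) => F H oH iF.
  have cH (t : seq (half q)) : {in t, forall h, ~~ inner_dart g h} ->
      count (fun h => inner_dart g h && (g h == inr i)) t = 0%N.
    move=> tH; apply/eqP; rewrite -leqn0 leqNgt -has_count; apply/hasPn => h /tH /negbTE -> //.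
  have oH' : {in map (@opp_half q) H, forall h, ~~ inner_dart g h}.
    by move=> _ /mapP[h hH ->]; rewrite inner_dart_opp oH.
  rewrite !map_cat !count_cat (cH _ oH) (cH _ oH') !addn0.
  rewrite !count_map; congr (_ + _)%N; apply: eq_in_count => h hF /=; first by rewrite iF.
  by rewrite inner_dart_opp iF.
have [[e1 f1 _ _] [e2 f2 _ _] [e3 f3 _ _] _ _ fV _ _] := mM.
rewrite Ef /frame_darts !map_cat e1 e2 e3 f1 f2 f3 -!map_cat.
have cinr (s : seq 'I_n) : count_mem (inr i : vertex k n) (map inr s) = count_mem i s.
  by rewrite count_map; apply: eq_count => y /=; apply/eqP/eqP => [[]|->].
have := full_count i fV; rewrite !cinr /vertices -!cats1 !count_cat /= !count_cat /=.
by clear; lia.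
Qed.

Lemma branchE i : branch g (inr i) = (src M == i) || (tgt M == i).
Proof. by rewrite /branch inner_valence; case: (_ == i); case: (_ == i). Qed.

(** Inner vertices have two inner darts and branch vertices three, so an arm is the trail of its
    first dart: it is determined by that dart and the graph. *)
Lemma arm_trail A : List.In A (arms M) -> exists h, [/\ ohead (darts A) = Some h, g h = inr (src M),
  trail g h (size (inner A)) & darts A = traject (next g) h (size (inner A)).+1].
Proof.
move=> AM; have [e1 e2 _ _] := arms_ok mM AM.
have subF : {subset darts A <= frame_darts M}.
  by move=> h hA; rewrite /frame_darts !mem_cat; case: AM hA => [<-|[<-|[<-|//]]] ->; rewrite ?orbT.
have subI : {subset inner A <= inner (arm1 M) ++ inner (arm2 M) ++ inner (arm3 M)}.
  by move=> h hA; rewrite !mem_cat; case: AM hA => [<-|[<-|[<-|//]]] ->; rewrite ?orbT.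
have nb i : i \in inner A -> #|inner_star g (inr i)| = 2%N.
  move=> /subI iI; have /andP[+ _] := mkv mM; rewrite inner_valence /vertices /= inE negb_or.
  case/and3P=> [/andP[_ us] ws _]; case: eqP => [E|_]; first by rewrite E iI in us.
  by case: eqP => [E|_] //; rewrite E iI in ws.
have step h h' i : h \in darts A -> h' \in darts A -> g (opp_half h) = inr i -> g h' = inr i ->
    i \in inner A -> h' = next g h.
  move=> hA h'A gh gh' iA; have ih := frame_dart_inner (subF _ hA).
  have io : inner_dart g (opp_half h) by rewrite inner_dart_opp.
  have [_ _ _ E] := partnerP io (etrans (congr1 (fun v => #|inner_star g v|) gh) (nb i iA)).
  have : h' \in inner_star g (g (opp_half h)) by rewrite inE (frame_dart_inner (subF _ h'A)) gh gh' eqxx.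
  rewrite E !inE => /orP[/eqP h'E|/eqP //]; exfalso.
  have hD : h \in all_darts M by rewrite mem_cat subF.
  have h'D : h' \in all_darts M by rewrite mem_cat subF.
  have := all_darts_inj mM hD h'D; rewrite h'E => /(_ erefl) /eqP.
  by rewrite eq_sym (negbTE (opp_neq _)).
have [h [p Ep]] : exists h p, darts A = h :: p by case: (darts A) e1 => // h p; exists h, p.
have sp : size p = size (inner A) by move: (congr1 size e1); rewrite Ep !size_map => -[].
have gh : g h = inr (src M) by move: e1; rewrite Ep => -[].
have walk r (y : half q) I : map g r = map inr I ->
    map (g \o @opp_half q) (y :: r) = map inr (rcons I (tgt M)) ->
    {subset y :: r <= darts A} -> {subset I <= inner A} -> r = traject (next g) (next g y) (size r).
  elim: r y I => [|y' r IH] y [|i I] //= [gy' r1] [gy r2] sP sI.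
  have yy : y' = next g y.
    by apply: (step y y' i) => //; [apply: sP|apply: sP|apply: sI]; rewrite !inE eqxx ?orbT.
  rewrite -yy; congr (_ :: _); apply: (IH _ I) => //.
    by move=> z zr; apply: sP; rewrite inE zr orbT.
  by move=> z zI; apply: sI; rewrite inE zI orbT.
have tp : p = traject (next g) (next g h) (size p).
  apply: (walk p h (inner A)) => //; first by move: e1; rewrite Ep => -[].
    by rewrite -Ep.
  by rewrite Ep.
have EA : darts A = traject (next g) h (size (inner A)).+1 by rewrite Ep -sp /= -tp.
exists h; split=> //; first by rewrite Ep.
have at_i i : (i <= size (inner A))%N -> g (opp_half (iter i (next g) h)) = inr (nth (tgt M) (rcons (inner A) (tgt M)) i).
  move=> il; have := congr1 (fun s => nth (inr (tgt M)) s i) e2.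
  rewrite (nth_map h) ?EA ?size_traject // (nth_map (tgt M)) ?size_rcons //.
  by rewrite nth_traject //= => ->.
split.
- by apply: frame_dart_inner; apply: subF; rewrite Ep mem_head.
- by rewrite gh branchE eqxx.
- move=> i il; rewrite at_i ?(ltnW il) // nth_rcons il /branch nb //.
  by apply: mem_nth.
- by rewrite at_i // nth_rcons ltnn eqxx branchE eqxx orbT.
Qed.

End OneMarking.

Definition heads (M : theta k n q) := [:: ohead (darts (arm1 M)); ohead (darts (arm2 M)); ohead (darts (arm3 M))].

(** The value forced on the class of the graph with order [s] by a functional that takes the values
    [f] on theta classes. *)
Definition mval (f : nat * nat * nat -> rat) (M : theta k n q) (s : seq (cell k n q)) : rat :=
  msign M s * f (msize M).

Lemma same_heads bs bt f M L s : marking g bs bt M -> marking g bs bt L -> heads M = heads L ->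
  mval f M s = mval f L s.
Proof.
move=> mM mL [E1 E2 E3].
have arm_eq A B : List.In A (arms M) -> List.In B (arms L) -> ohead (darts A) = ohead (darts B) ->
    [/\ darts A = darts B, inner A = inner B, src M = src L & tgt M = tgt L].
  move=> AM BL; have [h [oA gA tA dA]] := arm_trail mM AM; have [h' [oB gB tB dB]] := arm_trail mL BL.
  rewrite oA oB => -[hh]; rewrite -{h'}hh in gB tB dB {oB}.
  have E : darts A = darts B by rewrite dA dB (trail_uniq tA tB).
  have [a1 a2 _ _] := arms_ok mM AM; have [b1 b2 _ _] := arms_ok mL BL.
  have := a1; rewrite E b1 => /(inj_map inr_inj)[-> EI].
  have := a2; rewrite E b2 => /(inj_map inr_inj)/rcons_inj[_ ->]; by split.
have [d1 i1 us ws] := arm_eq (arm1 M) (arm1 L) (or_introl erefl) (or_introl erefl) E1.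
have [d2 i2 _ _] := arm_eq (arm2 M) (arm2 L) (or_intror (or_introl erefl)) (or_intror (or_introl erefl)) E2.
have [d3 i3 _ _] := arm_eq (arm3 M) (arm3 L) (or_intror (or_intror (or_introl erefl))) (or_intror (or_intror (or_introl erefl))) E3.
rewrite /mval /msign /msize /vertices i1 i2 i3 us ws; congr (_ * _ * _ * _); congr (_ ^+ _).
have EF : frame_darts M = frame_darts L by rewrite /frame_darts d1 d2 d3.
suff /seq.permP -> : perm_eq (all_darts M) (all_darts L) by [].
rewrite /all_darts EF perm_cat2l; apply: uniq_perm.
- by have := all_darts_uniq mM; rewrite cat_uniq => /and3P[].
- by have := all_darts_uniq mL; rewrite cat_uniq => /and3P[].
- by move=> h; rewrite (hair_dartE mM) (hair_dartE mL).
Qed.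

Section Value.
Variables (bs bt : bool) (f : nat * nat * nat -> rat).
Hypothesis f12 : forall a b c, f (b, a, c) = (-1) ^+ (a * b) * f (a, b, c).
Hypothesis f23 : forall a b c, f (a, c, b) = (-1) ^+ (b * c) * f (a, b, c).
Hypothesis f_reflect : bs = bt -> forall t, tsgn t * f t = f t.

Let sqr r : (-1) ^+ r * (-1) ^+ r = 1 :> rat. Proof. by rewrite -expr2 sqrr_sign. Qed.

Lemma mval12 M s : marking g bs bt M -> mval f (swap12 M) s = mval f M s.
Proof.
move=> mM; rewrite /mval (msign_swap12 _ mM) /msize /= f12 mulrACA.
by rewrite sqr mul1r.
Qed.

Lemma mval23 M s : marking g bs bt M -> mval f (swap23 M) s = mval f M s.
Proof.
move=> mM; rewrite /mval (msign_swap23 _ mM) /msize /= f23 mulrACA.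
by rewrite sqr mul1r.
Qed.

Lemma mval_reflect M s : bs = bt -> marking g bs bt M -> mval f (reflect M) s = mval f M s.
Proof.
move=> bb mM; have Es : msize (reflect M) = msize M by rewrite /msize /= !size_rev.
rewrite /mval Es (msign_reflect _ mM) -mulrA mulrCA; congr (_ * _).
exact: f_reflect.
Qed.

Lemma heads_star M : marking g bs bt M -> exists h1 h2 h3, [/\ heads M = [:: Some h1; Some h2; Some h3],
  uniq [:: h1; h2; h3] & inner_star g (inr (src M)) = [set h1; h2; h3]].
Proof.
move=> mM; have [h1 [o1 g1 [t1 _ _ _] d1]] := arm_trail mM (or_introl erefl : List.In (arm1 M) (arms M)).
have [h2 [o2 g2 [t2 _ _ _] d2]] := arm_trail mM (or_intror (or_introl erefl) : List.In (arm2 M) (arms M)).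
have [h3 [o3 g3 [t3 _ _ _] d3]] := arm_trail mM (or_intror (or_intror (or_introl erefl)) : List.In (arm3 M) (arms M)).
exists h1, h2, h3; have u3 : uniq [:: h1; h2; h3].
  apply: sub_uniq (all_darts_uniq mM) => y.
  by rewrite /all_darts /frame_darts d1 d2 d3 !count_cat /=; clear; lia.
split; rewrite /heads ?o1 ?o2 ?o3 //; apply/esym/eqP; rewrite eqEcard (inner_valence mM) eqxx.
rewrite eq_sym (negbTE (src_neq_tgt mM)); apply/andP; split.
  by apply/subsetP => y; rewrite !inE -!orbA => /or3P[] /eqP ->; rewrite ?t1 ?t2 ?t3 ?g1 ?g2 ?g3 eqxx.
move: u3; rewrite /= !inE !negb_or => /and3P[/andP[a1 a2] a3 _].
by rewrite -!setUA !cardsU1 cards1 !inE !negb_or a1 a2 a3.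
Qed.

(** The first darts of the arms of either marking are the three inner darts at the common source, so
    the arms of [M] can be permuted into those of [L]. *)
Lemma mval_src M L s : marking g bs bt M -> marking g bs bt L -> src M = src L ->
  mval f M s = mval f L s.
Proof.
move=> mM mL us; have [l1 [l2 [l3 [hL uL SL]]]] := heads_star mL.
have [M1 [m1 u1 v1 E1]] : exists M1, [/\ marking g bs bt M1, src M1 = src L,
    mval f M s = mval f M1 s & ohead (darts (arm1 M1)) = Some l1].
  have [h1 [h2 [h3 [[e1 e2 e3] _ SM]]]] := heads_star mM.
  have : l1 \in [set h1; h2; h3] by rewrite -SM us SL !inE eqxx.
  rewrite !inE -orbA => /or3P[] /eqP ->; first by exists M.
    by exists (swap12 M); split=> //; [apply: marking_swap12|rewrite mval12].
  exists (swap12 (swap23 M)); have m23 := marking_swap23 mM.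
  by split=> //; [apply: marking_swap12|rewrite mval12 // mval23].
rewrite v1; have [h1 [x [y [H1 U1 S1]]]] := heads_star m1.
have hl : h1 = l1 by move: (H1) => [+ _ _]; rewrite E1 => -[].
have l2M : l2 \in [set h1; x; y] by rewrite -S1 u1 SL !inE eqxx orbT.
have l3M : l3 \in [set h1; x; y] by rewrite -S1 u1 SL !inE eqxx orbT.
move: uL l2M l3M; rewrite hl !inE /= !inE !negb_or ![l1 == _]eq_sym.
move=> /and3P[/andP[/negbTE-> /negbTE->] l23 _] /= /orP[/eqP l2x|/eqP l2y] /orP[] /eqP E3.
- by rewrite l2x E3 eqxx in l23.
- by apply: (same_heads f s m1 mL); rewrite H1 hL hl l2x E3.
- rewrite -(mval23 _ m1); apply: (same_heads f s (marking_swap23 m1) mL).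
  by rewrite hL l2y E3; move: H1; rewrite hl /heads /= => -[-> -> ->].
- by rewrite l2y E3 eqxx in l23.
Qed.

(** If the sources differ, the markings have exchanged branch vertices. Comparing valences then
    gives [bs = bt], so the reflection of [M] is a marking of the same kind with the source of
    [L]. *)
Lemma mval_uniq M L s : marking g bs bt M -> marking g bs bt L -> mval f M s = mval f L s.
Proof.
move=> mM mL; have [E|us] := eqVneq (src M) (src L); first exact: mval_src.
have bL : branch g (inr (src L)) by rewrite (branchE mL) eqxx.
have wM : tgt M = src L by move: bL; rewrite (branchE mM) (negbTE us) => /eqP.
have bb : bs = bt.
  have wL : tgt L = src M.
    have : branch g (inr (src M)) by rewrite (branchE mM) eqxx.
    by rewrite (branchE mL) eq_sym (negbTE us) => /eqP.
  have := valence_inr mM (src M); rewrite (valence_inr mL) wL wM !eqxx eq_sym (negbTE us).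
  by case: bs bt => [] [].
have mR : marking g bs bt (reflect M) by have := marking_reflect mM; rewrite bb.
by rewrite -(mval_reflect _ bb mM); apply: (mval_src s mR mL).
Qed.

End Value.
End Rigidity.

(** * From values on marked graphs to functionals on the graph-complex *)

Section Functional.
Variables m N : nat.
Hypotheses (N_odd : odd N) (m_even : ~~ odd m).
Variables (bs bt : bool) (f : nat * nat * nat -> rat).
Hypothesis f12 : forall a b c, f (b, a, c) = (-1) ^+ (a * b) * f (a, b, c).
Hypothesis f23 : forall a b c, f (a, c, b) = (-1) ^+ (b * c) * f (a, b, c).
Hypothesis f_reflect : bs = bt -> forall t, tsgn t * f t = f t.

Definition marked_value k n q (G : pregraph k n q) : rat :=
  if pselect (exists M, marking G.1 bs bt M) is left H then mval f (projT1 (cid H)) G.2 else 0.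

Lemma marked_valueE k n q (G : pregraph k n q) M : marking G.1 bs bt M ->
  marked_value G = mval f M G.2.
Proof.
move=> mM; rewrite /marked_value; case: pselect => [H|[]]; last by exists M.
exact: (mval_uniq f12 f23 f_reflect G.2 (projT2 (cid H)) mM).
Qed.

Lemma marked_value0 k n q (G : pregraph k n q) : ~ (exists M, marking G.1 bs bt M) ->
  marked_value G = 0.
Proof. by rewrite /marked_value; case: pselect. Qed.

Definition relabel k n q (fx : {perm 'I_k}) (fi : {perm 'I_n}) (fe : {perm 'I_q})
    (M : theta k n q) : theta k n q :=
  let fh (h : half q) : half q := (fe h.1, h.2) in
  let fA A := Arm (map fh (darts A)) (map fh (hairs A)) (map fi (inner A)) (map fx (tips A)) in
  let fS S := Stub (map fh (sdarts S)) (map fx (stips S)) in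
  Theta (fi (src M)) (fi (tgt M)) (fA (arm1 M)) (fA (arm2 M)) (fA (arm3 M)) (fS (ssrc M)) (fS (stgt M)).

Lemma full_map r (p : {perm 'I_r}) s : full s -> full (map p s).
Proof. by case/andP=> us ss; rewrite /full size_map ss andbT map_inj_uniq //; apply: perm_inj. Qed.

Lemma marking_relabel k n q fx fi fe (G H : pregraph k n q) M : is_iso fx fi fe G H ->
  marking G.1 bs bt M -> marking H.1 bs bt (relabel fx fi fe M).
Proof.
move=> [eG _]; pose fh (h : half q) : half q := (fe h.1, h.2); pose vm := vertex_map fx fi.
have E (s : seq (half q)) : map H.1 (map fh s) = map vm (map G.1 s).
  by rewrite -!map_comp; apply: eq_map => -[e b] /=; rewrite eG.
have F (s : seq (half q)) : map (H.1 \o @opp_half q) (map fh s) = map vm (map (G.1 \o @opp_half q) s).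
  by rewrite -!map_comp; apply: eq_map => -[e b]; exact: eG.
have vi s : map vm (map inr s) = map inr (map fi s) by rewrite -!map_comp.
have vx s : map vm (map inl s) = map inl (map fx s) by rewrite -!map_comp.
have arm_rel A u w : arm_ok G.1 u w A -> arm_ok H.1 (fi u) (fi w)
    (Arm (map fh (darts A)) (map fh (hairs A)) (map fi (inner A)) (map fx (tips A))).
  move=> [e1 e2 e3 e4]; split; rewrite /= ?E ?F ?e1 ?e2 ?e3 ?e4 ?vi ?vx //.
  by rewrite -(map_rcons fi).
have stub_rel b u S : stub_ok G.1 b u S -> stub_ok H.1 b (fi u)
    (Stub (map fh (sdarts S)) (map fx (stips S))).
  by move=> [e1 e2]; split; rewrite /= ?E ?F ?e1 ?e2 ?vi ?vx ?nseq_map.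
move=> [o1 o2 o3 os ot fv ft fe']; split; try exact: arm_rel; try exact: stub_rel.
- by have := full_map fi fv; rewrite /vertices /= !map_cat.
- by have := full_map fx ft; rewrite /all_tips /= !map_cat.
- have := full_map fe fe'; rewrite /all_darts /frame_darts /hair_darts /= -!map_cat -!map_comp.
  by [].
Qed.

Lemma msign_relabel k n q fx fi fe (G H : pregraph k n q) M : is_iso fx fi fe G H ->
  total_order G.2 -> marking G.1 bs bt M -> msign (relabel fx fi fe M) H.2 = msign M G.2.
Proof.
move=> [_ ->] tG mM; rewrite /msign -!mulrA -(sign_relabel fx fi fe (mkv mM) tG); congr (_ * (_ * _)).
  rewrite /all_darts /frame_darts /hair_darts /= -!map_cat count_map.
  by congr (_ ^+ _); apply: eq_count.
by rewrite /vertices /= !map_cat.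
Qed.

Lemma is_iso_inv k n q fx fi fe (G H : pregraph k n q) : is_iso fx fi fe G H ->
  is_iso (fx^-1)%g (fi^-1)%g (fe^-1)%g H G.
Proof.
move=> [eG e2]; split=> [e b|].
  rewrite -[e in RHS](permKV fe) eG; case: (G.1 _) => i /=; by rewrite permK.
rewrite e2 -map_comp -[LHS]map_id; apply: eq_map => -[[i|i]|e] /=; by rewrite permK.
Qed.

Lemma marked_value_iso k n q fx fi fe (G H : ograph k n q) : is_iso fx fi fe G H ->
  marked_value H = marked_value G.
Proof.
move=> iGH; have [[M mM]|nM] := pselect (exists M, marking (ogval G).1 bs bt M).
  have mM' := marking_relabel iGH mM; rewrite (marked_valueE mM) (marked_valueE mM') /mval.
  rewrite (msign_relabel iGH _ mM); last by case/andP: (good_ograph G).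
  by congr (_ * f _); rewrite /msize /= !size_map.
rewrite !marked_value0 // => -[M mM]; apply: nM; exists (relabel (fx^-1)%g (fi^-1)%g (fe^-1)%g M).
exact: marking_relabel (is_iso_inv iGH) mM.
Qed.

Lemma flip_flip k n q (g : graph k n q) e : flip (flip g e) e = g.
Proof. by apply/ffunP => h; rewrite -[h in LHS](flip_halfK e) !flip_halfE. Qed.

Lemma marked_value_flip k n q (G H : pregraph k n q) e : H.1 = flip G.1 e -> H.2 = G.2 ->
  marked_value H = - marked_value G.
Proof.
move=> e1 e2; have [[M mM]|nM] := pselect (exists M, marking G.1 bs bt M).
  have mM' := marking_flip e mM; rewrite -e1 in mM'; rewrite (marked_valueE mM) (marked_valueE mM') e2 /mval.
  rewrite /msign all_darts_map count_flip ?mulNr //; first by case/andP: (mke mM).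
  exact: full_mem (mke mM).
rewrite !marked_value0 ?oppr0 // => -[M mM]; apply: nM; exists (theta_map (flip_half e) M).
by have := marking_flip e mM; rewrite e1 flip_flip.
Qed.

Lemma marked_value_order k n q (G H : ograph k n q) : (ogval H).1 = (ogval G).1 ->
  marked_value H = koszul m N (ogval G).2 (ogval H).2 * marked_value G.
Proof.
move=> e1; have [[M mM]|nM] := pselect (exists M, marking (ogval G).1 bs bt M).
  have mM' := mM; rewrite -e1 in mM'; rewrite (marked_valueE mM) (marked_valueE mM') /mval /msign.
  have /andP[_ tG] := good_ograph G; have /andP[_ tH] := good_ograph H.
  rewrite (koszul_sign N_odd m_even tG tH) !mulrA; congr (_ * _).
  have sG := order_sign_sqr (@internal k n q) (ogval G).2.
  set x := cell_sign _ in sG *; set y := cell_sign _; set z := (-1) ^+ _; set v := seq_sign _.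
  by rewrite -[LHS]mulr1 -sG; ring.
by rewrite !marked_value0 ?mulr0 // => -[M mM]; apply: nM; exists M; rewrite -e1.
Qed.

Definition free_value : {malg rat[any_ograph]} -> rat^o :=
  lin_ext (fun G : any_ograph => marked_value (tagged G) : rat^o).
HB.instance Definition _ := GRing.Linear.on free_value.

Lemma free_valueU k n q (G : ograph k n q) : free_value << any G >> = marked_value G.
Proof. exact: lin_extU. Qed.

Lemma free_valueB (c : rat) x y : free_value (x - c *: y) = free_value x - c *: free_value y.
Proof. by rewrite linearB linearZ. Qed.

Lemma free_value_relator x : relator m N x -> free_value x = 0.
Proof.
have sub k n q (G G' : ograph k n q) c : marked_value G' = c * marked_value G ->
    free_value (<< any G' >> - c *: << any G >>) = 0.
  move=> E; apply: etrans (free_valueB _ _ _) _.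
  apply: etrans (congr2 (fun a b => a - c *: b) (free_valueU G') (free_valueU G)) _.
  by rewrite E subrr.
case=> {x} k n q G G' => [fx fi fe iGG'|e e1 e2|e1].
- have := sub _ _ _ G G' 1; rewrite !scale1r; apply.
  by rewrite mul1r; apply: marked_value_iso iGG'.
- apply: sub; rewrite (marked_value_flip e1 e2) -signr_odd N_odd expr1 mulN1r //.
- by apply: sub; apply: marked_value_order.
Qed.

Definition class_value : E_pi m N -> rat^o := descend free_value_relator.
HB.instance Definition _ := GRing.Linear.on class_value.

Lemma class_value_gclass k n q (G : ograph k n q) :
  class_value (gclass m N G) = marked_value G.
Proof. by rewrite gclassE /class_value descendE; exact: free_valueU. Qed.

(** Theta classes satisfy no relations beyond the symmetries imposed on [f]. The value 0 on unmarked
    graphs respects the relators, because isomorphisms, flips and reorderings preserve the existence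
    of a marking. *)
Lemma theta_functional : exists F : {linear E_pi m N -> rat^o},
  forall t, (0 < tsum t + bs + bt)%N -> F (theta_class m N bs bt t) = f t.
Proof.
exists class_value => t s0.
have [k [n [q [G [M [mM sM k0]]]]]] := marked_exists s0; have gG := good_ograph G.
have E := theta_classE N_odd m_even gG mM; rewrite sM in E.
rewrite E linearZ /= class_value_gclass (marked_valueE mM) /mval sM.
by rewrite /GRing.scale /= mulrA msign_sqr mul1r.
Qed.

End Functional.

(** * Signed symmetric functions of three exponents *)

Notation fn := (nat -> nat -> nat -> rat).

Definition sg (b : bool) : rat := if b then -1 else 1.

Ltac parity_cases :=
  repeat match goal with |- context [odd ?x] => is_var x; case: (odd x) end; rewrite /=.

Section Operators.
Implicit Types (rho : bool) (f : fn).

Definition up1 f : fn := fun a b c => if a is a'.+1 then f a' b c else 0.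
Definition up2 f : fn := fun a b c => if b is b'.+1 then f a b' c else 0.
Definition up3 f : fn := fun a b c => if c is c'.+1 then f a b c' else 0.

(* Left multiplication by the sum of the variables of skew polynomials in three
   anticommuting variables, restricted to the factors of degree parity [rho]. *)
Definition D rho f : fn := fun a b c =>
  (if odd a == rho then 0 else up1 f a b c) +
  sg (odd a) * (if odd b == rho then 0 else up2 f a b c) +
  sg (odd a (+) odd b) * (if odd c == rho then 0 else up3 f a b c).

(** For odd parity put u = x^2: the exponents 2p - 1 and 2p stand for xi u^(p-1) and u^p, [D] is the
    Koszul differential replacing xi by u, and the weight p arises from differentiating u^p. *)
Definition weight rho (x : nat) : rat := if rho then x%:R / 2 else 1.

(** The eigenvalue of [D] and [contract] in [D_contract]: 3 for even parity, the Koszul degree for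
    odd parity. It vanishes only for odd parity at the exponents 0, 0, 0. *)
Definition W rho a b c : rat :=
  weight rho (if odd a == rho then a.+1 else a) +
  weight rho (if odd b == rho then b.+1 else b) +
  weight rho (if odd c == rho then c.+1 else c).

(* A contracting homotopy of [D rho]: contraction with (1,1,1) for the even
   entries, and the Euler homotopy of the Koszul complex for the odd ones. *)
Definition contract rho f : fn := fun a b c =>
  (if odd a == rho then weight rho a.+1 * f a.+1 b c else 0) +
  sg (odd a) * (if odd b == rho then weight rho b.+1 * f a b.+1 c else 0) +
  sg (odd a (+) odd b) * (if odd c == rho then weight rho c.+1 * f a b c.+1 else 0).

Definition homotopy rho f : fn := fun a b c => contract rho f a b c / W rho a b c.

Definition swap_ab f : fn := fun a b c => sg (odd a && odd b) * f b a c.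
Definition swap_bc f : fn := fun a b c => sg (odd b && odd c) * f a c b.

Definition shift2 f : fn := fun a b c => up1 (up1 f) a b c + up2 (up2 f) a b c + up3 (up3 f) a b c.

Lemma D_contract rho f a b c :
  D rho (contract rho f) a b c + contract rho (D rho f) a b c = W rho a b c * f a b c.
Proof.
rewrite /D /contract /W /weight; case: rho; case: a b c => [|a] [|b] [|c] /=;
by rewrite /sg; parity_cases; field.
Qed.

Lemma D_D rho f a b c : D rho (D rho f) a b c = 0.
Proof.
rewrite /D; case: rho; case: a b c => [|a] [|b] [|c] /=;
by rewrite /sg; parity_cases; ring.
Qed.

(** [W] does not change when an exponent of parity [rho] is raised by one, so dividing by it
    commutes with [D rho]. *)
Lemma D_homotopyE rho f a b c : D rho (homotopy rho f) a b c = D rho (contract rho f) a b c / W rho a b c.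
Proof.
rewrite /D !mulrDl -!mulrA ![_ / W _ _ _ _]mulrC /homotopy.
congr (_ + sg _ * _ + sg _ * _).
- case: a => [|a] /=; case: ifP => // ra; rewrite ?mulr0 // mulrC; congr (_^-1 * _).
  by rewrite /W /= ra; case: ifP => //; move: ra; case: (odd a) (rho) => [] [].
- case: b => [|b] /=; case: ifP => // rb; rewrite ?mulr0 // mulrC; congr (_^-1 * _).
  by rewrite /W /= rb; case: ifP => //; move: rb; case: (odd b) (rho) => [] [].
- case: c => [|c] /=; case: ifP => // rc; rewrite ?mulr0 // mulrC; congr (_^-1 * _).
  by rewrite /W /= rc; case: ifP => //; move: rc; case: (odd c) (rho) => [] [].
Qed.

Lemma D_homotopy rho f a b c : W rho a b c != 0 ->
  D rho (homotopy rho f) a b c + homotopy rho (D rho f) a b c = f a b c.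
Proof. by move=> W0; rewrite D_homotopyE -mulrDl D_contract mulrAC mulfV // mul1r. Qed.

(** The sum of the two operators is multiplication by x + y + z, whose square is x^2 + y^2 + z^2
    since mixed products cancel; the squares of the two operators vanish. *)
Lemma D_anticomm rho f a b c :
  D (~~ rho) (D rho f) a b c + D rho (D (~~ rho) f) a b c = shift2 f a b c.
Proof.
rewrite /D /shift2; case: rho; case: a b c => [|[|a]] [|[|b]] [|[|c]] /=;
by rewrite /sg; parity_cases; ring.
Qed.

Lemma D_swap_ab rho f a b c : D rho (swap_ab f) a b c = swap_ab (D rho f) a b c.
Proof.
rewrite /D /swap_ab; case: rho; case: a b c => [|a] [|b] [|c] /=;
by rewrite /sg; parity_cases; ring.
Qed.

Lemma D_swap_bc rho f a b c : D rho (swap_bc f) a b c = swap_bc (D rho f) a b c.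
Proof.
rewrite /D /swap_bc; case: rho; case: a b c => [|a] [|b] [|c] /=;
by rewrite /sg; parity_cases; ring.
Qed.

Lemma W_swap_ab rho a b c : W rho b a c = W rho a b c.
Proof. by rewrite /W; ring. Qed.

Lemma W_swap_bc rho a b c : W rho a c b = W rho a b c.
Proof. by rewrite /W; ring. Qed.

Lemma homotopy_swap_ab rho f a b c : homotopy rho (swap_ab f) a b c = swap_ab (homotopy rho f) a b c.
Proof.
rewrite /homotopy /swap_ab W_swap_ab mulrA; congr (_ / _); rewrite /contract.
by case: rho; rewrite /= /sg; parity_cases; ring.
Qed.

Lemma homotopy_swap_bc rho f a b c : homotopy rho (swap_bc f) a b c = swap_bc (homotopy rho f) a b c.
Proof.
rewrite /homotopy /swap_bc W_swap_bc mulrA; congr (_ / _); rewrite /contract.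
by case: rho; rewrite /= /sg; parity_cases; ring.
Qed.

Definition eqfn f g := forall a b c, f a b c = g a b c.

Lemma D_ext rho f g : eqfn f g -> eqfn (D rho f) (D rho g).
Proof. by move=> fg [|a] [|b] [|c]; rewrite /D /= ?fg. Qed.

Lemma homotopy_ext rho f g : eqfn f g -> eqfn (homotopy rho f) (homotopy rho g).
Proof. by move=> fg a b c; rewrite /homotopy /contract !fg. Qed.

Lemma D_lin rho x f y g a b c :
  D rho (fun a b c => x * f a b c + y * g a b c) a b c = x * D rho f a b c + y * D rho g a b c.
Proof. by rewrite /D; case: a b c => [|a] [|b] [|c] /=; do !case: ifP => _; ring. Qed.

(* Invariance under the symmetric group acting with signs. *)
Definition sinv f := eqfn (swap_ab f) f /\ eqfn (swap_bc f) f.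

Lemma sinv_D rho f : sinv f -> sinv (D rho f).
Proof.
by move=> [f1 f2]; split=> a b c; rewrite -?D_swap_ab -?D_swap_bc; apply: D_ext.
Qed.

Lemma sinv_homotopy rho f : sinv f -> sinv (homotopy rho f).
Proof.
by move=> [f1 f2]; split=> a b c; rewrite -?homotopy_swap_ab -?homotopy_swap_bc; apply: homotopy_ext.
Qed.

Lemma sinv_lin x f y g : sinv f -> sinv g -> sinv (fun a b c => x * f a b c + y * g a b c).
Proof.
move=> [f1 f2] [g1 g2]; split=> a b c.
  by have := f1 a b c; have := g1 a b c; rewrite /swap_ab => <- <-; ring.
by have := f2 a b c; have := g2 a b c; rewrite /swap_bc => <- <-; ring.
Qed.

(** [i] is the defect: of the [k] hairs, [a + b + c] sit along the arms and [i] at the branch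
    vertices. *)
Definition deg k i f := forall a b c, (a + b + c + i)%N != k -> f a b c = 0.

Definition level pi a b c : nat := ((odd a != pi) + (odd b != pi) + (odd c != pi))%N.

Definition lev pi j f := forall a b c, level pi a b c != j -> f a b c = 0.

Lemma deg_D rho k i f : deg k i.+1 f -> deg k i (D rho f).
Proof.
move=> df a b c ne; rewrite /D.
have -> : up1 f a b c = 0 by case: a ne => //= a ne; apply: df; lia.
have -> : up2 f a b c = 0 by case: b ne => //= b ne; apply: df; lia.
have -> : up3 f a b c = 0 by case: c ne => //= c ne; apply: df; lia.
by rewrite !if_same !mulr0 !addr0.
Qed.

Lemma deg_homotopy rho k i f : deg k i f -> deg k i.+1 (homotopy rho f).
Proof.
move=> df a b c ne; rewrite /homotopy /contract !df; try lia.
by rewrite !mulr0 !if_same !mulr0 !addr0 mul0r.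
Qed.

Lemma lev_up pi j f : lev pi j f -> lev pi j.+1 (D pi f).
Proof.
move=> lf a b c; rewrite /level => ne; rewrite /D.
have -> : (if odd a == pi then 0 else up1 f a b c) = 0.
  by case: ifP => // pa; case: a pa ne => //= a pa ne; apply: lf; move: pa ne; rewrite /level; case: (odd a) (pi) => [] []; lia.
have -> : (if odd b == pi then 0 else up2 f a b c) = 0.
  by case: ifP => // pa; case: b pa ne => //= b pa ne; apply: lf; move: pa ne; rewrite /level; case: (odd b) (pi) => [] []; lia.
have -> : (if odd c == pi then 0 else up3 f a b c) = 0.
  by case: ifP => // pa; case: c pa ne => //= c pa ne; apply: lf; move: pa ne; rewrite /level; case: (odd c) (pi) => [] []; lia.
by rewrite !mulr0 !addr0.
Qed.

Lemma lev_down pi j f : lev pi j.+1 f -> lev pi j (D (~~ pi) f).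
Proof.
move=> lf a b c; rewrite /level => ne; rewrite /D.
have -> : (if odd a == ~~ pi then 0 else up1 f a b c) = 0.
  by case: ifP => // pa; case: a pa ne => //= a pa ne; apply: lf; move: pa ne; rewrite /level; case: (odd a) (pi) => [] []; lia.
have -> : (if odd b == ~~ pi then 0 else up2 f a b c) = 0.
  by case: ifP => // pa; case: b pa ne => //= b pa ne; apply: lf; move: pa ne; rewrite /level; case: (odd b) (pi) => [] []; lia.
have -> : (if odd c == ~~ pi then 0 else up3 f a b c) = 0.
  by case: ifP => // pa; case: c pa ne => //= c pa ne; apply: lf; move: pa ne; rewrite /level; case: (odd c) (pi) => [] []; lia.
by rewrite !mulr0 !addr0.
Qed.

Lemma lev0_D pi f : lev pi 0 f -> forall a b c, D (~~ pi) f a b c = 0.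
Proof.
move=> lf a b c; rewrite /D.
have -> : (if odd a == ~~ pi then 0 else up1 f a b c) = 0.
  by case: ifP => // pa; case: a pa => //= a pa; apply: lf; move: pa; rewrite /level; case: (odd a) (pi) => [] [].
have -> : (if odd b == ~~ pi then 0 else up2 f a b c) = 0.
  by case: ifP => // pa; case: b pa => //= b pa; apply: lf; move: pa; rewrite /level; case: (odd b) (pi) => [] []; lia.
have -> : (if odd c == ~~ pi then 0 else up3 f a b c) = 0.
  by case: ifP => // pa; case: c pa => //= c pa; apply: lf; move: pa; rewrite /level; case: (odd c) (pi) => [] []; lia.
by rewrite !mulr0 !addr0.
Qed.

Lemma lev3_D pi f : lev pi 3 f -> forall a b c, D pi f a b c = 0.
Proof.
move=> lf a b c; apply: (lev_up lf); rewrite /level.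
by case: (odd a != pi); case: (odd b != pi); case: (odd c != pi).
Qed.

Lemma lev_homotopy_down pi j f : lev pi j.+1 f -> lev pi j (homotopy pi f).
Proof.
move=> lf a b c; rewrite /level => ne; rewrite /homotopy /contract.
have -> : (if odd a == pi then weight pi a.+1 * f a.+1 b c else 0) = 0.
  by case: ifP => // pa; rewrite lf ?mulr0 //; move: pa ne; rewrite /level /=; case: (odd a) (pi) => [] []; lia.
have -> : (if odd b == pi then weight pi b.+1 * f a b.+1 c else 0) = 0.
  by case: ifP => // pa; rewrite lf ?mulr0 //; move: pa ne; rewrite /level /=; case: (odd b) (pi) => [] []; lia.
have -> : (if odd c == pi then weight pi c.+1 * f a b c.+1 else 0) = 0.
  by case: ifP => // pa; rewrite lf ?mulr0 //; move: pa ne; rewrite /level /=; case: (odd c) (pi) => [] []; lia.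
by rewrite !mulr0 !addr0 mul0r.
Qed.

Lemma lev_homotopy_up pi j f : lev pi j f -> lev pi j.+1 (homotopy (~~ pi) f).
Proof.
move=> lf a b c; rewrite /level => ne; rewrite /homotopy /contract.
have -> : (if odd a == ~~ pi then weight (~~ pi) a.+1 * f a.+1 b c else 0) = 0.
  by case: ifP => // pa; rewrite lf ?mulr0 //; move: pa ne; rewrite /level /=; case: (odd a) (pi) => [] []; lia.
have -> : (if odd b == ~~ pi then weight (~~ pi) b.+1 * f a b.+1 c else 0) = 0.
  by case: ifP => // pa; rewrite lf ?mulr0 //; move: pa ne; rewrite /level /=; case: (odd b) (pi) => [] []; lia.
have -> : (if odd c == ~~ pi then weight (~~ pi) c.+1 * f a b c.+1 else 0) = 0.
  by case: ifP => // pa; rewrite lf ?mulr0 //; move: pa ne; rewrite /level /=; case: (odd c) (pi) => [] []; lia.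
by rewrite !mulr0 !addr0 mul0r.
Qed.

Lemma W_neq0 rho a b c : (0 < a + b + c)%N -> W rho a b c != 0.
Proof.
move=> s0; rewrite /W /weight; case: rho; last by [].
rewrite -!mulrDl -!natrD mulf_eq0 invr_eq0 !pnatr_eq0 orbF -lt0n.
by do !case: ifP => _; lia.
Qed.

Lemma W_false a b c : W false a b c = 3.
Proof. by []. Qed.

(** The constant term is the only obstruction to exactness: for odd parity it has eigenvalue 0, and
    division by 0 makes the homotopy vanish there. *)
Lemma homotopy_formula rho f a b c : (rho -> f 0%N 0%N 0%N = 0) ->
  D rho (homotopy rho f) a b c + homotopy rho (D rho f) a b c = f a b c.
Proof.
case: rho => f0; last by apply: D_homotopy; rewrite W_false.
have [|] := posnP (a + b + c)%N; last by move=> ?; apply/D_homotopy/W_neq0.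
move/eqP; rewrite !addn_eq0 => /andP[/andP[/eqP-> /eqP->] /eqP->].
by rewrite f0 // /homotopy /D /W /weight /= !(mul0r, addr0, invr0, mulr0).
Qed.

End Operators.

Definition delta x y z : fn := fun a b c => ((a == x) && (b == y) && (c == z))%:R.

Definition sym (f : fn) : fn := fun a b c => f a b c + swap_ab f a b c + swap_bc f a b c +
  swap_ab (swap_bc f) a b c + swap_bc (swap_ab f) a b c + swap_ab (swap_bc (swap_ab f)) a b c.

Lemma sinv_sym f : sinv (sym f).
Proof.
by split=> a b c; rewrite /sym /swap_ab /swap_bc /sg; parity_cases; ring.
Qed.

Lemma deg_sym k i f : deg k i f -> deg k i (sym f).
Proof.
move=> df a b c ne; rewrite /sym /swap_ab /swap_bc !df; try lia.
by rewrite !mulr0 !addr0.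
Qed.

(* The exponents [a], [b], [c] for which the exchange of the branch vertices of
   the theta graph acts by [+1]. *)
Definition reflection_even a b c : bool := ~~ odd (uphalf a + uphalf b + uphalf c).

Definition even_part (f : fn) : fn := fun a b c => if reflection_even a b c then f a b c else 0.

Lemma sinv_even_part f : sinv f -> sinv (even_part f).
Proof.
move=> [f1 f2]; split=> a b c; rewrite /swap_ab /swap_bc /even_part /reflection_even.
  rewrite (addnC (uphalf b)); case: ifP => _; last by rewrite mulr0.
  by have := f1 a b c.
rewrite addnAC; case: ifP => _; last by rewrite mulr0.
by have := f2 a b c.
Qed.

Lemma deg_even_part k i f : deg k i f -> deg k i (even_part f).
Proof. by move=> df a b c ne; rewrite /even_part df // if_same. Qed.

(** * Functions as coefficients of linear combinations of generators *)

Section Sums.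
Variables (V : lmodType rat) (th : nat -> nat -> nat -> V) (K : nat).
Implicit Types f g : fn.

Definition lincomb f : V := \sum_(a < K) \sum_(b < K) \sum_(c < K) f a b c *: th a b c.

Lemma lincomb_ext f g : eqfn f g -> lincomb f = lincomb g.
Proof.
by move=> fg; apply: eq_bigr => a _; apply: eq_bigr => b _; apply: eq_bigr => c _; rewrite fg.
Qed.

Lemma lincomb_lin x f y g : lincomb (fun a b c => x * f a b c + y * g a b c) = x *: lincomb f + y *: lincomb g.
Proof.
rewrite /lincomb !scaler_sumr -big_split; apply: eq_bigr => a _ /=.
rewrite !scaler_sumr -big_split; apply: eq_bigr => b _ /=.
rewrite !scaler_sumr -big_split; apply: eq_bigr => c _ /=.
by rewrite scalerDl !scalerA.
Qed.

Lemma lincomb0 : lincomb (fun _ _ _ => 0) = 0.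
Proof. by rewrite /lincomb !big1 // => a _; rewrite big1 // => b _; rewrite big1 // => c _; rewrite scale0r. Qed.

Lemma lincomb_delta x y z : (x < K)%N -> (y < K)%N -> (z < K)%N -> lincomb (delta x y z) = th x y z.
Proof.
move=> xK yK zK; rewrite /lincomb (bigD1 (Ordinal xK)) //= [X in _ + X]big1 ?addr0 => [|a ax]; last first.
  by rewrite big1 // => b _; rewrite big1 // => c _; rewrite /delta -val_eqE /= in ax *; rewrite (negbTE ax) scale0r.
rewrite (bigD1 (Ordinal yK)) //= [X in _ + X]big1 ?addr0 => [|b bx]; last first.
  by rewrite big1 // => c _; rewrite /delta -val_eqE /= in bx *; rewrite (negbTE bx) andbF scale0r.
rewrite (bigD1 (Ordinal zK)) //= [X in _ + X]big1 ?addr0 => [|c cx]; last first.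
  by rewrite /delta -val_eqE /= in cx *; rewrite (negbTE cx) andbF scale0r.
by rewrite /delta !eqxx scale1r.
Qed.

Section Symmetric.
Hypothesis th_ab : forall a b c, th b a c = sg (odd a && odd b) *: th a b c.
Hypothesis th_bc : forall a b c, th a c b = sg (odd b && odd c) *: th a b c.

Lemma lincomb_swap_ab f : lincomb (swap_ab f) = lincomb f.
Proof.
rewrite /lincomb exchange_big; apply: eq_bigr => a _; apply: eq_bigr => b _; apply: eq_bigr => c _ /=.
rewrite /swap_ab (th_ab a b) scalerA mulrAC andbC /sg.
by case: (_ && _); rewrite ?mulrNN !mul1r.
Qed.

Lemma lincomb_swap_bc f : lincomb (swap_bc f) = lincomb f.
Proof.
apply: eq_bigr => a _; rewrite exchange_big; apply: eq_bigr => b _; apply: eq_bigr => c _ /=.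
rewrite /swap_bc (th_bc a b) scalerA mulrAC andbC /sg.
by case: (_ && _); rewrite ?mulrNN !mul1r.
Qed.

Lemma lincomb_sym f : lincomb (sym f) = 6%:R *: lincomb f.
Proof.
have add (g h : fn) : lincomb (fun a b c => g a b c + h a b c) = lincomb g + lincomb h.
  by rewrite -[lincomb g]scale1r -[lincomb h]scale1r -lincomb_lin; apply: lincomb_ext => a b c; rewrite !mul1r.
rewrite /sym !add !(lincomb_swap_ab, lincomb_swap_bc).
have -> : 6%:R = 1 + 1 + 1 + 1 + 1 + 1 :> rat by [].
by rewrite !scalerDl !scale1r.
Qed.
End Symmetric.

Lemma lincomb_even_part f : (forall a b c, ~~ reflection_even a b c -> th a b c = 0) -> lincomb (even_part f) = lincomb f.
Proof.
move=> bad; apply: eq_bigr => a _; apply: eq_bigr => b _; apply: eq_bigr => c _.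
by rewrite /even_part; case: ifP => // /negbT /bad ->; rewrite !scaler0.
Qed.

Lemma sum_shift (W : zmodType) (F : nat -> W) : F K = 0 ->
  \sum_(a < K) F a.+1 = \sum_(a < K) (if (a : nat) is a'.+1 then F a'.+1 else 0).
Proof.
case: K => [|K'] FK; first by rewrite !big_ord0.
by rewrite big_ord_recr [RHS]big_ord_recl /= FK addr0 add0r.
Qed.

(** Summation by parts: raising exponents in the coefficients is moved onto the generators. No term
    is lost at the bound [K] because of the degree. *)
Lemma lincomb_D rho k i f : deg k i f -> (k.+1 < K)%N -> lincomb (D rho f) =
  \sum_(a < K) \sum_(b < K) \sum_(c < K) f a b c *:
    ((if odd a == rho then th a.+1 b c else 0) + sg (odd a) *: (if odd b == rho then th a b.+1 c else 0)
     + sg (odd a (+) odd b) *: (if odd c == rho then th a b c.+1 else 0)).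
Proof.
move=> df kK.
have up1K b c : up1 f K b c = 0 by case: K kK => //= K' kK; apply: df; lia.
have up2K a c : up2 f a K c = 0 by case: K kK => //= K' kK; apply: df; lia.
have up3K a b : up3 f a b K = 0 by case: K kK => //= K' kK; apply: df; lia.
have e1 : \sum_(a < K) \sum_(b < K) \sum_(c < K) f a b c *: (if odd a == rho then th a.+1 b c else 0) =
    \sum_(a < K) \sum_(b < K) \sum_(c < K) (if odd a == rho then 0 else up1 f a b c) *: th a b c.
  pose F a := \sum_(b < K) \sum_(c < K) (if odd a == rho then 0 else up1 f a b c) *: th a b c.
  transitivity (\sum_(a < K) F a.+1).
    rewrite /F {F}; apply: eq_bigr => a _; apply: eq_bigr => b _; apply: eq_bigr => c _ /=.
    by case: (odd a) (rho) => [] []; rewrite ?scaler0 ?scale0r.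
  rewrite (sum_shift (F := F)) => [|]; last first.
    rewrite /F {F}.
    rewrite big1 // => b _; rewrite big1 // => c _.
    by rewrite up1K if_same scale0r.
  apply: eq_bigr => -[[|a] la] _ //=; rewrite big1 // => b _; rewrite big1 // => c _.
  by rewrite if_same scale0r.
have e2 : \sum_(a < K) \sum_(b < K) \sum_(c < K) f a b c *: (sg (odd a) *: (if odd b == rho then th a b.+1 c else 0)) =
    \sum_(a < K) \sum_(b < K) \sum_(c < K) (sg (odd a) * (if odd b == rho then 0 else up2 f a b c)) *: th a b c.
  apply: eq_bigr => a _; pose F b := \sum_(c < K) (sg (odd a) * (if odd b == rho then 0 else up2 f a b c)) *: th a b c.
  transitivity (\sum_(b < K) F b.+1).
    rewrite /F {F}; apply: eq_bigr => b _; apply: eq_bigr => c _ /=; rewrite scalerA mulrC.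
    by case: (odd b) (rho) => [] []; rewrite ?scaler0 ?mulr0 ?scale0r.
  rewrite (sum_shift (F := F)) => [|]; last first.
    rewrite /F {F}.
    rewrite big1 // => c _.
    by rewrite up2K if_same mulr0 scale0r.
  apply: eq_bigr => -[[|b] lb] _ //=; rewrite big1 // => c _.
  by rewrite if_same mulr0 scale0r.
have e3 : \sum_(a < K) \sum_(b < K) \sum_(c < K) f a b c *: (sg (odd a (+) odd b) *: (if odd c == rho then th a b c.+1 else 0)) =
    \sum_(a < K) \sum_(b < K) \sum_(c < K) (sg (odd a (+) odd b) * (if odd c == rho then 0 else up3 f a b c)) *: th a b c.
  apply: eq_bigr => a _; apply: eq_bigr => b _; pose F c := (sg (odd a (+) odd b) * (if odd c == rho then 0 else up3 f a b c)) *: th a b c.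
  transitivity (\sum_(c < K) F c.+1).
    rewrite /F {F}; apply: eq_bigr => c _ /=; rewrite scalerA mulrC.
    by case: (odd c) (rho) => [] []; rewrite ?scaler0 ?mulr0 ?scale0r.
  rewrite (sum_shift (F := F)) => [|]; last first.
    rewrite /F {F}.
    by rewrite up3K if_same mulr0 scale0r.
  by apply: eq_bigr => -[[|c] lc] _ //=; rewrite if_same mulr0 scale0r.
rewrite /lincomb /D; transitivity (\sum_(a < K) \sum_(b < K) \sum_(c < K) (if odd a == rho then 0 else up1 f a b c) *: th a b c +
  \sum_(a < K) \sum_(b < K) \sum_(c < K) (sg (odd a) * (if odd b == rho then 0 else up2 f a b c)) *: th a b c +
  \sum_(a < K) \sum_(b < K) \sum_(c < K) (sg (odd a (+) odd b) * (if odd c == rho then 0 else up3 f a b c)) *: th a b c).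
  do 3![rewrite -!big_split; apply: eq_bigr => ? _ /=].
  by rewrite !scalerDl.
rewrite -e1 -e2 -e3; do 3![rewrite -!big_split; apply: eq_bigr => ? _ /=].
by rewrite !scalerDr.
Qed.

(** A functional with the values [f] on the generators sends the combination to the sum of the
    squares of [f], which vanishes over the rationals only if all terms do. *)
Lemma lincomb_functional k i f (F : {linear V -> rat^o}) : deg k i f -> (k < K)%N ->
  (forall a b c, (a + b + c + i)%N = k -> F (th a b c) = f a b c) -> lincomb f = 0 -> eqfn f (fun _ _ _ => 0).
Proof.
move=> df kK Ff /(congr1 F); rewrite linear0 /lincomb linear_sum.
under eq_bigr => a _.
  rewrite linear_sum; under eq_bigr => b _.
    rewrite linear_sum; under eq_bigr => c _.
      rewrite linearZ /= (_ : _ *: F (th a b c) = f a b c ^+ 2 :> rat^o); last first.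
        have [E|E] := eqVneq (a + b + c + i)%N k; first by rewrite Ff.
        by rewrite df // scale0r expr0n.
      over.
    over.
  over.
move=> S0 a b c; have [E|] := eqVneq (a + b + c + i)%N k; last exact: df.
have aK : (a < K)%N by lia.
have bK : (b < K)%N by lia.
have cK : (c < K)%N by lia.
have ge0 : forall x y z, 0 <= f x y z ^+ 2 by move=> *; apply: sqr_ge0.
move/eqP: S0; rewrite psumr_eq0 => [/allP/(_ (Ordinal aK))|? _]; last by do 2![apply: sumr_ge0 => ? _].
rewrite mem_index_enum => /(_ isT) /=; rewrite psumr_eq0 => [/allP/(_ (Ordinal bK))|? _]; last by apply: sumr_ge0.
rewrite mem_index_enum => /(_ isT) /=; rewrite psumr_eq0 // => /allP/(_ (Ordinal cK)).
by rewrite mem_index_enum => /(_ isT) /=; rewrite sqrf_eq0 => /eqP.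
Qed.

End Sums.

(** * Multiplication by the sum of the squares *)

Lemma signed_diag (V : lmodType rat) (x : V) : x = (-1 : rat) *: x -> x = 0.
Proof.
rewrite scaleN1r => /eqP; rewrite -addr_eq0 -mulr2n -scaler_nat scaler_eq0 pnatr_eq0 /=.
by move/eqP.
Qed.

(** * Spanning by lowering the largest exponent *)

Section Spanning.
Variables (V : lmodType rat) (Q : V -> Prop) (v : nat -> nat -> nat -> V) (pi : bool) (n : nat).
Hypotheses (QD : forall x y, Q x -> Q y -> Q (x + y)) (QZ : forall (c : rat) x, Q x -> Q (c *: x)).
Hypotheses (Q0 : Q 0).
Hypothesis v_ab : forall a b c, v b a c = sg (odd a && odd b) *: v a b c.
Hypothesis v_bc : forall a b c, v a c b = sg (odd b && odd c) *: v a b c.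
Hypothesis v_shift : forall a b c, level pi a b c = 0%N -> (a + b + c + 2)%N = n ->
  Q (v a.+2 b c + v a b.+2 c + v a b c.+2).
Hypothesis v_basis : forall y z, odd y = pi -> odd z = pi ->
  (y + 2 * pi + y + z)%N = n -> (z + 2 * pi <= y)%N -> Q (v (y + 2 * pi)%N y z).

Lemma span_ab a b c : Q (v a b c) -> Q (v b a c).
Proof. by rewrite [v b a c]v_ab; apply: QZ. Qed.

Lemma span_bc a b c : Q (v a b c) -> Q (v a c b).
Proof. by rewrite [v a c b]v_bc; apply: QZ. Qed.

(** Two equal odd exponents give 0, and otherwise x = y + 2 pi is a basis orbit. In the remaining
    cases x >= y + 2 pi + 2, and the relation with base (x - 2, y, z) lowers the largest
    exponent. *)
Lemma spanning_sorted m x y z : odd x = pi -> odd y = pi -> odd z = pi -> (x + y + z)%N = n ->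
  (z <= y <= x)%N -> (x <= m.+1)%N ->
  (forall x y z, odd x = pi -> odd y = pi -> odd z = pi -> (x + y + z)%N = n ->
    (x <= m)%N -> (y <= m)%N -> (z <= m)%N -> Q (v x y z)) -> Q (v x y z).
Proof.
move=> ox oy oz sn /andP[zy yx] xm IH.
have [xy|] := eqVneq x (y + 2 * pi)%N; last move=> ne.
  have [zb|zb] := leqP (z + 2 * pi) y; first by rewrite xy in sn *; apply: v_basis.
  have pt : pi by move: zb; case: (pi) => //; lia.
  have yz : y = z by move: oy oz; rewrite pt; lia.
  suff -> : v x y z = 0 by [].
  by apply: signed_diag; rewrite {1}yz -{2}yz v_bc oy oz pt.
have [E|ne'] := eqVneq x y.
  have pt : pi by move: ne; rewrite E; case: (pi) => //; lia.
  suff -> : v x y z = 0 by [].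
  by apply: signed_diag; rewrite {1}E -{2}E v_ab ox oy pt.
have xy2 : (y + 2 * pi + 2 <= x)%N by move: ox oy ne ne'; case: (pi); lia.
case: x ox sn yx xm ne ne' xy2 => [|[|x]] //= ox sn yx xm ne ne' xy2; first by lia.
  by move: xy2; lia.
rewrite negbK in ox.
have lv : level pi x y z = 0%N by rewrite /level ox oy oz eqxx.
have sm : (x + y + z + 2)%N = n by lia.
have rel := v_shift lv sm.
(* Terms of the relation that agree with [v x.+2 y z] by symmetry raise its coefficient to 2 or 3,
   which is invertible; this happens only for even parity and x = y. *)
have solve (c : rat) w : c != 0 -> Q w -> Q (c *: v x.+2 y z + w) -> Q (v x.+2 y z).
  move=> c0 /(QZ (-1)) Qw /QD/(_ Qw); rewrite scaleN1r addrK => /(QZ c^-1).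
  by rewrite scalerA mulVf // scale1r.
have [xy|xy] := leqP (y + 2) x.
  apply: (solve 1 (v x y.+2 z + v x y z.+2)) => //; last by rewrite scale1r addrA.
  by apply: QD; apply: IH; rewrite /= ?negbK //; lia.
have pf : pi = false by move: xy2 xy; case: (pi) => //; lia.
have xE : x = y by move: xy xy2 ox oy; rewrite pf; lia.
rewrite {}xE in ox lv sm rel solve sn yx xm ne ne' xy2 xy *.
have s1 : v y y.+2 z = v y.+2 y z by rewrite v_ab /= !negbK oy pf scale1r.
have [zy'|zy'] := ltnP z y.
  apply: (solve 2 (v y y z.+2)) => //; first by apply: IH; rewrite /= ?negbK //; move: oz oy; lia.
  by rewrite (_ : 2 = 1 + 1 :> rat) // scalerDl !scale1r -{2}s1.
have zE : z = y by apply/eqP; rewrite eqn_leq zy zy'.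
have s2 : v y y z.+2 = v y.+2 y z by rewrite zE v_bc v_ab /= !negbK oy pf !scale1r.
apply: (solve 3 0) => //; rewrite addr0.
by rewrite (_ : 3 = 1 + 1 + 1 :> rat) // !scalerDl !scale1r -{2}s1 -{2}s2.
Qed.

Lemma spanning x y z : level pi x y z = 0%N -> (x + y + z)%N = n -> Q (v x y z).
Proof.
rewrite /level => lv sn.
have [ox oy oz] : [/\ odd x = pi, odd y = pi & odd z = pi].
  by move: lv; do !case: eqP => //.
have [m [xm ym zm]] : exists m, [/\ x <= m, y <= m & z <= m]%N by exists n; split; lia.
elim: m x y z {lv} ox oy oz sn xm ym zm => [|m IH] x y z ox oy oz sn xm ym zm.
  move: xm ym zm ox sn; rewrite !leqn0 => /eqP-> /eqP-> /eqP-> /= p0 n0.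
  have e : (0 + 2 * pi = 0)%N by rewrite -p0.
  by rewrite -[X in v X]e; apply: v_basis; rewrite // e.
have sorted a b c := @spanning_sorted m a b c.
have [xy|xy] := leqP y x; have [yz|yz] := leqP z y; have [xz|xz] := leqP z x; try lia.
- by apply: sorted => //; lia.
- by apply: span_bc; apply: sorted => //; lia.
- by apply: span_bc; apply: span_ab; apply: sorted => //; lia.
- by apply: span_ab; apply: sorted => //; lia.
- by apply: span_ab; apply: span_bc; apply: sorted => //; lia.
- by apply: span_ab; apply: span_bc; apply: span_ab; apply: sorted => //; lia.
Qed.
End Spanning.

(** * Independence of the orbits modulo the sum of the squares *)

Section Independence.
Variable pi : bool.

(* Induction on the sum of the two entries that are not maximal: raising the
   maximal entry by 2 singles out one term of [shift2]. *)
Lemma shift2_inj (h : fn) : sinv h -> lev pi 0 h ->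
  (forall x y z, (y + 2 * pi + 2 <= x)%N -> (z + 2 * pi + 2 <= x)%N -> shift2 h x y z = 0) ->
  eqfn h (fun _ _ _ => 0).
Proof.
move=> [h1 h2] lh hs.
have zero w : w = - w :> rat -> w = 0 by lra.
have top m x y z : (y + z < m)%N -> (y <= x)%N -> (z <= x)%N -> h x y z = 0.
  elim: m x y z => // m IH x y z yzm yx zx.
  have [lv|/lh//] := eqVneq (level pi x y z) 0%N.
  have [ox oy oz] : [/\ odd x = pi, odd y = pi & odd z = pi].
    by move: lv; rewrite /level; do !case: eqP.
  have [/andP[pt xy]|nxy] := boolP (pi && (x == y)).
    by apply: zero; have := h1 x y z; rewrite /swap_ab ox oy pt /sg /= -(eqP xy) mulN1r.
  have [/andP[pt xz]|nxz] := boolP (pi && (x == z)).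
    have e : h x y x = - h x x y by have := h2 x y x; rewrite /swap_bc ox oy pt /sg /= mulN1r => <-.
    rewrite -(eqP xz) e; suff -> : h x x y = 0 by rewrite oppr0.
    by apply: zero; have := h1 x x y; rewrite /swap_ab ox pt /sg /= mulN1r.
  have := hs x.+2 y z; rewrite /shift2 /=.
  have -> : up2 (up2 h) x.+2 y z = 0.
    by case: y yzm yx {nxy oy lv} => [|[|y]] //= yzm yx; apply: IH; lia.
  have -> : up3 (up3 h) x.+2 y z = 0.
    by case: z yzm zx {nxz oz lv} => [|[|z]] //= yzm zx; apply: IH; lia.
  by rewrite !addr0; apply; move: nxy nxz ox oy oz; case: (pi); lia.
have swap_b x y z : h x y z = 0 -> h y x z = 0 by rewrite -(h1 y) /swap_ab => ->; rewrite mulr0.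
have swap_c x y z : h x y z = 0 -> h x z y = 0 by rewrite -(h2 x z) /swap_bc => ->; rewrite mulr0.
move=> x y z; have [xy|xy] := leqP y x; have [yz|yz] := leqP z y; have [xz|xz] := leqP z x; try lia.
- by apply: (top (y + z).+1).
- by apply: (top (y + z).+1); lia.
- by apply/swap_c/swap_b/(top (x + y).+1); lia.
- by apply/swap_b/(top (x + z).+1); lia.
- by apply/swap_b/(top (x + z).+1); lia.
- by apply/swap_c/swap_b/(top (x + y).+1); lia.
Qed.

Variables (n d : nat) (T : 'I_d -> nat * nat).

(* The orbits of [(y + 2 * pi, y, z)] with [z + 2 * pi <= y]. *)
Definition orbit_basis :=
  [/\ injective T,
      forall i, let: (y, z) := T i in
        [/\ odd y = pi, odd z = pi, (y + 2 * pi + y + z)%N = n & (z + 2 * pi <= y)%N]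
    & forall y z, odd y = pi -> odd z = pi -> (y + 2 * pi + y + z)%N = n -> (z + 2 * pi <= y)%N ->
        exists i, T i = (y, z)].

Hypothesis Tb : orbit_basis.

Definition basis_delta i := delta ((T i).1 + 2 * pi)%N (T i).1 (T i).2.
Definition basis_comb (c : 'I_d -> rat) : fn := fun x y z => \sum_i c i * basis_delta i x y z.

(** In a basis orbit the largest exponent exceeds the next one by only 2 pi, so [shift2 h] vanishes
    where one exponent is further ahead and [shift2_inj] gives h = 0. Evaluating the symmetrised
    combination at the i-th orbit leaves [c i] times a positive number. *)
Lemma basis_comb_free (c : 'I_d -> rat) (h : fn) : sinv h -> lev pi 0 h ->
  eqfn (sym (basis_comb c)) (shift2 h) -> forall i, c i = 0.
Proof.
case: Tb => [Ti Tp _] ih lh E i.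
have far x y z : (y + 2 * pi + 2 <= x)%N -> (z + 2 * pi + 2 <= x)%N ->
    [/\ basis_comb c x y z = 0, basis_comb c y x z = 0 & basis_comb c y z x = 0].
  move=> yx zx; split; apply: big1 => j _; have := Tp j; rewrite /basis_delta /delta;
  by case: (T j) => y' z' [oy oz _ zy] /=; do !case: eqP => //= *; rewrite ?mulr0 //; exfalso; lia.
have s0 : eqfn (sym (basis_comb c)) (fun _ _ _ => 0).
  have h0 : eqfn h (fun _ _ _ => 0).
    apply: shift2_inj => // x y z yx zx; rewrite -E /sym /swap_ab /swap_bc.
    have [-> -> ->] := far _ _ _ yx zx; have [-> -> ->] := far _ _ _ zx yx.
    by rewrite !mulr0 !addr0.
  move=> x y z; rewrite E /shift2.
  by case: x y z => [|[|x]] [|[|y]] [|[|z]] /=; rewrite ?h0 !addr0.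
have := Tp i; case Ei: (T i) => [y z] [oy oz ty zy].
have ox : odd (y + 2 * pi) = pi by rewrite oddD oddM oy addbF.
set x := (y + 2 * pi)%N in ox ty.
have val t : t \in [:: (x, y, z); (y, x, z); (x, z, y); (z, x, y); (y, z, x); (z, y, x)] ->
    basis_comb c t.1.1 t.1.2 t.2 = c i * delta x y z t.1.1 t.1.2 t.2.
  move=> tP; rewrite /basis_comb (bigD1 i) //= big1 ?addr0 => [|j ji]; first by rewrite /basis_delta Ei.
  apply/eqP; rewrite mulf_eq0; apply/orP; right; apply/eqP; rewrite /basis_delta /delta.
  have := Tp j; case Ej: (T j) => [y' z'] [oy' oz' ty' zy'].
  case: eqP => //= e1; case: eqP => //= e2; case: eqP => //= e3; case/eqP: ji; apply: Ti.
  rewrite Ei Ej; move: tP; rewrite !inE /x in e1 e2 e3 ty zy *.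
  by case: t e1 e2 e3 => [[t1 t2] t3] /= -> -> ->; rewrite !xpair_eqE => H; congr (_, _); lia.
have := s0 x y z; rewrite /sym /swap_ab /swap_bc ox oy oz.
rewrite (val (x, y, z)) ?inE ?eqxx ?orbT // (val (y, x, z)) ?inE ?eqxx ?orbT //.
rewrite (val (x, z, y)) ?inE ?eqxx ?orbT // (val (y, z, x)) ?inE ?eqxx ?orbT //.
rewrite (val (z, x, y)) ?inE ?eqxx ?orbT // (val (z, y, x)) ?inE ?eqxx ?orbT //.
have e1 : delta x y z x y z = 1 by rewrite /delta !eqxx.
rewrite /= e1 mulr1; move: zy; case: (boolP pi) => pP zy.
  have [yx zx zy'] : [/\ (y == x) = false, (z == x) = false & (z == y) = false].
    by rewrite /x; split; apply/eqP; lia.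
  by rewrite /delta yx zx zy' !andbF /= !mulr0 !addr0.
have ge0 p q r : 0 <= delta x y z p q r by apply: ler0n.
rewrite /sg /= !mul1r => H; have : c i * (1 + (delta x y z y x z + delta x y z x z y +
    delta x y z y z x + delta x y z z x y + delta x y z z y x)) == 0.
  by rewrite -H; apply/eqP; ring.
by rewrite mulf_eq0 => /orP[/eqP//|]; rewrite gt_eqF // ltr_pwDl // !addr_ge0.
Qed.
End Independence.

(** From 2y + z = n with y even it follows that 4 divides z; for z = 4i the condition z <= y means
    12i <= n. *)
Lemma orbit_basis_even (n d : nat) : (n %% 4 = 0)%N -> d = (n %/ 12).+1%N ->
  exists T : 'I_d -> nat * nat, orbit_basis false n T.
Proof.
move=> n4 ->; exists (fun i => (2 * (n %/ 4 - i), 4 * i))%N; split=> [i j /(congr1 snd) /= E|i|y z oy oz sn zy].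
- by apply: val_inj => /=; lia.
- by have := ltn_ord i; rewrite !oddM; split=> //; lia.
have zn : (z %/ 4 < (n %/ 12).+1)%N by lia.
by exists (Ordinal zn) => /=; congr (_, _); lia.
Qed.

(** From 2y + 2 + z = n with y odd it follows that z = 4i + 3; then z + 2 <= y means 12i + 15 <= n,
    which for n = 3 mod 4 is the same as 12i + 12 <= n. *)
Lemma orbit_basis_odd (n d : nat) : (n %% 4 = 3)%N -> d = (n %/ 12)%N ->
  exists T : 'I_d -> nat * nat, orbit_basis true n T.
Proof.
move=> n4 ->; exists (fun i => (2 * (n %/ 4 - i.+1) + 1, 4 * i + 3))%N; split=> [i j /(congr1 snd) /= E|i|y z oy oz sn zy].
- by apply: val_inj => /=; lia.
- by have /= := ltn_ord i => li; split; lia.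
have [w ey] : exists w, y = (2 * w + 1)%N by exists y./2; have := odd_double_half y; rewrite oy; lia.
have [q [ez nq]] : exists q, z = (4 * q + 3)%N /\ (12 * q + 12 <= n)%N.
  by exists (z %/ 4)%N; move: sn zy; rewrite ey /= muln1; clear -n4; lia.
have zn : (q < n %/ 12)%N by rewrite leq_divRL //; lia.
exists (Ordinal zn) => /=; move: sn zy; rewrite ey ez /= muln1; clear -n4 => sn zy.
by congr (_, _); lia.
Qed.

(** * The homology of the complex of signed symmetric functions *)

Lemma swap_ab_delta x y z a b c : delta y x z a b c = sg (odd x && odd y) * swap_ab (delta x y z) a b c.
Proof.
rewrite /swap_ab /delta; case: (a =P y) => [->|]; last by rewrite !andbF /= !mulr0.
case: (b =P x) => [->|]; last by rewrite /= !mulr0.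
by rewrite mulrA /sg (andbC (odd y)); case: (_ && odd y); rewrite ?mulrNN !mul1r.
Qed.

Lemma swap_bc_delta x y z a b c : delta x z y a b c = sg (odd y && odd z) * swap_bc (delta x y z) a b c.
Proof.
rewrite /swap_bc /delta; case: (a =P x) => [_|]; last by rewrite /= !mulr0.
case: (b =P z) => [->|]; last by rewrite !andbF /= !mulr0.
case: (c =P y) => [->|]; last by rewrite /= !mulr0.
by rewrite mulrA /sg (andbC (odd z)); case: (_ && odd z); rewrite ?mulrNN !mul1r.
Qed.

Lemma shift2_delta x y z a b c :
  shift2 (delta x y z) a b c = delta x.+2 y z a b c + delta x y.+2 z a b c + delta x y z.+2 a b c.
Proof.
rewrite /shift2 /delta; congr (_ + _ + _).
- by case: a => [|[|a]].
- by case: b => [|[|b]]; rewrite ?andbF.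
- by case: c => [|[|c]]; rewrite ?andbF.
Qed.

Lemma deg_delta k i x y z : (x + y + z + i)%N = k -> deg k i (delta x y z).
Proof. by move=> E a b c ne; rewrite /delta; do !case: eqP => //= *; exfalso; lia. Qed.

Lemma lev_delta pi x y z : lev pi (level pi x y z) (delta x y z).
Proof.
move=> a b c; rewrite /delta; case: (a =P x) => [->|//]; case: (b =P y) => [->|//].
by case: (c =P z) => [->|//]; rewrite eqxx.
Qed.

(** [D (~~ pi)] kills level 0, so only one of the two composites in [D_anticomm] remains. *)
Lemma D_lev0 pi f : lev pi 0 f -> eqfn (D (~~ pi) (D pi f)) (shift2 f).
Proof.
move=> lf a b c; rewrite -(D_anticomm pi) (D_ext (g := fun _ _ _ => 0) _ (lev0_D lf)).
by rewrite /D; case: a b c => [|a] [|b] [|c] /=; rewrite !if_same !mulr0 !addr0.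
Qed.

Definition part pi j f : fn := fun a b c => if level pi a b c == j then f a b c else 0.

Lemma lev_part pi j f : lev pi j (part pi j f).
Proof. by move=> a b c /negbTE ne; rewrite /part ne. Qed.

Lemma deg_part pi j k i f : deg k i f -> deg k i (part pi j f).
Proof. by move=> df a b c ne; rewrite /part df // if_same. Qed.

Lemma sinv_part pi j f : sinv f -> sinv (part pi j f).
Proof.
move=> [f1 f2]; split=> a b c; rewrite /swap_ab /swap_bc /part.
  have -> : level pi b a c = level pi a b c by rewrite /level; lia.
  by rewrite -(f1 a b c) /swap_ab; case: ifP; rewrite ?mulr0.
have -> : level pi a c b = level pi a b c by rewrite /level; lia.
by rewrite -(f2 a b c) /swap_bc; case: ifP; rewrite ?mulr0.
Qed.

Lemma homotopy_lin rho x f y g a b c :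
  homotopy rho (fun a b c => x * f a b c + y * g a b c) a b c = x * homotopy rho f a b c + y * homotopy rho g a b c.
Proof. by rewrite /homotopy /contract; do !case: ifP => _; ring. Qed.

Lemma shift2_scale x f a b c : shift2 (fun a b c => x * f a b c) a b c = x * shift2 f a b c.
Proof. by rewrite /shift2; case: a b c => [|[|a]] [|[|b]] [|[|c]] /=; ring. Qed.

(** The sum of the rounded-up halves is half of a + b + c plus the number of odd exponents. Since a
    + b + c = k - i, the level is 1 or 3, and the residue of k modulo 4 decides which of them makes
    this sum even. *)
Lemma reflection_even_level k i a b c : (a + b + c + i = k)%N -> i = 0%N \/ i = 2 ->
  reflection_even a b c = (level (~~ odd k) a b c == if (k %% 4 < 2)%N == (i == 0%N) then 3 else 1).
Proof.
rewrite /reflection_even /level !uphalf_half => <- i02; rewrite [odd (a + b + c + i)]oddD [odd (a + b + c)]oddD [odd (a + b)]oddD.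
have := odd_double_half a; have := odd_double_half b; have := odd_double_half c.
move: (a./2) (b./2) (c./2) => x y z.
by case: (odd a); case: (odd b); case: (odd c) => /= <- <- <-; case: i02 => -> /=; case: ifP; lia.
Qed.

(** * Linear algebra modulo a subspace *)

Section ModuloSpan.
Variables (V : lmodType rat) (B : V -> Prop) (d : nat) (e : 'I_d -> V).
Hypotheses (B0 : B 0) (BD : forall x y, B x -> B y -> B (x + y)) (BZ : forall (c : rat) x, B x -> B (c *: x)).

Definition modspan x := exists c : 'I_d -> rat, B (x - \sum_i c i *: e i).

Lemma modspanD x y : modspan x -> modspan y -> modspan (x + y).
Proof.
move=> [c Bc] [c' Bc']; exists (fun i => c i + c' i).
have -> : \sum_i (c i + c' i) *: e i = \sum_i c i *: e i + \sum_i c' i *: e i.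
  by rewrite -big_split; apply: eq_bigr => i _; rewrite scalerDl.
by rewrite opprD addrACA; apply: BD.
Qed.

Lemma modspanZ (a : rat) x : modspan x -> modspan (a *: x).
Proof.
move=> [c Bc]; exists (fun i => a * c i).
have -> : \sum_i (a * c i) *: e i = a *: \sum_i c i *: e i.
  by rewrite scaler_sumr; apply: eq_bigr => i _; rewrite scalerA.
by rewrite -scalerBr; apply: BZ.
Qed.

Lemma modspan_sub x : B x -> modspan x.
Proof.
by move=> Bx; exists (fun=> 0); rewrite big1 ?subr0 // => i _; rewrite scale0r.
Qed.

Lemma modspan_gen i : modspan (e i).
Proof.
exists (fun j => (j == i)%:R); rewrite (bigD1 i) //= eqxx scale1r big1 ?addr0 ?subrr //.
by move=> j /negbTE ->; rewrite scale0r.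
Qed.

Lemma modspan_lincomb (v : nat -> nat -> nat -> V) K f :
  (forall a b c, f a b c != 0 -> modspan (v a b c)) -> modspan (lincomb v K f).
Proof.
move=> fv; have M0 : modspan 0 by apply: modspan_sub.
apply: (big_ind modspan) => // [|a _]; first exact: modspanD.
apply: (big_ind modspan) => // [|b _]; first exact: modspanD.
apply: (big_ind modspan) => // [|c _]; first exact: modspanD.
by have [->|/fv/modspanZ] := eqVneq (f a b c) 0; rewrite ?scale0r.
Qed.
End ModuloSpan.

Lemma lincomb_basis_comb (V : lmodType rat) (v : nat -> nat -> nat -> V) K (pi : bool) d (T : 'I_d -> nat * nat) (c : 'I_d -> rat) :
  (forall i, (T i).1 + 2 * pi < K /\ (T i).2 < K)%N ->
  lincomb v K (basis_comb pi T c) = \sum_i c i *: v ((T i).1 + 2 * pi)%N (T i).1 (T i).2.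
Proof.
move=> TK; have -> : lincomb v K (basis_comb pi T c) = \sum_i c i *: lincomb v K (basis_delta pi T i).
  rewrite /lincomb; under [RHS]eq_bigr => i _.
    rewrite scaler_sumr; under eq_bigr => x _.
      rewrite scaler_sumr; under eq_bigr => y _ do rewrite scaler_sumr.
      over.
    over.
  rewrite [RHS]exchange_big; apply: eq_bigr => x _; rewrite [RHS]exchange_big; apply: eq_bigr => y _.
  rewrite [RHS]exchange_big; apply: eq_bigr => z _; rewrite /basis_comb scaler_suml.
  by apply: eq_bigr => i _; rewrite scalerA.
by apply: eq_bigr => i _; have [? ?] := TK i; rewrite lincomb_delta //; lia.
Qed.

Lemma subquotient_dim0 (V : lmodType rat) (Z B : V -> Prop) :
  (forall z, Z z -> B z) -> subquotient_dim Z B 0.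
Proof.
move=> ZB; exists (fun=> 0); split=> [[]//|c _ []//|z /ZB Bz].
by exists (fun=> 0); rewrite big_ord0 subr0.
Qed.

Lemma lev_sym pi f : lev pi 0 f -> lev pi 0 (sym f).
Proof.
by move=> lf a b c ne; rewrite /sym /swap_ab /swap_bc !lf ?mulr0 ?addr0 //; move: ne; rewrite /level; lia.
Qed.

Lemma deg_basis_comb pi n d (T : 'I_d -> nat * nat) c : orbit_basis pi n T -> deg n 0 (basis_comb pi T c).
Proof.
move=> [_ Tp _] x y z ne; apply: big1 => i _; have := Tp i; rewrite /basis_delta; case: (T i) => a b [_ _ E _].
have dd := @deg_delta n 0 (a + 2 * pi)%N a b.
by rewrite /= dd ?mulr0 // addn0.
Qed.

Lemma lev_basis_comb pi n d (T : 'I_d -> nat * nat) c : orbit_basis pi n T -> lev pi 0 (basis_comb pi T c).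
Proof.
move=> [_ Tp _] x y z ne; apply: big1 => i _; have := Tp i; rewrite /basis_delta; case: (T i) => a b [oa ob _ _].
rewrite (@lev_delta pi) ?mulr0 //=; suff -> : level pi (a + 2 * pi) a b = 0%N by [].
by rewrite /level oddD oddM oa ob /= addbF eqxx.
Qed.

Lemma homotopy0 rho f : eqfn f (fun _ _ _ => 0) -> eqfn (homotopy rho f) (fun _ _ _ => 0).
Proof.
by move=> f0 a b c; rewrite /homotopy /contract !f0 !mulr0 !if_same !mulr0 !addr0 mul0r.
Qed.

Lemma D_zero rho f : eqfn f (fun _ _ _ => 0) -> eqfn (D rho f) (fun _ _ _ => 0).
Proof. by move=> f0 [|a] [|b] [|c]; rewrite /D /= ?f0 !if_same !mulr0 !addr0. Qed.

Lemma D_exact (rho : bool) f : (rho -> f 0%N 0%N 0%N = 0) -> eqfn (D rho f) (fun _ _ _ => 0) ->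
  eqfn (D rho (homotopy rho f)) f.
Proof. by move=> f0 Df a b c; rewrite -[RHS](homotopy_formula a b c f0) (homotopy0 rho Df) addr0. Qed.

Section LinearFunction.
Variables (V : lmodType rat) (L : fn -> V).
Hypothesis L_ext : forall f g, eqfn f g -> L f = L g.
Hypothesis L_lin : forall x f y g, L (fun a b c => x * f a b c + y * g a b c) = x *: L f + y *: L g.

Lemma linear_fn0 : L (fun _ _ _ => 0) = 0.
Proof.
have <- : L (fun a b c => 0 * delta 0 0 0 a b c + 0 * delta 0 0 0 a b c) = L (fun _ _ _ => 0).
  by apply: L_ext => a b c; rewrite !mul0r addr0.
by rewrite L_lin !scale0r addr0.
Qed.

Lemma linear_fn_scale x f : L (fun a b c => x * f a b c) = x *: L f.
Proof. by rewrite -[RHS]addr0 -(scale0r (L f)) -L_lin; apply: L_ext => a b c; rewrite mul0r addr0. Qed.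

Lemma linear_fn_sum n (F : nat -> fn) : L (fun a b c => \sum_(i < n) F i a b c) = \sum_(i < n) L (F i).
Proof.
elim: n => [|n IH]; first by rewrite big_ord0 -[RHS]linear_fn0; apply: L_ext => a b c; rewrite big_ord0.
rewrite big_ord_recr /= -IH -[in RHS](scale1r (L (fun _ => _))) -[in RHS](scale1r (L (F n))) -L_lin.
by apply: L_ext => a b c; rewrite big_ord_recr /= !mul1r.
Qed.

Lemma linear_lincomb k i K f : deg k i f -> (k < K)%N -> L f = lincomb (fun a b c => L (delta a b c)) K f.
Proof.
move=> df kK; rewrite /lincomb; transitivity (L (fun x y z => \sum_(a < K) \sum_(b < K) \sum_(c < K) f a b c * delta a b c x y z)).
  apply: L_ext => x y z; have [E|ne] := eqVneq (x + y + z + i)%N k; last first.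
    rewrite df // big1 // => a _; rewrite big1 // => b _; rewrite big1 // => c _; rewrite /delta.
    by case: eqP => [xa|]; case: eqP => [yb|]; case: eqP => [zc|]; rewrite ?mulr0 // -xa -yb -zc df ?mul0r.
  have xK : (x < K)%N by lia.
  have yK : (y < K)%N by lia.
  have zK : (z < K)%N by lia.
  rewrite (bigD1 (Ordinal xK)) //= [X in _ + X]big1 ?addr0 => [|a ax]; last first.
    by rewrite big1 // => b _; rewrite big1 // => c _; rewrite /delta eq_sym -val_eqE /= in ax *; rewrite (negbTE ax) mulr0.
  rewrite (bigD1 (Ordinal yK)) //= [X in _ + X]big1 ?addr0 => [|a ax]; last first.
    by rewrite big1 // => c _; rewrite /delta (eq_sym y) -val_eqE /= in ax *; rewrite (negbTE ax) andbF mulr0.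
  rewrite (bigD1 (Ordinal zK)) //= [X in _ + X]big1 ?addr0 => [|a ax]; last first.
    by rewrite /delta (eq_sym z) -val_eqE /= in ax *; rewrite (negbTE ax) andbF mulr0.
  by rewrite /delta !eqxx mulr1.
rewrite (linear_fn_sum _ (fun a x y z => \sum_(b < K) \sum_(c < K) f a b c * delta a b c x y z)); apply: eq_bigr => a _.
rewrite (linear_fn_sum _ (fun b x y z => \sum_(c < K) f a b c * delta a b c x y z)); apply: eq_bigr => b _.
by rewrite (linear_fn_sum _ (fun c x y z => f a b c * delta a b c x y z)); apply: eq_bigr => c _; rewrite linear_fn_scale.
Qed.
End LinearFunction.

(** * The homology of a complex with signed symmetric generators *)

Section Homology.
Variables (V : lmodType rat) (bd : {linear V -> V}) (C : nat -> V -> Prop).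
Variables (t : nat -> nat -> nat -> nat -> V) (k : nat).
Hypothesis k_gt0 : (0 < k)%N.
Hypotheses (C0 : forall i, C i 0) (CD : forall i x y, C i x -> C i y -> C i (x + y)).
Hypothesis CZ : forall i (c : rat) x, C i x -> C i (c *: x).
Hypothesis C_t : forall i a b c, (i < 3)%N -> (a + b + c + i)%N = k -> C i (t i a b c).
Hypothesis C_ind : forall i (Q : V -> Prop), (i < 3)%N -> Q 0 ->
  (forall x y, Q x -> Q y -> Q (x + y)) -> (forall (c : rat) x, Q x -> Q (c *: x)) ->
  (forall a b c, (a + b + c + i)%N = k -> Q (t i a b c)) -> forall x, C i x -> Q x.
Hypothesis t_ab : forall i a b c, t i b a c = sg (odd a && odd b) *: t i a b c.
Hypothesis t_bc : forall i a b c, t i a c b = sg (odd b && odd c) *: t i a b c.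
Hypothesis t0_bad : forall a b c, ~~ reflection_even a b c -> t 0 a b c = 0.
Hypothesis t2_bad : forall a b c, ~~ reflection_even a b c -> t 2 a b c = 0.
Hypothesis bd0 : forall a b c, bd (t 0 a b c) = 0.
Hypothesis bd1 : forall a b c,
  bd (t 1 a b c) = t 0 a.+1 b c + sg (odd a) *: t 0 a b.+1 c + sg (odd a (+) odd b) *: t 0 a b c.+1.
Hypothesis bd2 : forall a b c, reflection_even a b c ->
  bd (t 2 a b c) = (2 : rat) *: (- sg (odd a) *: t 1 a.+1 b c + (sg (odd a) * - sg (odd b)) *: t 1 a b.+1 c
    + (sg (odd a (+) odd b) * - sg (odd c)) *: t 1 a b c.+1).
Hypothesis theta_functional0 : forall f : fn, sinv f -> (forall a b c, ~~ reflection_even a b c -> f a b c = 0) ->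
  exists F : {linear V -> rat^o}, forall a b c, (a + b + c + 0)%N = k -> F (t 0 a b c) = f a b c.
Hypothesis theta_functional1 : forall f : fn, sinv f ->
  exists F : {linear V -> rat^o}, forall a b c, (a + b + c + 1)%N = k -> F (t 1 a b c) = f a b c.

(** A bound for the exponents of functions of degree up to [k.+1], one more than the Hodge degree,
    as they occur in [homology0_high]. *)
Local Notation K := k.+3.
Local Notation pi := (~~ odd k).
Local Notation S i := (lincomb (t i) K).

Lemma chain_lincomb i f : (i < 3)%N -> deg k i f -> C i (S i f).
Proof.
move=> i3 df; apply: (big_ind (C i)) => // [|a _]; first exact: CD.
apply: (big_ind (C i)) => // [|b _]; first exact: CD.
apply: (big_ind (C i)) => // [|c _]; first exact: CD.
have [E|/df->] := eqVneq (a + b + c + i)%N k; last by rewrite scale0r.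
by apply: CZ; apply: C_t.
Qed.

Lemma chainE i x : (i < 3)%N -> C i x -> exists2 f, sinv f /\ deg k i f & x = S i f.
Proof.
move=> i3; apply: (@C_ind i (fun x => exists2 f, sinv f /\ deg k i f & x = S i f) i3) => [|y z [f [fs fd] ->] [g [gs g_deg] ->]|c y [f [fs fd] ->]|a b c E].
- exists (fun _ _ _ => 0); last by rewrite lincomb0.
  by split=> //; split=> a b c; rewrite /swap_ab /swap_bc mulr0.
- exists (fun a b c => 1 * f a b c + 1 * g a b c); last by rewrite lincomb_lin !scale1r.
  by split=> [|a b c ne]; [exact: (@sinv_lin 1 f 1 g) | rewrite fd // g_deg // !mulr0 addr0].
- exists (fun a b c' => c * f a b c' + 0 * f a b c'); last by rewrite lincomb_lin scale0r addr0.
  by split=> [|a b c' ne]; [exact: (@sinv_lin c f 0 f) | rewrite fd // !mulr0 addr0].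
(* Averaging over the six permutations makes the coefficients of a single generator invariant. *)
exists (fun x y z => 6%:R^-1 * sym (delta a b c) x y z + 0 * sym (delta a b c) x y z).
  split; first by apply: (@sinv_lin _ (sym (delta a b c)) _ (sym (delta a b c))); apply: sinv_sym.
  by move=> x' y' z' ne; rewrite (deg_sym (deg_delta E)) // !mulr0 addr0.
rewrite lincomb_lin scale0r addr0 (lincomb_sym _ (@t_ab i) (@t_bc i)).
by rewrite scalerA mulVf // scale1r lincomb_delta //; lia.
Qed.

Lemma boundary_lincomb i f (w : nat -> nat -> nat -> V) :
  (forall a b c, f a b c != 0 -> bd (t i a b c) = w a b c) ->
  bd (S i f) = \sum_(a < K) \sum_(b < K) \sum_(c < K) f a b c *: w a b c.
Proof.
move=> fw; rewrite /lincomb linear_sum; apply: eq_bigr => a _; rewrite linear_sum; apply: eq_bigr => b _.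
rewrite linear_sum; apply: eq_bigr => c _; rewrite linearZ /=.
by have [->|/fw->//] := eqVneq (f a b c) 0; rewrite !scale0r.
Qed.

Lemma boundary0 f : bd (S 0 f) = 0.
Proof.
rewrite (@boundary_lincomb 0 f (fun _ _ _ => 0)) => [|a b c _]; last exact: bd0.
by rewrite big1 // => a _; rewrite big1 // => b _; rewrite big1 // => c _; rewrite scaler0.
Qed.

Lemma boundary1 rho f : deg k 1 f -> bd (S 1 f) = S 0 (D rho f) + S 0 (D (~~ rho) f).
Proof.
move=> df; rewrite (boundary_lincomb (fun a b c _ => bd1 a b c)) !(lincomb_D _ _ df) //.
rewrite -big_split; apply: eq_bigr => a _; rewrite -big_split; apply: eq_bigr => b _.
rewrite -big_split; apply: eq_bigr => c _ /=; rewrite -scalerDr; congr (_ *: _).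
rewrite addrACA [X in _ = X + _]addrACA -!scalerDr; congr (_ + _ *: _ + _ *: _).
- by case: rho; case: (odd a); rewrite ?addr0 ?add0r.
- by case: rho; case: (odd b); rewrite ?addr0 ?add0r.
- by case: rho; case: (odd c); rewrite ?addr0 ?add0r.
Qed.

(** In [bd2] the term that raises an exponent carries the extra sign of the parity of that exponent,
    so the two operators enter with opposite signs. *)
Lemma boundary2 rho f : deg k 2 f -> (forall a b c, ~~ reflection_even a b c -> f a b c = 0) ->
  bd (S 2 f) = (2 * - sg rho) *: (S 1 (D rho f) - S 1 (D (~~ rho) f)).
Proof.
move=> df fg; rewrite (boundary_lincomb (w := fun a b c => (2 : rat) *: (- sg (odd a) *: t 1 a.+1 b c + (sg (odd a) * - sg (odd b)) *: t 1 a b.+1 c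
    + (sg (odd a (+) odd b) * - sg (odd c)) *: t 1 a b c.+1))) => [|a b c f0]; last first.
  by apply: bd2; apply: contraNT f0 => /fg->.
rewrite !(lincomb_D _ _ df) // -sumrB scaler_sumr; apply: eq_bigr => a _.
rewrite -sumrB scaler_sumr; apply: eq_bigr => b _.
rewrite -sumrB scaler_sumr; apply: eq_bigr => c _ /=; rewrite -scalerBr !scalerA.
rewrite [f a b c * 2]mulrC [in RHS]mulrAC -[in RHS]scalerA; congr (_ *: _).
rewrite opprD addrACA opprD [X in _ *: (X + _)]addrACA -!scalerBr !scalerDr !scalerA; congr (_ + _ + _).
- case: rho; case: (odd a); rewrite /= ?oppr0 ?scaler0 ?addr0 ?add0r ?scalerN -?scaleNr; congr (_ *: _); rewrite /sg; ring.
- case: rho; case: (odd b); rewrite /= ?oppr0 ?scaler0 ?addr0 ?add0r ?scalerN -?scaleNr; congr (_ *: _); rewrite /sg; ring.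
- case: rho; case: (odd c); rewrite /= ?oppr0 ?scaler0 ?addr0 ?add0r ?scalerN -?scaleNr; congr (_ *: _); rewrite /sg; ring.
Qed.

Lemma lincomb_inj0 f : sinv f -> deg k 0 f -> S 0 f = 0 -> eqfn (even_part f) (fun _ _ _ => 0).
Proof.
move=> fs fd; rewrite -(lincomb_even_part _ _ t0_bad).
have [|F Ff] := theta_functional0 (sinv_even_part fs); first by move=> a b c /negbTE; rewrite /even_part => ->.
by apply: (lincomb_functional (deg_even_part fd) _ Ff); lia.
Qed.

Lemma lincomb_inj1 f : sinv f -> deg k 1 f -> S 1 f = 0 -> eqfn f (fun _ _ _ => 0).
Proof. by move=> fs fd; have [F Ff] := theta_functional1 fs; apply: (lincomb_functional fd _ Ff); lia. Qed.

Lemma lincomb_add i f g : S i (fun a b c => f a b c + g a b c) = S i f + S i g.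
Proof.
by rewrite -[S i f]scale1r -[S i g]scale1r -lincomb_lin; apply: lincomb_ext => a b c; rewrite !mul1r.
Qed.

Lemma lincomb_eq0 f g : sinv f -> sinv g -> deg k 0 f -> deg k 0 g -> S 0 f = S 0 g -> eqfn (even_part f) (even_part g).
Proof.
move=> fs gs fd gdg E a b c; have := @lincomb_inj0 (fun a b c => 1 * f a b c + -1 * g a b c).
rewrite lincomb_lin E scale1r scaleN1r subrr => /(_ _ _ erefl a b c).
rewrite /even_part; case: ifP => // _ H; apply/eqP; rewrite -subr_eq0 -[f a b c]mul1r -mulN1r; apply/eqP/H.
  exact: (@sinv_lin 1 f (-1) g).
by move=> a' b' c' ne; rewrite fd // gdg // !mulr0 addr0.
Qed.

Lemma lincomb_eq1 f g : sinv f -> sinv g -> deg k 1 f -> deg k 1 g -> S 1 f = S 1 g -> eqfn f g.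
Proof.
move=> fs gs fd gdg E a b c; have := @lincomb_inj1 (fun a b c => 1 * f a b c + -1 * g a b c).
rewrite lincomb_lin E scale1r scaleN1r subrr => /(_ _ _ erefl a b c) H.
apply/eqP; rewrite -subr_eq0 -[f a b c]mul1r -mulN1r; apply/eqP/H.
  exact: (@sinv_lin 1 f (-1) g).
by move=> a' b' c' ne; rewrite fd // gdg // !mulr0 addr0.
Qed.

Lemma level_parity i a b c : (a + b + c + i)%N = k -> odd (level pi a b c) = ~~ odd i.
Proof.
rewrite /level => <-; rewrite [odd (a + b + c + i)]oddD [odd (a + b + c)]oddD [odd (a + b)]oddD.
by case: (odd a); case: (odd b); case: (odd c); case: (odd i).
Qed.

Lemma lev1_split f : deg k 1 f -> eqfn f (fun a b c => part pi 0 f a b c + part pi 2 f a b c).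
Proof.
move=> df a b c; rewrite /part; have [E|/df->] := eqVneq (a + b + c + 1)%N k; last by rewrite !if_same addr0.
have := level_parity E; rewrite /level.
by case: (_ == _); case: (_ == _); case: (_ == _); rewrite //= ?addr0 ?add0r.
Qed.

Definition boundary_of i x := exists2 y, C i.+1 y & x = bd y.

Lemma boundary_of0 i : boundary_of i 0.
Proof. by exists 0; rewrite ?linear0. Qed.

Lemma boundary_ofD i x y : boundary_of i x -> boundary_of i y -> boundary_of i (x + y).
Proof. by move=> [x' Cx ->] [y' Cy ->]; exists (x' + y'); rewrite ?linearD //; apply: CD. Qed.

Lemma boundary_ofZ i (c : rat) x : boundary_of i x -> boundary_of i (c *: x).
Proof. by move=> [x' Cx ->]; exists (c *: x'); rewrite ?linearZ //; apply: CZ. Qed.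

Lemma lev_neq j f : lev pi j f -> j != 3 -> pi -> f 0%N 0%N 0%N = 0.
Proof. by move=> lf j3 p1; apply: lf; rewrite /level p1 /= eq_sym. Qed.

Lemma lev_neq0 j f : lev pi j f -> j != 0%N -> ~~ pi -> f 0%N 0%N 0%N = 0.
Proof. by move=> lf j0 p0; apply: lf; rewrite /level (negbTE p0) /= eq_sym. Qed.

Lemma lincomb_zero i f : eqfn f (fun _ _ _ => 0) -> S i f = 0.
Proof. by move=> f0; rewrite -(lincomb0 (t i) K); apply: lincomb_ext. Qed.

Lemma lincomb_even_eq f g : eqfn (even_part f) g -> S 0 f = S 0 g.
Proof. by move=> E; rewrite -(lincomb_even_part _ _ t0_bad); apply: lincomb_ext. Qed.

Lemma cycle1E x : C 1 x -> exists g a, [/\ sinv g, deg k 1 g & lev pi 0 g] /\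
  [/\ sinv a, deg k 1 a & lev pi 2 a] /\ x = S 1 g + S 1 a.
Proof.
move=> /chainE[] // f [fs fd] ->; exists (part pi 0 f), (part pi 2 f).
split; first by split; [apply: sinv_part | apply: deg_part | apply: lev_part].
split; first by split; [apply: sinv_part | apply: deg_part | apply: lev_part].
by rewrite -lincomb_add; apply/lincomb_ext/lev1_split.
Qed.

(* The exponents on which the reflection acts trivially have level 3 in defect 0
   and level 1 in defect 2; for the other residues of [k] it is the opposite. *)
Section CaseI.
Hypothesis k4 : (k %% 4 < 2)%N.

Lemma even0_low a b c : (a + b + c + 0)%N = k -> reflection_even a b c = (level pi a b c == 3).
Proof. by move=> E; rewrite (reflection_even_level E) ?k4 //; left. Qed.

Lemma even2_low a b c : (a + b + c + 2)%N = k -> reflection_even a b c = (level pi a b c == 1%N).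
Proof. by move=> E; rewrite (reflection_even_level E) ?k4 //; right. Qed.

Lemma even_partE_low f : deg k 0 f -> eqfn (even_part f) (part pi 3 f).
Proof.
move=> df a b c; rewrite /even_part /part; have [E|/df->] := eqVneq (a + b + c + 0)%N k.
  by rewrite even0_low.
by rewrite !if_same.
Qed.

Lemma lincomb0_lev_low j f : deg k 0 f -> lev pi j f -> j != 3 -> S 0 f = 0.
Proof.
move=> fd lf j3; rewrite (lincomb_even_eq (even_partE_low fd)); apply: lincomb_zero => a b c; rewrite /part.
by case: eqP => // E; apply: lf; rewrite E eq_sym.
Qed.

Lemma boundary_lev0_low g : deg k 1 g -> lev pi 0 g -> bd (S 1 g) = 0.
Proof.
move=> dg lg; rewrite (boundary1 pi dg) (lincomb0_lev_low (deg_D pi dg) (lev_up lg)) // add0r.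
exact/lincomb_zero/lev0_D.
Qed.

Lemma boundary_lev2_low a : deg k 1 a -> lev pi 2 a -> bd (S 1 a) = S 0 (D pi a).
Proof. by move=> da la; rewrite (boundary1 pi da) (lincomb0_lev_low (deg_D _ da) (lev_down la)) // addr0. Qed.

Lemma boundary_lev1_low g : deg k 2 g -> lev pi 1 g ->
  bd (S 2 g) = (2 * - sg pi) *: (S 1 (D pi g) - S 1 (D (~~ pi) g)).
Proof.
move=> dg lg; apply: boundary2 => // a b c bad; have [E|/dg//] := eqVneq (a + b + c + 2)%N k.
by apply: lg; move: bad; rewrite even2_low.
Qed.

(** Only level 3 survives in defect 0. There [D pi] is zero for lack of a level 4, so by exactness
    every function is [D pi] of a function of level 2. *)
Lemma homology0_low : subquotient_dim (fun x => C 0 x /\ bd x = 0) (boundary_of 0) 0.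
Proof.
apply: subquotient_dim0 => _ [/chainE[] // f [fs fd] -> _].
have dp : deg k 0 (part pi 3 f) by apply: deg_part.
have dh := deg_homotopy pi dp; have lh := lev_homotopy_down (@lev_part pi 3 f).
exists (S 1 (homotopy pi (part pi 3 f))); first exact: chain_lincomb.
rewrite boundary_lev2_low // (lincomb_even_eq (even_partE_low fd)); apply: lincomb_ext => a b c.
rewrite D_exact //; first by move=> _; apply: dp; rewrite eq_sym -lt0n.
exact/lev3_D/lev_part.
Qed.

(** The level 2 part of a cycle is closed under [D pi], hence exact, and can be traded for a level 0
    function. A level 0 function bounds exactly when it is [D (~~ pi)] of some [D pi z], that is,
    [shift2] of a multiple of [z]. *)
Lemma homology1_low d (T : 'I_d -> nat * nat) : orbit_basis pi k.-1 T ->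
  subquotient_dim (fun x => C 1 x /\ bd x = 0) (boundary_of 1) d.
Proof.
move=> Tb; have [_ Tp Tall] := Tb; have kS := prednK k_gt0.
have sumT i : ((T i).1 + 2 * pi + (T i).1 + (T i).2 + 1 = k)%N.
  by have := Tp i; case: (T i) => y z [_ _ E _]; rewrite addn1 E kS.
have lt K' x y z : (x + y + z + 1 = K')%N -> [/\ x < K'.+3, y < K'.+3 & z < K'.+3]%N by move=> E; split; clear -E; lia.
pose e i := t 1 ((T i).1 + 2 * pi)%N (T i).1 (T i).2.
have Pe c : S 1 (basis_comb pi T c) = \sum_i c i *: e i.
  by apply: lincomb_basis_comb => i; have [] := lt _ _ _ _ (sumT i).
have lev_e i : level pi ((T i).1 + 2 * pi) (T i).1 (T i).2 = 0%N.
  by have := Tp i; case: (T i) => a b [oa ob _ _]; rewrite /level oddD oddM oa ob /= addbF eqxx.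
have d1 f : deg k.-1 0 f -> deg k 1 f.
  by move=> df a b c ne; apply: df; rewrite addn0 -eqSS kS -addn1.
exists e; split=> [i|c [y Cy Ey]|z [Cz bz]].
- split; first exact: C_t.
  have [xK yK zK] := lt _ _ _ _ (sumT i); rewrite /e -(lincomb_delta (t 1) xK yK zK).
  apply: boundary_lev0_low; first exact: deg_delta (sumT i).
  by have := @lev_delta pi ((T i).1 + 2 * pi)%N (T i).1 (T i).2; rewrite lev_e.
- have [f [fs fd] yE] := @chainE 2 y isT Cy; pose g := even_part f.
  have gs : sinv g by apply: sinv_even_part.
  have dg : deg k 2 g by apply: deg_even_part.
  have lg : lev pi 1 g.
    move=> a b c' ne; rewrite /g /even_part; case: ifP => // gabc; have [E|/fd//] := eqVneq (a + b + c' + 2)%N k.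
    by move: ne; rewrite -even2_low // gabc.
  (* The factor 6 comes from symmetrising [u], the other one from [boundary_lev1_low]. *)
  pose u := basis_comb pi T c; pose q : rat := 6%:R * (2 * - sg pi).
  have q0 : q != 0 by rewrite /q /sg; case: (pi).
  have us := sinv_sym u; have ul : lev pi 0 (sym u) by apply: lev_sym; apply: lev_basis_comb Tb.
  have ud : deg k 1 (sym u) by apply/deg_sym/d1/(deg_basis_comb _ Tb).
  pose z := homotopy pi g.
  have zs : sinv z by apply: sinv_homotopy.
  have zl : lev pi 0 z by apply: lev_homotopy_down.
  have E : eqfn (sym u) (fun a b c => q * D pi g a b c + - q * D (~~ pi) g a b c).
    apply: lincomb_eq1 => //; first by apply: sinv_lin; apply: sinv_D.
      by move=> a b c' ne; rewrite !(deg_D _ dg) // !mulr0 addr0.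
    rewrite (lincomb_sym _ (@t_ab 1) (@t_bc 1)) Pe Ey yE -(lincomb_even_part _ _ t2_bad) boundary_lev1_low //.
    by rewrite lincomb_lin scaleNr -scalerBr scalerA.
  (* In [E] the functions [sym u] and [D (~~ pi) g] have level 0, so comparing at level 2 isolates
     [D pi g]. *)
  have Dg0 : eqfn (D pi g) (fun _ _ _ => 0).
    move=> a b c'; have [lv|/(lev_up lg)//] := eqVneq (level pi a b c') 2%N.
    have := E a b c'; rewrite ul ?lv // (lev_down lg) ?lv // mulr0 addr0 => /esym/eqP.
    by rewrite mulf_eq0 (negbTE q0) => /eqP.
  have gz : eqfn (D pi z) g by apply: D_exact => //; apply: lev_neq lg _.
  apply: (@basis_comb_free _ _ _ _ Tb c (fun a b c => - q * z a b c + 0 * z a b c)).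
  + exact: sinv_lin.
  + by move=> a b c' ne; rewrite zl // !mulr0 addr0.
  move=> a b c'; rewrite E Dg0 mulr0 add0r -(D_ext (~~ pi) gz) (D_lev0 zl) -shift2_scale.
  by rewrite /shift2; case: a b c' => [|[|a]] [|[|b]] [|[|c']] /=; rewrite ?mul0r ?addr0.
suff: modspan (boundary_of 1) e z by [].
pose M := modspan (boundary_of 1) e.
have MD x y : M x -> M y -> M (x + y) by apply: modspanD; apply: boundary_ofD.
have MZ (c : rat) x : M x -> M (c *: x) by apply: modspanZ; apply: boundary_ofZ.
have MB x : boundary_of 1 x -> M x by apply: modspan_sub.
have [g [a [[gs dg lg] [[sa da la] zE]]]] := cycle1E Cz.
have Da0 : eqfn (D pi a) (fun _ _ _ => 0).
  move: bz; rewrite zE linearD /= boundary_lev0_low // add0r boundary_lev2_low // => /lincomb_inj0 H.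
  have dD := deg_D pi da; move=> x y w; have := even_partE_low dD x y w; rewrite (H (sinv_D pi sa) dD) /part.
  by case: eqP => [_ //|/eqP /(lev_up la)].
pose h := homotopy pi a.
have hs : sinv h by apply: sinv_homotopy.
have dh : deg k 2 h by apply: deg_homotopy.
have lh : lev pi 1 h by apply: lev_homotopy_down.
have ha : eqfn (D pi h) a by apply: D_exact => //; apply: lev_neq la _.
(* Up to a scalar the boundary of [h] is [a] minus the level 0 function [D (~~ pi) h]. *)
have zE' : z = S 1 (fun x y w => g x y w + D (~~ pi) h x y w) + (2 * - sg pi)^-1 *: bd (S 2 h).
  rewrite boundary_lev1_low // scalerA mulVf ?scale1r; last by rewrite /sg; case: (pi).
  by rewrite lincomb_add zE (lincomb_ext _ _ ha) -addrA; congr (_ + _); rewrite addrC subrK.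
rewrite zE'; apply: (MD); last first.
  by apply/MZ/MB; exists (S 2 h) => //; apply: chain_lincomb.
have M0 : M 0 by apply/MB/boundary_of0.
apply: (modspan_lincomb (boundary_of0 1) (@boundary_ofD 1) (@boundary_ofZ 1)) => x y w nz.
have lv : level pi x y w = 0%N.
  by apply/eqP; apply: contraNT nz => lv; rewrite lg // (lev_down lh) // addr0.
have sm : (x + y + w + 1)%N = k.
  by apply/eqP; apply: contraNT nz => lv'; rewrite dg // (deg_D _ dh) // addr0.
have {}sm : (x + y + w)%N = k.-1 by rewrite -sm addn1.
apply: (spanning MD MZ M0 (@t_ab 1) (@t_bc 1) _ _ lv sm) => {x y w nz lv sm}.
  move=> x y w lv sm; apply: MB.
  have sm3 : (x + y + w + 3)%N = k by rewrite -kS -sm -addnS.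
  have dx := deg_delta sm3; have lx := @lev_delta pi x y w; rewrite lv in lx.
  have dDx : deg k 2 (D pi (delta x y w)) by apply: deg_D.
  have lDx := lev_up lx.
  (* [D pi] of the delta function is closed under [D pi], so its boundary reduces to the level 0
     function [D (~~ pi) (D pi delta)], which is [shift2 delta]. *)
  exists ((2 * - sg pi)^-1 *: - S 2 (D pi (delta x y w))).
    by apply: CZ; rewrite -scaleN1r; apply/CZ/chain_lincomb.
  rewrite linearZ linearN /= boundary_lev1_low // -scalerN scalerA mulVf ?scale1r; last by rewrite /sg; case: (pi).
  rewrite opprB (@lincomb_zero 1 (D pi (D pi _))) => [|a' b' c']; last exact: D_D.
  rewrite subr0 (lincomb_ext _ _ (D_lev0 lx)) (lincomb_ext _ _ (@shift2_delta x y w)) !lincomb_add !lincomb_delta //;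
  by move: sm3; clear; lia.
move=> y w oy ow sm zy; have [i Ti] := Tall y w oy ow sm zy.
by have := modspan_gen e (boundary_of0 1) i; rewrite /e Ti.
Qed.
End CaseI.

(** * The residues 2 and 3 modulo 4 *)

Section CaseII.
Hypothesis k4 : (1 < k %% 4)%N.

Lemma even0_high a b c : (a + b + c + 0)%N = k -> reflection_even a b c = (level pi a b c == 1%N).
Proof. by move=> E; rewrite (reflection_even_level E) ?(leq_gtF k4) //; left. Qed.

Lemma even2_high a b c : (a + b + c + 2)%N = k -> reflection_even a b c = (level pi a b c == 3).
Proof. by move=> E; rewrite (reflection_even_level E) ?(leq_gtF k4) //; right. Qed.

Lemma even_partE_high f : deg k 0 f -> eqfn (even_part f) (part pi 1 f).
Proof.
move=> df a b c; rewrite /even_part /part; have [E|/df->] := eqVneq (a + b + c + 0)%N k.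
  by rewrite even0_high.
by rewrite !if_same.
Qed.

Lemma lincomb0_lev_high j f : deg k 0 f -> lev pi j f -> j != 1%N -> S 0 f = 0.
Proof.
move=> fd lf j1; rewrite (lincomb_even_eq (even_partE_high fd)); apply: lincomb_zero => a b c; rewrite /part.
by case: eqP => // E; apply: lf; rewrite E eq_sym.
Qed.

Lemma boundary_lev0_high g : deg k 1 g -> lev pi 0 g -> bd (S 1 g) = S 0 (D pi g).
Proof. by move=> dg lg; rewrite (boundary1 pi dg) [X in _ + X]lincomb_zero ?addr0 //; apply: lev0_D. Qed.

Lemma boundary_lev2_high a : deg k 1 a -> lev pi 2 a -> bd (S 1 a) = S 0 (D (~~ pi) a).
Proof. by move=> da la; rewrite (boundary1 pi da) (lincomb0_lev_high (deg_D _ da) (lev_up la)) // add0r. Qed.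

Lemma boundary_lev3_high g : deg k 2 g -> lev pi 3 g ->
  bd (S 2 g) = (2 * sg pi) *: S 1 (D (~~ pi) g).
Proof.
move=> dg lg; rewrite (@boundary2 pi) // => [|a b c bad]; last first.
  have [E|/dg//] := eqVneq (a + b + c + 2)%N k.
  by apply: lg; move: bad; rewrite even2_high.
by rewrite lincomb_zero ?sub0r ?scalerN -?scaleNr ?mulrN ?opprK //; apply: lev3_D.
Qed.

(** For a cycle the level 1 functions [D pi g] and [D (~~ pi) a] cancel. Applying [D (~~ pi)] gives
    [shift2 g] = 0, so g = 0; then [a] is closed under [D (~~ pi)], hence the image of a level 3
    function. *)
Lemma homology1_high : subquotient_dim (fun x => C 1 x /\ bd x = 0) (boundary_of 1) 0.
Proof.
apply: subquotient_dim0 => z [Cz bz].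
have [g [a [[gs dg lg] [[sa da la] zE]]]] := cycle1E Cz.
have sum0 x y w : D pi g x y w + D (~~ pi) a x y w = 0.
  move: bz; rewrite zE linearD /= boundary_lev0_high // boundary_lev2_high // -lincomb_add => /lincomb_inj0 H.
  pose f x y w := 1 * D pi g x y w + 1 * D (~~ pi) a x y w.
  have fE : eqfn f (fun x y w => D pi g x y w + D (~~ pi) a x y w) by move=> *; rewrite /f !mul1r.
  have df : deg k 0 (fun x y w => D pi g x y w + D (~~ pi) a x y w).
    by move=> ? ? ? ne; rewrite !(deg_D _ _ ne) ?addr0.
  have := even_partE_high df x y w; rewrite H //; last first.
    have := sinv_lin 1 1 (sinv_D pi gs) (sinv_D (~~ pi) sa).
    by case=> f1 f2; split=> a' b' c'; [have := f1 a' b' c' | have := f2 a' b' c'];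
      rewrite /swap_ab /swap_bc !mul1r.
  by rewrite /part; case: eqP => [_ //|/eqP lv _]; rewrite (lev_up lg) ?(lev_down la) ?addr0.
have g0 : eqfn g (fun _ _ _ => 0).
  apply: (shift2_inj gs lg) => x y w _ _; rewrite -(D_lev0 lg).
  have := D_lin (~~ pi) 1 (D pi g) 1 (D (~~ pi) a) x y w.
  rewrite D_zero => [|? ? ?]; last by rewrite !mul1r.
  by rewrite (D_D (~~ pi) a) mulr0 addr0 mul1r.
have Da0 : eqfn (D (~~ pi) a) (fun _ _ _ => 0).
  by move=> x y w; have := sum0 x y w; rewrite (D_zero _ g0) add0r.
pose h := homotopy (~~ pi) a.
have ha : eqfn (D (~~ pi) h) a by apply: D_exact => //; apply: lev_neq0 la _.
have dh : deg k 2 h by apply: deg_homotopy.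
have lh : lev pi 3 h by apply: lev_homotopy_up.
exists ((2 * sg pi)^-1 *: S 2 h); first exact/CZ/chain_lincomb.
rewrite linearZ /= boundary_lev3_high // scalerA mulVf ?scale1r; last by rewrite /sg; case: (pi).
by rewrite zE (lincomb_ext _ _ ha) (lincomb_zero 1 g0) add0r.
Qed.

(* Carries the functions of degree [k.+1] and level 0 to chains of defect 0. *)
Local Notation L f := (S 0 (homotopy (~~ pi) f)).
Local Notation v := (fun a b c => L (delta a b c)).

Lemma lift_ext f g : eqfn f g -> L f = L g.
Proof. by move=> E; apply/lincomb_ext/homotopy_ext. Qed.

Lemma lift_lin x f y g : L (fun a b c => x * f a b c + y * g a b c) = x *: L f + y *: L g.
Proof. by rewrite -lincomb_lin; apply: lincomb_ext => a b c; rewrite homotopy_lin. Qed.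

Lemma liftE f : deg k.+1 0 f -> L f = lincomb v K f.
Proof. by move=> df; apply: (linear_lincomb lift_ext lift_lin df). Qed.

Lemma lift_ab a b c : v b a c = sg (odd a && odd b) *: v a b c.
Proof.
rewrite /= (lift_ext (swap_ab_delta a b c)) (linear_fn_scale lift_ext lift_lin); congr (_ *: _).
rewrite (lincomb_ext _ _ (@homotopy_swap_ab _ _)); apply: lincomb_swap_ab; exact: t_ab.
Qed.

Lemma lift_bc a b c : v a c b = sg (odd b && odd c) *: v a b c.
Proof.
rewrite /= (lift_ext (swap_bc_delta a b c)) (linear_fn_scale lift_ext lift_lin); congr (_ *: _).
rewrite (lincomb_ext _ _ (@homotopy_swap_bc _ _)); apply: lincomb_swap_bc; exact: t_bc.
Qed.

Lemma deg_pred i f : deg k.+1 i.+1 f -> deg k i f.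
Proof. by move=> df a b c ne; apply: df; rewrite addnS eqSS. Qed.

Lemma deg_succ i f : deg k i f -> deg k.+1 i.+1 f.
Proof. by move=> df a b c; rewrite addnS eqSS; apply: df. Qed.

(** Modulo the boundaries of level 2, the operator [D (~~ pi)] identifies level 1 with level 0 in
    degree [k.+1], the lift being its inverse. The boundaries of level 0 turn into the image of
    [shift2]. *)
Lemma homology0_high d (T : 'I_d -> nat * nat) : orbit_basis pi k.+1 T ->
  subquotient_dim (fun x => C 0 x /\ bd x = 0) (boundary_of 0) d.
Proof.
move=> Tb; have [_ Tp Tall] := Tb.
have sumT i : ((T i).1 + 2 * pi + (T i).1 + (T i).2 + 0 = k.+1)%N.
  by have := Tp i; case: (T i) => y z [_ _ E _]; rewrite addn0 E.
have lt K' x y z : (x + y + z + 0 = K'.+1)%N -> [/\ x < K'.+3, y < K'.+3 & z < K'.+3]%N.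
  by move=> E; split; clear -E; lia.
pose e i := v ((T i).1 + 2 * pi)%N (T i).1 (T i).2.
have Pe c : lincomb v K (basis_comb pi T c) = \sum_i c i *: e i.
  by apply: lincomb_basis_comb => i; have [] := lt _ _ _ _ (sumT i).
pose M := modspan (boundary_of 0) e.
have MD x y : M x -> M y -> M (x + y) by apply: modspanD; apply: boundary_ofD.
have MZ (c : rat) x : M x -> M (c *: x) by apply: modspanZ; apply: boundary_ofZ.
have MB x : boundary_of 0 x -> M x by apply: modspan_sub.
have M0 : M 0 by apply/MB/boundary_of0.
exists e; split=> [i|c [y Cy Ey]|z [Cz _]].
- by split; [apply/chain_lincomb/deg_pred/deg_homotopy/deg_delta/sumT | apply: boundary0].
- have [g [a [[gs dg lg] [[sa da la] yE]]]] := cycle1E Cy.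
  pose u := basis_comb pi T c.
  have us := sinv_sym u; have ul : lev pi 0 (sym u) by apply: lev_sym; apply: lev_basis_comb Tb.
  have ud : deg k.+1 0 (sym u) by apply/deg_sym/(deg_basis_comb _ Tb).
  have u0 : ~~ pi -> sym u 0%N 0%N 0%N = 0 by move=> _; apply: ud.
  have E : eqfn (even_part (homotopy (~~ pi) (sym u))) (even_part (fun a' b c => 6%:R * D pi g a' b c + 6%:R * D (~~ pi) a a' b c)).
    apply: lincomb_eq0.
    + exact: sinv_homotopy.
    + by apply: sinv_lin; apply: sinv_D.
    + exact/deg_pred/deg_homotopy.
    + by move=> a' b' c' ne; rewrite !(deg_D _ _ ne) // !mulr0 addr0.
    rewrite liftE // (lincomb_sym _ lift_ab lift_bc) Pe Ey yE linearD /= boundary_lev0_high // boundary_lev2_high //.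
    by rewrite lincomb_lin scalerDr.
  have lh : lev pi 1 (homotopy (~~ pi) (sym u)) by apply: lev_homotopy_up.
  have {}E : eqfn (homotopy (~~ pi) (sym u)) (fun a' b c => 6%:R * D pi g a' b c + 6%:R * D (~~ pi) a a' b c).
    move=> a' b' c'; have [lv|ne] := eqVneq (level pi a' b' c') 1%N; last first.
      by rewrite lh // (lev_up lg) // (lev_down la) // !mulr0 addr0.
    have [sm|ne] := eqVneq (a' + b' + c' + 0)%N k; last first.
      by rewrite (deg_pred (deg_homotopy _ ud) ne) (deg_D _ dg ne) (deg_D _ da ne) !mulr0 addr0.
    by have := E a' b' c'; rewrite /even_part even0_high // lv eqxx.
  apply: (@basis_comb_free _ _ _ _ Tb c (fun a b c => 6%:R * g a b c + 0 * g a b c)).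
  + exact: sinv_lin.
  + by move=> a' b' c' ne; rewrite lg // !mulr0 addr0.
  (* [D (~~ pi)] undoes the homotopy on [sym u] and kills the term with [a], which leaves 6 times
     [shift2 g]. *)
  move=> a' b' c'; rewrite -(D_exact u0 (lev0_D ul)) (D_ext _ E) D_lin D_D mulr0 addr0.
  rewrite (D_lev0 lg) -shift2_scale.
  by rewrite /shift2; case: a' b' c' => [|[|a']] [|[|b']] [|[|c']] /=; rewrite ?mul0r ?addr0.
suff: M z by [].
have [f [fs fd] ->] := @chainE 0 z isT Cz; rewrite (lincomb_even_eq (even_partE_high fd)).
pose b := part pi 1 f; have db : deg k 0 b by apply: deg_part.
have lb : lev pi 1 b by apply: lev_part.
pose h := homotopy (~~ pi) b.
have dh : deg k 1 h by apply: deg_homotopy.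
have lh : lev pi 2 h by apply: lev_homotopy_up.
pose w := D (~~ pi) b; have lw : lev pi 0 w by apply: lev_down.
have dw : deg k.+1 0 w by apply/deg_D/deg_succ.
(* The homotopy formula splits [b] into the boundary of [h] and the lift of [w]. *)
rewrite -(lincomb_ext _ _ (fun x y z => homotopy_formula x y z (lev_neq0 lb isT))) lincomb_add.
apply: (MD); first by apply: MB; exists (S 1 h); [apply: chain_lincomb | rewrite boundary_lev2_high].
rewrite -/w liftE //; apply: (modspan_lincomb (boundary_of0 0) (@boundary_ofD 0) (@boundary_ofZ 0)) => x y q nz.
have lv : level pi x y q = 0%N by apply/eqP; apply: contraNT nz => lv; rewrite lw.
have sm : (x + y + q)%N = k.+1.
  by apply/eqP; apply: contraNT nz => sm; rewrite dw // addn0.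
apply: (spanning MD MZ M0 lift_ab lift_bc _ _ lv sm) => {x y q nz lv sm}.
  move=> x y q lv sm; apply: MB.
  have sm1 : (x + y + q + 1)%N = k by apply/eqP; rewrite -eqSS -sm addn2 addn1.
  have dx := deg_delta sm1; have lx := @lev_delta pi x y q; rewrite lv in lx.
  have dDx : deg k 0 (D pi (delta x y q)) by apply: deg_D.
  have lDx := lev_up lx.
  have -> : v x.+2 y q + v x y.+2 q + v x y q.+2 = L (shift2 (delta x y q)).
    rewrite [RHS](lift_ext (g := fun a b c => 1 * (1 * delta x.+2 y q a b c + 1 * delta x y.+2 q a b c) + 1 * delta x y q.+2 a b c)).
      rewrite [RHS](lift_lin 1 (fun a b c => 1 * delta x.+2 y q a b c + 1 * delta x y.+2 q a b c)).
      by rewrite [in RHS](lift_lin 1 (delta x.+2 y q)) !scale1r.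
    by move=> a' b' c'; rewrite shift2_delta !mul1r.
  (* The lift of [D (~~ pi) (D pi delta)] is [D pi delta] minus [D (~~ pi) h'], and both of these
     are boundaries. *)
  pose h' := homotopy (~~ pi) (D pi (delta x y q)).
  have dh' : deg k 1 h' by apply: deg_homotopy.
  have lh' : lev pi 2 h' by apply: lev_homotopy_up.
  exists (S 1 (delta x y q) - S 1 h').
    by apply: CD; [|rewrite -scaleN1r; apply: CZ]; apply: chain_lincomb.
  rewrite linearB /= boundary_lev0_high // boundary_lev2_high // -(lift_ext (D_lev0 lx)).
  rewrite -(lincomb_ext _ _ (fun x y z => homotopy_formula x y z (lev_neq0 lDx isT))) lincomb_add.
  by rewrite addrAC subrr add0r.
move=> y q oy oq sm zy; have [i Ti] := Tall y q oy oq sm zy.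
by have := modspan_gen e (boundary_of0 0) i; rewrite /e Ti.
Qed.

End CaseII.
End Homology.

(** * The two-loop homology *)

Lemma sgE n : sg (odd n) = (-1) ^+ n.
Proof. by rewrite -signr_odd; case: (odd n). Qed.

Lemma sg_and a b : sg (odd a && odd b) = (-1) ^+ (a * b).
Proof. by rewrite -oddM sgE. Qed.

Lemma rsgnS a : rsgn a.+1 = rsgn a * - sg (odd a).
Proof. by rewrite /rsgn binS bin1 exprD sgE exprS mulN1r. Qed.

Lemma rsgnE a : rsgn a = sg (odd (uphalf a)).
Proof.
elim: a => // a IH; rewrite rsgnS IH /= uphalf_half oddD oddb.
by case: (odd a) (odd a./2) => [] []; rewrite /sg /=; ring.
Qed.

Lemma tsgnE a b c : tsgn (a, b, c) = if reflection_even a b c then 1 else -1.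
Proof.
rewrite /tsgn /reflection_even /= !rsgnE !oddD.
by case: (odd (uphalf a)); case: (odd (uphalf b)); case: (odd (uphalf c)); rewrite /sg /=; ring.
Qed.

Section ThetaComplex.
Variables (m N : nat) (N_odd : odd N) (m_even : ~~ odd m) (k : nat) (k_gt0 : (0 < k)%N).

(* [i] is the defect: the first [i] branch vertices carry a hair. *)
Definition theta_of i a b c : E_pi m N := theta_class m N (0 < i)%N (1 < i)%N (a, b, c).

Lemma theta_of_ab i a b c : theta_of i b a c = sg (odd a && odd b) *: theta_of i a b c.
Proof. by rewrite sg_and; apply: theta_swap12. Qed.

Lemma theta_of_bc i a b c : theta_of i a c b = sg (odd b && odd c) *: theta_of i a b c.
Proof. by rewrite sg_and; apply: theta_swap23. Qed.

Lemma theta_vanish (bs : bool) a b c : ~~ reflection_even a b c -> theta_class m N bs bs (a, b, c) = 0.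
Proof.
move=> /negbTE bad; apply: signed_diag.
by rewrite {1}(theta_reflect N_odd m_even bs bs) tsgnE bad.
Qed.

Lemma theta_of_chain i a b c : (i < 3)%N -> (a + b + c + i)%N = k ->
  two_loop_chain i k (theta_of i a b c).
Proof.
move=> i3 E; have := theta_chain N_odd m_even (0 < i)%N (1 < i)%N (a, b, c).
rewrite -addnA; have -> : ((0 < i) + (1 < i) = i)%N by case: i i3 {E} => [|[|[]]].
by rewrite /tsum /= E.
Qed.

Lemma theta_of_ind i (Q : E_pi m N -> Prop) : (i < 3)%N -> Q 0 ->
  (forall x y, Q x -> Q y -> Q (x + y)) -> (forall (c : rat) x, Q x -> Q (c *: x)) ->
  (forall a b c, (a + b + c + i)%N = k -> Q (theta_of i a b c)) -> forall x, two_loop_chain i k x -> Q x.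
Proof.
move=> i3 Q0 QD QZ Qt; apply: (chain_span N_odd m_even) => // bs bt [[a b] c] ei ek.
case: i / ei i3 Qt ek => _ Qt ek; have {Qt ek} := Qt a b c ek; rewrite /theta_of.
case: bs; case: bt => // Qt; rewrite (theta_reflect N_odd m_even true false).
exact: QZ.
Qed.

Lemma boundary_theta0 a b c : boundary (theta_of 0 a b c) = 0.
Proof. by rewrite (boundary_theta N_odd m_even) mul0r !scale0r addr0. Qed.

Lemma boundary_theta1 a b c : boundary (theta_of 1 a b c) = theta_of 0 a.+1 b c +
  sg (odd a) *: theta_of 0 a b.+1 c + sg (odd a (+) odd b) *: theta_of 0 a b c.+1.
Proof.
by rewrite (boundary_theta N_odd m_even) mul0r scale0r addr0 scale1r /theta_sum -oddD !sgE.
Qed.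

(** The two branch vertices contribute equally, whence the factor 2. The remaining hair is left at
    the target and is brought to the source by the reflection, whose sign depends on the parity of
    the raised exponent. *)
Lemma boundary_theta2 a b c : reflection_even a b c -> boundary (theta_of 2 a b c) =
  (2 : rat) *: (- sg (odd a) *: theta_of 1 a.+1 b c + (sg (odd a) * - sg (odd b)) *: theta_of 1 a b.+1 c
    + (sg (odd a (+) odd b) * - sg (odd c)) *: theta_of 1 a b c.+1).
Proof.
move=> gt; have t1 : tsgn (a, b, c) = 1 by rewrite tsgnE gt.
rewrite (boundary_theta N_odd m_even) t1 mulr1 scale1r -mulr2n -scaler_nat; congr (_ *: _).
have [e1 e2 e3] : [/\ tsgn (a.+1, b, c) = - sg (odd a), tsgn (a, b.+1, c) = - sg (odd b) &
    tsgn (a, b, c.+1) = - sg (odd c)].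
  by move: t1; rewrite /tsgn /= !rsgnS => t1; split; rewrite -[RHS]mul1r -t1; ring.
rewrite /theta_sum !(theta_reflect N_odd m_even true false).
by rewrite -[(a.+1, _, _)]/(a.+1, b, c) e1 e2 e3 !scalerA -!sgE oddD.
Qed.

Lemma theta_functional0 (f : fn) : sinv f -> (forall a b c, ~~ reflection_even a b c -> f a b c = 0) ->
  exists F : {linear E_pi m N -> rat^o}, forall a b c, (a + b + c + 0)%N = k -> F (theta_of 0 a b c) = f a b c.
Proof.
move=> [f1 f2] fg; have := @theta_functional m N N_odd m_even false false (fun t => f t.1.1 t.1.2 t.2).
case=> /= [a b c|a b c|_ [[a b] c]|F Ff].
- by rewrite -(f1 b a c) /swap_ab andbC sg_and.
- by rewrite -(f2 a c b) /swap_bc andbC sg_and.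
- by rewrite tsgnE; case: (boolP (reflection_even a b c)) => /= [|/fg->]; rewrite ?mul1r ?mulr0.
by exists F => a b c E; rewrite Ff //= /tsum /= ?addn0 -?E; lia.
Qed.

Lemma theta_functional1 (f : fn) : sinv f ->
  exists F : {linear E_pi m N -> rat^o}, forall a b c, (a + b + c + 1)%N = k -> F (theta_of 1 a b c) = f a b c.
Proof.
move=> [f1 f2]; have := @theta_functional m N N_odd m_even true false (fun t => f t.1.1 t.1.2 t.2).
case=> //= [a b c|a b c|F Ff].
- by rewrite -(f1 b a c) /swap_ab andbC sg_and.
- by rewrite -(f2 a c b) /swap_bc andbC sg_and.
by exists F => a b c E; rewrite Ff //= /tsum /=; lia.
Qed.
End ThetaComplex.

Local Open Scope nat_scope.

Theorem theorem6p3 (m N : nat) (m_gt0 : 0 < m) (N_gt0 : 0 < N)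
    (N_odd : odd N) (m_even : ~~ odd m) (k : nat) (k_gt0 : 0 < k) :
  two_loop_homology_dim m N 0 k
    (match k %% 4 with
     | 0 | 1 => 0
     | 2 => k %/ 12
     | _ => ceil_div (k + 2) 12
     end) /\
  two_loop_homology_dim m N 1 k
    (match k %% 4 with
     | 2 | 3 => 0
     | 0 => (k - 1) %/ 12
     | _ => ceil_div k 12
     end).
Proof.
pose C i := @two_loop_chain m N i k.
have C0 i : C i 0%R by apply: lspan0.
have CD i x y : C i x -> C i y -> C i (x + y)%R by apply: lspanD.
have CZ i c x : C i x -> C i (c *: x)%R by apply: lspanZ.
have C_t := @theta_of_chain m N N_odd m_even k.
have C_ind := @theta_of_ind m N N_odd m_even k.
have t_ab := @theta_of_ab m N N_odd m_even; have t_bc := @theta_of_bc m N N_odd m_even.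
have bad0 := @theta_vanish m N N_odd m_even false; have bad2 := @theta_vanish m N N_odd m_even true.
have bd0 := @boundary_theta0 m N N_odd m_even; have bd1 := @boundary_theta1 m N N_odd m_even.
have bd2 := @boundary_theta2 m N N_odd m_even.
have f0 := @theta_functional0 m N N_odd m_even k k_gt0; have f1 := @theta_functional1 m N N_odd m_even k k_gt0.
have H0 := homology0_low k_gt0 C0 CD CZ C_t C_ind t_ab t_bc bad0 bd1.
have H1 := homology1_low k_gt0 C0 CD CZ C_t C_ind t_ab t_bc bad0 bad2 bd1 bd2 f0 f1.
have H0' := homology0_high k_gt0 C0 CD CZ C_t C_ind t_ab t_bc bad0 bd0 bd1 f0.
have H1' := homology1_high k_gt0 C0 CD CZ C_t C_ind t_ab t_bc bad0 bd1 bd2 f0.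
move: H0 H1 H0' H1'; rewrite /two_loop_homology_dim.
have [ek|[ek|[ek|ek]]] : k %% 4 = 0 \/ k %% 4 = 1 \/ k %% 4 = 2 \/ k %% 4 = 3 by lia.
- rewrite ek => /(_ isT) H0 /(_ isT) H1 _ _; split; first exact: H0.
  (* [pi] is the parity of k - 1, odd here, and k - 1 = 3 mod 4. For k = 1 mod 4 it is even, and the
     count (k - 1) / 12 + 1 with rounding down is k / 12 rounded up. *)
  have [T] : exists T : 'I_((k - 1) %/ 12) -> nat * nat, orbit_basis true k.-1 T.
    by apply: orbit_basis_odd; lia.
  have -> : true = ~~ odd k by lia.
  exact: H1.
- rewrite ek => /(_ isT) H0 /(_ isT) H1 _ _; split; first exact: H0.
  have [T] : exists T : 'I_(ceil_div k 12) -> nat * nat, orbit_basis false k.-1 T.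
    by apply: orbit_basis_even; rewrite /ceil_div; lia.
  have -> : false = ~~ odd k by lia.
  exact: H1.
- rewrite ek => _ _ /(_ isT) H0 /(_ isT) H1; split; last exact: H1.
  (* The degree is now k + 1 = 3 mod 4, which 12 does not divide, so (k + 1) / 12 and k / 12 round
     down alike. *)
  have [T] : exists T : 'I_(k %/ 12) -> nat * nat, orbit_basis true k.+1 T.
    by apply: orbit_basis_odd; lia.
  have -> : true = ~~ odd k by lia.
  exact: H0.
rewrite ek => _ _ /(_ isT) H0 /(_ isT) H1; split; last exact: H1.
have [T] : exists T : 'I_(ceil_div (k + 2) 12) -> nat * nat, orbit_basis false k.+1 T.
  by apply: orbit_basis_even; rewrite /ceil_div; lia.
have -> : false = ~~ odd k by lia.
exact: H0.
Qed.
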